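(* Let $\mathcal N$ be a semifinite von Neumann algebra with faithful normal semifinite trace $\tau$. If $D$ is $\theta$-summable relative to $\mathcal N$ and $\epsilon>0$, then $$\tfrac12\,\eta_\epsilon(D)=\gamma_0(\sqrt\epsilon D)-\tfrac12\,\tau([\ker(D)]),$$ where $[\ker(D)]$ is the projection on $\ker(D)$.
   Context: $\mathcal N$ has separable predual. $D$ is $\theta$-summable relative to $\mathcal N$ if it is an unbounded self-adjoint operator affiliated with $\mathcal N$ and $e^{-tD^2}$ is trace-class ($\tau(e^{-tD^2})<\infty$) for all $t>0$. The truncated eta invariant is the (convergent) integral $$\eta_\epsilon(D)=\frac1{\sqrt\pi}\int_\epsilon^\infty\tau\big(De^{-tD^2}\big)t^{-1/2}dt.$$ For such $D$ put $F=D(1+D^2)^{-1/2}$, $\tilde F=\operatorname{sign}(F)$ with $\operatorname{sign}(x)=1$ for $x\ge0$ and $-1$ for $x<0$, $F_t=F+t(\tilde F-F)$ for $t\in[0,1]$, and $$\gamma_0(D)=\frac{e}{\sqrt\pi}\int_0^1\tau\Big((\tilde F-F)\,|1-F_t^2|^{-3/2}e^{-|1-F_t^2|^{-1}}\Big)dt,$$ where the function $x\mapsto x^{-3/2}e^{-1/x}$ on $[0,\infty)$ is defined to be $0$ at $x=0$ (note $\int_{-1}^1(1-u^2)^{-3/2}e^{-(1-u^2)^{-1}}du=\sqrt\pi/e$). *)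

(* Defs.v *)
From HB Require Import structures.
From mathcomp Require Import all_boot all_order all_algebra.
From mathcomp Require Import sesquilinear complex.
From mathcomp Require Import all_classical all_reals all_analysis.

Set Implicit Arguments.
Unset Strict Implicit.
Unset Printing Implicit Defensive.

Import Order.TTheory GRing.Theory Num.Theory numFieldNormedType.Exports.

Local Open Scope classical_set_scope.
Local Open Scope complex_scope.
Local Open Scope ring_scope.

(* The inner product is linear in its first argument. *)
Record hilbertType (R : realType) := HilbertType {
  hcarrier :> completeNormedModType R[i];
  hdot : {dot hcarrier for @Num.conj R[i]};
  hdotE : forall x : hcarrier, `|x| ^+ 2 = hdot x x }.

Section BoundedOperators.
Context {R : realType} {H : hilbertType R}.
Implicit Types (A B S T U P : H -> H) (M : set (H -> H)).

Definition bounded_op T : Prop := linear T /\ continuous T.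

Definition adjoint_of T S : Prop := forall x y, hdot H (T x) y = hdot H x (S y).

(* On R[i], [0 <= z] says that z is real and nonnegative. *)
Definition positive_op T : Prop := forall x, 0 <= hdot H (T x) x.

Definition op_le S T : Prop := positive_op (T - S).

Definition unitary_op U : Prop :=
  [/\ bounded_op U, forall x y, hdot H (U x) (U y) = hdot H x y &
      forall y, exists x, U x = y].

Definition orthogonal_projection P : Prop :=
  [/\ bounded_op P, P \o P = P & adjoint_of P P].

Definition commutant M : set (H -> H) :=
  [set T | bounded_op T /\ forall S, M S -> T \o S = S \o T].

(* M = M'' makes M a unital, weakly closed subalgebra of B(H). *)
Record von_neumann_algebra M : Prop := VonNeumannAlgebra {
  vna_bounded : forall T, M T -> bounded_op T;
  vna_adjoint : forall T, M T -> exists2 S, M S & adjoint_of T S;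
  vna_bicommutant : commutant (commutant M) = M }.

Definition positive_part M : set (H -> H) := [set T | M T /\ positive_op T].

(* The predual of M: the sigma-weakly continuous functionals
   T |-> \sum_n <T x_n, y_n> with \sum_n |x_n|^2 and \sum_n |y_n|^2 finite. *)
Definition normal_functional M (phi : (H -> H) -> R[i]) : Prop :=
  exists x y : nat -> H,
    [/\ cvgn (series (fun n => `|x n| ^+ 2)),
        cvgn (series (fun n => `|y n| ^+ 2)) &
        forall T, M T -> 
          series (fun n => hdot H (T (x n)) (y n) : R[i]^o) @ \oo
            --> (phi T : R[i]^o)].

Definition separable_predual M : Prop :=
  exists2 phi_ : nat -> (H -> H) -> R[i],
    forall k, normal_functional M (phi_ k) &
    forall phi, normal_functional M phi -> forall e : R, 0 < e ->
      exists k, forall T, M T -> (forall x, `|T x| <= `|x|) ->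
        `|phi T - phi_ k T| <= e%:C.

Definition op_supremum M (A : set (H -> H)) T : Prop :=
  [/\ positive_part M T, forall S, A S -> op_le S T &
      forall T', positive_part M T' -> (forall S, A S -> op_le S T') ->
        op_le T T'].

(* Only the values of tau on the positive part of M matter. *)
Record faithful_normal_semifinite_trace M (tau : (H -> H) -> \bar R) : Prop :=
  FaithfulNormalSemifiniteTrace {
  trace_ge0 : forall T, positive_part M T -> (0 <= tau T)%E;
  traceD : forall S T, positive_part M S -> positive_part M T ->
    tau (S + T) = (tau S + tau T)%E;
  traceZ : forall (c : R) T, 0 <= c -> positive_part M T ->
    tau (fun x => c%:C *: T x) = (c%:E * tau T)%E;
  trace_comm : forall T S, M T -> M S -> adjoint_of T S ->
    tau (S \o T) = tau (T \o S);
  trace_faithful : forall T, positive_part M T -> tau T = 0%E -> T = 0;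
  trace_normal : forall (A : set (H -> H)) T,
    A !=set0 -> A `<=` positive_part M ->
    (forall S1 S2, A S1 -> A S2 ->
      exists S, [/\ A S, op_le S1 S & op_le S2 S]) ->
    op_supremum M A T -> tau T = ereal_sup (tau @` A);
  trace_semifinite : forall T, positive_part M T -> T <> 0 ->
    exists S, [/\ positive_part M S, op_le S T, S <> 0 & (tau S < +oo)%E] }.

(* The extension of tau to the self-adjoint trace-class elements of M, which
   are the differences of positive elements of finite trace; 0 elsewhere. *)
Definition trace M (tau : (H -> H) -> \bar R) T : R :=
  xget 0 [set r | exists A B,
    [/\ positive_part M A /\ (tau A < +oo)%E,
        positive_part M B /\ (tau B < +oo)%E,
        T = A - B & r = fine (tau A) - fine (tau B)]].

(* The orthogonal projection onto the closed subspace K. *)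
Definition projection_on (K : set H) : H -> H :=
  xget 0 [set P | forall x, K (P x) /\
    forall y, K y -> hdot H (x - P x) y = 0].

End BoundedOperators.

(* Possibly unbounded operators; [opfun] is irrelevant outside [opdom]. *)
Record operator (R : realType) (H : hilbertType R) := Operator {
  opdom : set H;
  opfun : H -> H }.

(* Projection-valued measures on the line.  [pvm_measure E x] is the scalar
   measure B |-> <E(B) x, x>: its sigma-additivity for every x is the
   (weak, equivalently strong) sigma-additivity of E. *)
Record pvm (R : realType) (H : hilbertType R) := Pvm {
  pvm_proj : set R -> H -> H;
  pvm_measure : H -> {measure set (measurableTypeR R) -> \bar R};
  pvm_projP : forall B : set (measurableTypeR R), measurable B ->
    orthogonal_projection (pvm_proj B);
  pvm_projT : pvm_proj setT = id;
  pvm_measureE : forall x (B : set (measurableTypeR R)), measurable B ->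
    hdot H (pvm_proj B x) x = (fine (pvm_measure x B))%:C /\
    pvm_measure x B \is a fin_num }.

Section UnboundedOperators.
Context {R : realType} {H : hilbertType R}.
Implicit Types (D : operator H) (T : H -> H) (M : set (H -> H)).

(* The last clause says that the graph of the adjoint of D is that of D. *)
Definition self_adjoint D : Prop :=
  [/\ forall (a : R[i]) x y, opdom D x -> opdom D y ->
        opdom D (a *: x + y) /\
        opfun D (a *: x + y) = a *: opfun D x + opfun D y,
      dense (opdom D) &
      forall y z, (forall x, opdom D x -> hdot H (opfun D x) y = hdot H x z) <->
        opdom D y /\ opfun D y = z].

Definition affiliated M D : Prop :=
  forall U, unitary_op U -> commutant M U -> forall x, opdom D x ->
    opdom D (U x) /\ opfun D (U x) = U (opfun D x).

Definition total_op T : operator H := Operator setT T.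

Definition scale_op (s : R) D : operator H :=
  Operator (opdom D) (fun x => s%:C *: opfun D x).

Definition op_kernel D : set H := [set x | opdom D x /\ opfun D x = 0].

(* D is the integral of r dE(r), with domain {x | \int r^2 d<E x,x> finite}. *)
Definition spectral_resolution D (E : pvm H) : Prop :=
  (forall x, opdom D x <->
    (pvm_measure E x).-integrable setT (fun r => (r ^+ 2)%:E)) /\
  (forall x, opdom D x ->
    hdot H (opfun D x) x = (\int[pvm_measure E x]_r r)%R%:C).

(* T is f(D), the integral of f(r) dE(r), for a Borel function f such that
   this operator is everywhere defined.  A linear map is determined by its
   quadratic form. *)
Definition is_fcalc D (f : R -> R) T : Prop :=
  exists2 E : pvm H, spectral_resolution D E &
    [/\ measurable_fun setT (f : measurableTypeR R -> R), linear T,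
        forall x, (pvm_measure E x).-integrable setT (fun r => (f r ^+ 2)%:E) &
        forall x, hdot H (T x) x = (\int[pvm_measure E x]_r f r)%R%:C].

Definition fcalc D (f : R -> R) : H -> H := xget 0 [set T | is_fcalc D f T].

Definition theta_summable M (tau : (H -> H) -> \bar R) D : Prop :=
  [/\ self_adjoint D, affiliated M D &
      forall t : R, 0 < t ->
        exists2 T, is_fcalc D (fun x => expR (- t * x ^+ 2)) T &
          (tau T < +oo)%E].

Definition truncated_eta M (tau : (H -> H) -> \bar R) (eps : R) D : \bar R :=
  ((Num.sqrt pi)^-1%:E *
   \int[lebesgue_measure]_(t in `[eps, +oo[)
     (trace M tau (opfun D \o fcalc D (fun x => expR (- t * x ^+ 2)))
      * t `^ (- 2^-1))%:E)%E.

Definition sign_fun (x : R) : R := if 0 <= x then 1 else -1.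

(* x |-> x^(-3/2) e^(-1/x), with value 0 at 0; it is only applied to
   nonnegative operators. *)
Definition cutoff_fun (x : R) : R :=
  if 0 < x then x `^ (- (3 / 2)) * expR (- x^-1) else 0.

(* D (1 + D^2)^(-1/2). *)
Definition bounded_transform D : H -> H :=
  opfun D \o fcalc D (fun x => (Num.sqrt (1 + x ^+ 2))^-1).

Definition sign_op T : H -> H := fcalc (total_op T) sign_fun.

(* F_t for F = T. *)
Definition sign_path T (t : R) : H -> H :=
  T + (fun x => t%:C *: (sign_op T - T) x).

(* |1 - T^2|^(-3/2) e^(-|1 - T^2|^(-1)). *)
Definition cutoff_op T : H -> H :=
  fcalc (total_op (fcalc (total_op (idfun - (T \o T))) Num.norm)) cutoff_fun.

Definition gamma0 M (tau : (H -> H) -> \bar R) D : \bar R :=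
  let F := bounded_transform D in
  ((expR 1 / Num.sqrt pi)%:E *
   \int[lebesgue_measure]_(t in `[0%R, 1%R])
     (trace M tau ((sign_op F - F) \o cutoff_op (sign_path F t)))%:E)%E.

End UnboundedOperators.

(* Main.v *)
(* The spectral projections of D lie in N, so that nu(B) = tau(E(B)) is a measure on
   the line, tau(f(D)) is the integral of f against nu, and theta-summability makes
   nu sigma-finite and Gaussian functions integrable. With s = sqrt eps, both sides
   of the formula become double integrals, and by Fubini it suffices to compare
   their kernels at each r. Put J(r) = sign(r) * (integral of exp(-v^2) over
   v >= s |r|). The substitution v = sqrt t |r| gives
     integral over t >= eps of r exp(-t r^2) t^(-1/2) = 2 J(r) - sqrt pi * 1_{r = 0},
   and the substitution v = u (1 - u^2)^(-1/2), where u is the value of F_t, gives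
   e^-1 J(r) for the kernel of gamma_0. The correction at r = 0 has nu-mass
   tau([ker D]). *)
Require Import Defs.
From HB Require Import structures.
From mathcomp Require Import finmap.
From mathcomp Require Import all_boot all_order all_algebra.
From mathcomp Require Import sesquilinear complex.
From mathcomp Require Import all_classical all_reals all_analysis.
From mathcomp Require Import measurable_realfun.
From mathcomp Require Import ring lra.

Set Implicit Arguments.
Unset Strict Implicit.
Unset Printing Implicit Defensive.

Import Order.TTheory GRing.Theory Num.Theory numFieldNormedType.Exports.

Local Open Scope classical_set_scope.
Local Open Scope ring_scope.

(** * One-dimensional integrals *)

(** [fcalc], [trace] and [projection_on] are choices: each picks some object meeting a
    specification, possibly through another spectral resolution than the one at hand. The bulk of
    the work is therefore uniqueness: two resolutions of [D] have the same scalar measures, so that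
    every operator of the statement is [Phi E f] for a single [E] and a bounded Borel [f]. The
    calculus is for real functions, hence resolvents are replaced by (1 + (D - a)^2)^-1, which is
    characterised by the equation that it solves, without mention of [E]; its spectral subspaces are
    read off the growth of its powers. The same uniqueness puts the spectral projections in N:
    affiliation speaks of unitaries of the commutant only, and these carry a resolution of [D] to
    another one. On the scalar side both uses of Fubini need a bound that is Gaussian in r. Half of
    the exponent of exp(-1/x) absorbs x^(-3/2); the other half, with x <= 1 / (1 + r^2), leaves a
    Gaussian that theta-summability integrates. *)

Section Cutoff.
Context {R : realType}.
Implicit Types (x y t u a r s : R).

(** The maximum of y^(3/2) exp(-y/2) over y > 0, attained at y = 3. *)
Definition cutoff_const : R := expR (3 / 2 * (ln 3 - 1)).

Lemma cutoff_fun_ge0 x : 0 <= cutoff_fun x.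
Proof.
by rewrite /cutoff_fun; case: ifP => // _; rewrite mulr_ge0 ?powR_ge0 ?expR_ge0.
Qed.

(* ln y <= y / 3 + ln 3 - 1, applied to y = 1 / x. *)
Lemma cutoff_fun_le x : 0 < x -> cutoff_fun x <= cutoff_const * expR (- x^-1 / 2).
Proof.
move=> x0; rewrite /cutoff_fun x0 /powR gt_eqF// /cutoff_const -!expRD ler_expR.
have y0 : 0 < x^-1 by rewrite invr_gt0.
have : ln (x^-1 / 3) <= x^-1 / 3 - 1.
  by rewrite -[X in ln X](subrKC 1) le_ln1Dx// ltrBrDl subrr divr_gt0.
rewrite lnM ?posrE ?invr_gt0// !lnV ?posrE//; lra.
Qed.

Lemma cutoff_fun_le_const x : cutoff_fun x <= cutoff_const.
Proof.
have [x0|x0] := ltP 0 x; last first.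
  by rewrite /cutoff_fun ltNge x0 /= expR_ge0.
apply: le_trans (cutoff_fun_le x0) _; rewrite ler_piMr ?expR_ge0//.
by rewrite -expR0 ler_expR mulNr oppr_le0 divr_ge0// invr_ge0 ltW.
Qed.

(** The remaining factor exp(-1/(2x)) is at most 2x, by exp(y) >= 1 + y at y = 1/(2x). This gives
    the continuity of [cutoff_fun] at 0. *)
Lemma cutoff_fun_le_lin x : 0 <= x -> cutoff_fun x <= cutoff_const * (2 * x).
Proof.
rewrite le_eqVlt => /predU1P[<-|x0]; first by rewrite /cutoff_fun ltxx !mulr0.
apply: le_trans (cutoff_fun_le x0) _; rewrite ler_pM2l ?expR_gt0//.
rewrite mulNr expRN -[leRHS]invrK lef_pV2 ?posrE ?expR_gt0 ?invr_gt0 ?mulr_gt0//.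
apply: le_trans (expR_ge1Dx _); rewrite invfM mulrC lerDr//.
Qed.

Lemma cutoff_fun_continuous : continuous (cutoff_fun : R -> R).
Proof.
move=> x; have [x0|x0|x0] := ltgtP x 0.
- rewrite /continuous_at {2}/cutoff_fun ltNge ltW//=.
  apply: cvg_near_cst; near=> y; rewrite /cutoff_fun ltNge (_ : y <= 0)//; apply/ltW.
  by near: y; exact: lt_nbhsl.
- have c : {for x, continuous (fun y => y `^ (- (3 / 2)) * expR (- y^-1))}.
    have cp : {for x, continuous (fun y => y `^ (- (3 / 2)))}.
      by apply/differentiable_continuous/derivable1_diffP; apply: derivable_powR; rewrite in_itv/= x0.
    apply: cvgM; first exact: cp.
    apply: continuous_comp; last exact: continuous_expR.
    by apply: cvgN; apply: cvgV => //; rewrite gt_eqF.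
  rewrite /continuous_at {2}/cutoff_fun x0.
  apply: cvg_trans c; apply: near_eq_cvg; near=> y; rewrite /cutoff_fun ifT//.
  by near: y; exact: lt_nbhsr.
- rewrite x0 /continuous_at {2}/cutoff_fun ltxx.
  apply: (@squeeze_cvgr _ _ _ _ (fun=> 0) (fun y => cutoff_const * (2 * `|y|))).
  + near=> y; rewrite cutoff_fun_ge0/=; have [y0|y0] := leP 0 y.
      by rewrite (le_trans (cutoff_fun_le_lin y0))// ger0_norm.
    by rewrite /cutoff_fun ltNge (ltW y0)/= mulr_ge0 ?expR_ge0// mulr_ge0.
  + exact: cvg_cst.
  + have : (fun y => cutoff_const * (2 * `|y|)) @ (0 : R) --> cutoff_const * (2 * `|0 : R|).
      apply: cvgM; first exact: cvg_cst.
      by apply: cvgM; [exact: cvg_cst|exact: norm_continuous].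
    by rewrite normr0 !mulr0.
Unshelve. all: end_near. Qed.

End Cutoff.

(** * The Gaussian integral and its tail *)

Section GaussianPrimitive.
Context {R : realType}.
Notation mu := (@lebesgue_measure R).
Implicit Types (x y t u a r s : R).

(** The base point is -oo rather than 0, so that the function is differentiable on the whole line, 0
    included. *)
Definition gauss_primitive (x : R) : R := \int[mu]_(t in `]-oo, x]) gauss_fun t.

Lemma is_derive_gauss_primitive x : is_derive x 1 gauss_primitive (gauss_fun x).
Proof.
have int : mu.-integrable [set` Interval -oo%O (BRight (x + 1))] (EFin \o gauss_fun).
  by apply: integrableS integrableT_gauss.
have x1 : x < x + 1 by rewrite ltrDl.
have [d e] : derivable gauss_primitive x 1 /\ gauss_primitive^`()%classic x = gauss_fun x.
  by apply: (continuous_FTC1 x1 int); [rewrite ltNyr|exact: continuous_gauss_fun].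
by apply: DeriveDef; [exact: d|rewrite -derive1E e].
Qed.

Lemma gauss_primitiveE x : 0 <= x ->
  gauss_primitive x = gauss_primitive 0 + gauss_integral_proof.integral0_gauss x.
Proof.
move=> x0; have int : mu.-integrable `]-oo, x] (EFin \o gauss_fun).
  by apply: integrableS integrableT_gauss.
suff <- : gauss_primitive x - gauss_primitive 0 = gauss_integral_proof.integral0_gauss x.
  by rewrite subrKC.
have := Rintegral_itvB int (x := 0); rewrite bnd_simp => /(_ isT); rewrite bnd_simp => /(_ x0) ->.
rewrite Rintegral_itv_obnd_cbnd//.
by apply: integrableS integrableT_gauss.
Qed.

Lemma gauss_primitive_cvg :
  gauss_primitive x @[x --> +oo] --> gauss_primitive 0 + Num.sqrt pi / 2.
Proof.
have c : gauss_integral_proof.integral0_gauss x @[x --> +oo] --> (Num.sqrt pi / 2 : R).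
  (* The known limit is that of the square; the integral being nonnegative, a square root recovers
     its own limit. *)
  have : Num.sqrt (@gauss_integral_proof.integral0_gauss R x ^+ 2) @[x --> +oo]
      --> Num.sqrt (pi / 4).
    apply: continuous_cvg => //;
      [exact: sqrt_continuous|exact: gauss_integral_proof.cvg_integral0_gauss_sqr].
  rewrite sqrtrM ?pi_ge0// sqrtrV// (_ : 4 = 2 ^+ 2); last by rewrite expr2 -natrM.
  rewrite sqrtr_sqr ger0_norm// (_ : (fun _ => Num.sqrt _) = gauss_integral_proof.integral0_gauss)//.
  apply/funext => r; rewrite sqrtr_sqr// ger0_norm//.
  exact: gauss_integral_proof.integral0_gauss_ge0.
have : gauss_primitive 0 + gauss_integral_proof.integral0_gauss x @[x --> +oo] -->
    gauss_primitive 0 + Num.sqrt pi / 2.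
  by apply: cvgD; [exact: cvg_cst|exact: c].
apply: cvg_trans; apply: near_eq_cvg; near=> x.
have x0 : 0 <= x by near: x; exact: nbhs_pinfty_ge.
by rewrite /= [in RHS]gauss_primitiveE.
Unshelve. all: end_near. Qed.

(* The integral of exp(- v ^ 2) over v >= x. *)
Definition gauss_tail x : R := gauss_primitive 0 + Num.sqrt pi / 2 - gauss_primitive x.

Lemma gauss_tail0 : gauss_tail 0 = Num.sqrt pi / 2.
Proof. by rewrite /gauss_tail addrAC subrr add0r. Qed.

End GaussianPrimitive.

Section TailIntegral.
Context {R : realType}.
Notation mu := (@lebesgue_measure R).
Implicit Types (x y t u a r s : R).

Lemma is_derive_continuous (f : R -> R) x d : is_derive x 1 f d -> {for x, continuous f}.
Proof. by move=> [df _]; apply/differentiable_continuous/derivable1_diffP. Qed.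

Lemma is_derive_mull (f : R -> R) k x d : is_derive x 1 f d ->
  is_derive x 1 (fun y => k * f y) (k * d).
Proof. by move=> h; exact: (@is_deriveZ _ _ _ f k x 1 d h). Qed.

Lemma sqrt_ge x y : 0 <= x -> x ^+ 2 <= y -> x <= Num.sqrt y.
Proof.
move=> x0 xy; rewrite -[leLHS]ger0_norm// -sqrtr_sqr ler_sqrt//.
exact: le_trans (sqr_ge0 _) xy.
Qed.

Lemma powRN12 x : 0 <= x -> x `^ (- 2^-1) = (Num.sqrt x)^-1.
Proof. by move=> x0; rewrite powRN powR12_sqrt. Qed.

(** The primitive [F] comes from v = sqrt t * r. The fundamental theorem on a half-line is applied
    to a nonnegative integrand, whence [0 < r]; negative r will follow by oddness. *)
Lemma gauss_tail_integral r e : 0 < r -> 0 < e ->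
  (\int[mu]_(t in `[e, +oo[) (r * expR (- t * r ^+ 2) * t `^ (- 2^-1))%:E)%E =
  (2 * gauss_tail (Num.sqrt e * r))%:E.
Proof.
move=> r0 e0; pose F t := 2 * gauss_primitive (Num.sqrt t * r).
have dF t : 0 < t -> is_derive t 1 F (r * expR (- t * r ^+ 2) * t `^ (- 2^-1)).
  move=> t0; have st0 : 0 < Num.sqrt t by rewrite sqrtr_gt0.
  have d1 := is_derive_gauss_primitive (Num.sqrt t * r).
  have d2 : is_derive t 1 (fun t => Num.sqrt t * r) ((2 * Num.sqrt t)^-1 * r).
    apply: is_derive_eq; first by apply: is_deriveM; exact: is_derive1_sqrt.
    by rewrite scaler0 add0r /GRing.scale/= mulrC.
  have d3 := @is_derive1_comp _ gauss_primitive (fun t => Num.sqrt t * r) t _ _ d1 d2.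
  have d4 : is_derive t 1 F (2 * (gauss_fun (Num.sqrt t * r) * ((2 * Num.sqrt t)^-1 * r))).
    exact: is_derive_mull d3.
  apply: is_derive_eq d4 _.
  rewrite powRN12 ?ltW// /gauss_fun exprMn sqr_sqrtr ?ltW// mulNr.
  by field; rewrite gt_eqF.
have cf t : 0 < t -> {for t, continuous (fun t => r * expR (- t * r ^+ 2) * t `^ (- 2^-1))}.
  move=> t0; have cp : {for t, continuous (fun y => y `^ (- 2^-1))}.
    by apply/differentiable_continuous/derivable1_diffP; apply: derivable_powR; rewrite in_itv/= t0.
  apply: cvgM; last exact: cp.
  apply: cvgM; first exact: cvg_cst.
  apply: continuous_comp; last exact: continuous_expR.
  by apply: cvgM; [exact: cvgN|exact: cvg_cst].
have e0t t : e <= t -> 0 < t by exact: lt_le_trans.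
rewrite (@ge0_continuous_FTC2y R _ F e (2 * (gauss_primitive 0 + Num.sqrt pi / 2))).
- by rewrite -EFinB /gauss_tail /F; congr EFin; ring.
- move=> t et; rewrite mulr_ge0 ?powR_ge0// mulr_ge0 ?expR_ge0// ltW//.
- apply: continuous_in_subspaceT => t; rewrite inE/= in_itv/= andbT => et.
  by apply: cf; exact: e0t.
- apply: cvgM; first exact: cvg_cst.
  apply: (cvg_comp _ _ _ gauss_primitive_cvg).
  apply/cvgryPge => A; near=> t.
  have : `|A| / r <= Num.sqrt t.
    apply: sqrt_ge; first by rewrite divr_ge0// ltW.
    by near: t; apply: nbhs_pinfty_ge; exact: num_real.
  by rewrite ler_pdivrMr//; apply: le_trans; exact: ler_norm.
- by move=> t et; have [] := dF t (e0t _ (ltW et)).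
- apply: cvg_at_right_filter; exact: is_derive_continuous (dF e e0).
- move=> t; rewrite in_itv/= andbT => et.
  by rewrite derive1E; have [_ ->] := dF t (e0t _ (ltW et)).
Unshelve. all: end_near. Qed.

End TailIntegral.

(** * The cutoff integrated along the path from the bounded transform to its sign *)

Section CutoffIntegral.
Context {R : realType}.
Notation mu := (@lebesgue_measure R).
Implicit Types (x y t u a r s : R).

Definition bounded_part a := a / Num.sqrt (1 + a ^+ 2).

Lemma oneDsqr_gt0 a : 0 < 1 + a ^+ 2.
Proof. by rewrite ltr_pwDl// sqr_ge0. Qed.

Lemma bounded_part_sqr a : 1 - bounded_part a ^+ 2 = (1 + a ^+ 2)^-1.
Proof.
rewrite /bounded_part expr_div_n sqr_sqrtr; last exact: ltW (oneDsqr_gt0 a).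
by field; rewrite gt_eqF// oneDsqr_gt0.
Qed.

(** The inverse of [bounded_part] on ]-1, 1[. *)
Definition slope u := u / Num.sqrt (1 - u ^+ 2).

Lemma slope_bounded_part a : slope (bounded_part a) = a.
Proof.
rewrite /slope bounded_part_sqr sqrtrV ?(ltW (oneDsqr_gt0 a))// invrK /bounded_part.
by rewrite divfK// gt_eqF// sqrtr_gt0 oneDsqr_gt0.
Qed.

(** The derivative of u / q is 1 / q + u^2 / q^3, and q^2 + u^2 = 1. *)
Lemma is_derive_slope u (q := Num.sqrt (1 - u ^+ 2)) : u ^+ 2 < 1 ->
  is_derive u 1 slope (q ^- 3).
Proof.
move=> u1; have w0 : 0 < 1 - u ^+ 2 by rewrite subr_gt0.
have q0 : q != 0 by rewrite gt_eqF// sqrtr_gt0.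
have d1 : is_derive u 1 (fun u => 1 - u ^+ 2) (- 2 * u).
  by apply: is_derive_eq; rewrite /GRing.scale/= ?expr1; ring.
have d2 : is_derive u 1 (fun u => Num.sqrt (1 - u ^+ 2)) ((2 * q)^-1 * (- 2 * u)).
  exact: (@is_derive1_comp _ Num.sqrt (fun u => 1 - u ^+ 2) u _ _ (is_derive1_sqrt w0) d1).
have d3 := @is_deriveV _ (fun u => Num.sqrt (1 - u ^+ 2)) u _ 1 q0 d2.
have d4 := @is_deriveM _ _ id (fun u => (Num.sqrt (1 - u ^+ 2))^-1) u 1 _ _ (is_derive_id u 1) d3.
apply: is_derive_eq d4 _; rewrite /GRing.scale/= -/q.
have qq : u ^+ 2 = 1 - q ^+ 2 by rewrite sqr_sqrtr ?ltW//; ring.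
transitivity ((q ^+ 2 + u ^+ 2) / q ^+ 3); first by field.
by rewrite qq; field.
Qed.

(* With v = slope u, dv = q^-3 du, so that cutoff_fun (1 - u ^ 2) du is e^-1 exp (- v ^ 2) dv. *)
Lemma cutoff_slope u (q := Num.sqrt (1 - u ^+ 2)) : u ^+ 2 < 1 ->
  expR (-1) * (gauss_fun (slope u) * q ^- 3) = cutoff_fun (1 - u ^+ 2).
Proof.
move=> u1; have w0 : 0 < 1 - u ^+ 2 by rewrite subr_gt0.
have qw : q ^+ 2 = 1 - u ^+ 2 by rewrite sqr_sqrtr ?ltW.
rewrite /cutoff_fun w0 mulrA -expRD mulrC; congr (_ * expR _).
  rewrite powRN; congr (_^-1).
  rewrite (_ : 3 / 2 = 1 + 2^-1); last by field.
  rewrite powRD; last by rewrite gt_eqF// implybT.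
  by rewrite powRr1 ?ltW// powR12_sqrt ?ltW// -/q -qw exprSr.
rewrite /slope expr_div_n -/q qw; field.
by rewrite gt_eqF.
Qed.

(** For a >= 0 the sign is 1 and the path runs from p to 1. In the variable [slope] it runs from a
    to +oo, so that the integral is a Gaussian tail. *)
Lemma cutoff_integral a (p := bounded_part a) : 0 <= a ->
  (\int[mu]_(t in `[0%R, 1%R])
     ((1 - p) * cutoff_fun (1 - (p + t * (1 - p)) ^+ 2))%:E)%E =
  (expR (-1) * gauss_tail a)%:E.
Proof.
move=> a0; pose L : R := gauss_primitive 0 + Num.sqrt pi / 2.
pose P t := p + t * (1 - p).
have p0 : 0 <= p by rewrite divr_ge0 ?sqrtr_ge0.
have p1 : p < 1.
  have := bounded_part_sqr a; rewrite -/p => h.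
  have : 0 < 1 - p ^+ 2 by rewrite h invr_gt0 oneDsqr_gt0.
  rewrite expr2; nra.
have P01 t : 0 <= t -> t < 1 -> 0 <= P t < 1 by move=> t0 t1; rewrite /P; apply/andP; split; nra.
have Psq t : 0 <= t -> t < 1 -> P t ^+ 2 < 1.
  by move=> t0 t1; have /andP[? ?] := P01 t t0 t1; rewrite expr2; nra.
(* [slope] blows up at the endpoint t = 1, so the primitive is given its limit there by hand. *)
pose F t := if t < 1 then expR (-1) * gauss_primitive (slope (P t)) else expR (-1) * L.
have dF t : 0 <= t -> t < 1 ->
    is_derive t 1 F ((1 - p) * cutoff_fun (1 - P t ^+ 2)).
  move=> t0 t1; have d1 := is_derive_slope (Psq t t0 t1).
  have d2 : is_derive t 1 P (1 - p).
    by apply: is_derive_eq; rewrite /GRing.scale/=; ring.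
  have d3 := @is_derive1_comp _ gauss_primitive (slope \o P) t _ _
    (is_derive_gauss_primitive _) (@is_derive1_comp _ slope P t _ _ d1 d2).
  have d4 := is_derive_mull (expR (-1)) d3.
  apply: (@near_eq_is_derive _ _ _ (fun t => expR (-1) * gauss_primitive (slope (P t)))) => //.
    near=> x; rewrite /F ifT//; near: x; exact: lt_nbhsl.
  apply: is_derive_eq d4 _.
  by rewrite -cutoff_slope ?Psq// /GRing.scale/=; ring.
rewrite (@continuous_FTC2 R _ F)//.
- rewrite /F ltxx ltr01 /P mul0r addr0 slope_bounded_part /gauss_tail -EFinB; congr EFin.
  by rewrite mulrBr.
- apply: continuous_subspaceT => t.
  have cP : {for t, continuous P}.
    by apply: cvgD; [exact: cvg_cst|apply: cvgM; [exact: cvg_id|exact: cvg_cst]].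
  have cw : {for t, continuous (fun t => 1 - P t ^+ 2)}.
    by apply: cvgB; [exact: cvg_cst|apply: cvgM; exact: cP].
  apply: cvgM; first exact: cvg_cst.
  exact: (@continuous_comp _ _ _ (fun t => 1 - P t ^+ 2) cutoff_fun t cw
    (@cutoff_fun_continuous R _)).
- split.
  + by move=> t; rewrite in_itv/= => /andP[/ltW t0 t1]; have [] := dF t t0 t1.
  + by apply: cvg_at_right_filter; exact: is_derive_continuous (dF 0 (lexx 0) ltr01).
  + rewrite {2}/F ltxx.
    have : expR (-1) * gauss_primitive (slope (P t)) @[t --> 1^'-] --> expR (-1) * L.
      apply: cvgM; first exact: cvg_cst.
      apply: (cvg_comp _ _ _ gauss_primitive_cvg).
      apply/cvgryPge => A.
      (* P t >= 1 - d / 2 gives 1 - P t ^+ 2 <= d, which bounds the denominator of [slope] by 1 / (2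
         (|A| + 1)); with P t >= 1/2 the slope is then at least |A| + 1. *)
      pose d := ((2 * (`|A| + 1))^-1) ^+ 2.
      have d0 : 0 < d by rewrite exprn_gt0// invr_gt0 mulr_gt0// ltr_wpDl.
      have cP : P t @[t --> 1^'-] --> P 1.
        apply: cvg_at_left_filter.
        by apply: cvgD; [exact: cvg_cst|apply: cvgM; [exact: cvg_id|exact: cvg_cst]].
      have P1 : P 1 = 1 by rewrite /P; ring.
      rewrite P1 in cP.
      near=> t.
      have t1 : t < 1 by near: t; exact: nbhs_left_lt.
      have t0 : 0 <= t by near: t; exact: nbhs_left_ge.
      have h1 : 2^-1 <= P t by near: t; apply: (cvgr_ge _ cP); lra.
      have h2 : 1 - d / 2 <= P t by near: t; apply: (cvgr_ge _ cP); lra.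
      have /andP[_ Pt1] := P01 t t0 t1.
      have w0 : 0 < 1 - P t ^+ 2 by rewrite subr_gt0 Psq.
      have w1 : 1 - P t ^+ 2 <= d by rewrite expr2; nra.
      have q1 : Num.sqrt (1 - P t ^+ 2) <= (2 * (`|A| + 1))^-1.
        rewrite -[leRHS]ger0_norm ?invr_ge0 ?mulr_ge0 ?addr_ge0//.
        by rewrite -sqrtr_sqr ler_sqrt// sqr_ge0.
      have q0 : 0 < Num.sqrt (1 - P t ^+ 2) by rewrite sqrtr_gt0.
      have : 2 * (`|A| + 1) <= (Num.sqrt (1 - P t ^+ 2))^-1.
        by rewrite -[leLHS]invrK lef_pV2 ?posrE// invr_gt0 mulr_gt0// ltr_wpDl.
      rewrite /slope; have := ler_norm A; have := normr_ge0 A; nra.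
    apply: cvg_trans; apply: near_eq_cvg; near=> t.
    have t1 : t < 1 by near: t; exact: nbhs_left_lt.
    by rewrite /F t1.
- move=> t; rewrite in_itv/= => /andP[/ltW t0 t1].
  by rewrite derive1E; have [_ ->] := dF t t0 t1.
Unshelve. all: end_near. Qed.

End CutoffIntegral.

(** * Fubini with a dominating function in r *)

Section Swap.
Context {R : realType}.
Notation mu := (@lebesgue_measure R).
Local Open Scope ereal_scope.

Lemma kernel_swap_sigma_finite
    (nu : {sigma_finite_measure set (measurableTypeR R) -> \bar R})
    (D : set (measurableTypeR R)) (k : R -> R -> R)
    (b : R -> R) :
  measurable D ->
  measurable_fun setT (fun z : measurableTypeR R * measurableTypeR R => k z.1 z.2) ->
  nu.-integrable setT (EFin \o b) ->
  (forall r, \int[mu]_(t in D) `|k r t|%:E <= (b r)%:E) ->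
  \int[mu]_(t in D) \int[nu]_r (k r t)%:E = \int[nu]_r \int[mu]_(t in D) (k r t)%:E.
Proof.
move=> mD mk ib kb.
(* The domain [D] becomes an indicator, so that Fubini applies on the whole product; absolute
   integrability follows from Tonelli and the bound [b] on the inner integrals. *)
pose f z := ((k z.1 z.2) * \1_D z.2)%:E.
have mf : measurable_fun setT f.
  apply/measurable_EFinP; apply: measurable_funM => //.
  by apply: measurableT_comp => //; exact: measurable_indic.
have eD (h : R -> R) : \int[mu]_(t in D) (h t)%:E = \int[mu]_t (h t * \1_D t)%:E.
  rewrite integral_mkcond; apply: eq_integral => t _; rewrite /patch indicE.
  by case: ifP => _; rewrite ?mulr1 ?mulr0.
have int : (nu \x mu).-integrable setT f.
  have eF r : \int[mu]_t `|f (r, t)| = \int[mu]_(t in D) `|k r t|%:E.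
    rewrite (eD (fun t => `|k r t|%R)).
    apply: eq_integral => t _; rewrite /f /= normrM.
    by rewrite indicE (ger0_norm (ler0n R _)).
  apply/(integrable12ltyP nu mu mf); have /integrableP[mb] := ib; apply: le_lt_trans.
  apply: ge0_le_integral => //.
  - by move=> r _; exact: integral_ge0.
  - apply: (measurable_fun_fubini_tonelli_F (m2 := mu) (abse \o f)) => [|z]; last exact: abse_ge0.
    exact: (measurableT_comp (@abse_measurable R setT) mf).
  - exact: measurableT_comp.
  - by move=> r _; rewrite eF (le_trans (kb r))//= lee_fin ler_norm.
have := Fubini int; rewrite /f /= => F.
transitivity (\int[nu]_r \int[mu]_t (k r t * \1_D t)%:E); last first.
  by apply: eq_integral => r _; rewrite eD.
rewrite F.
rewrite integral_mkcond; apply: eq_integral => t _; rewrite /patch indicE.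
case: ifP => _; first by apply: eq_integral => r _; rewrite mulr1.
by under eq_integral do rewrite mulr0; rewrite integral0.
Qed.

(** The measure used later is sigma-finite by a theorem that depends on theta-summability, not by
    its construction; here that fact is turned into the structure which Fubini requires. *)
Lemma kernel_swap (nu : {measure set (measurableTypeR R) -> \bar R})
    (D : set (measurableTypeR R)) (k : R -> R -> R)
    (b : R -> R) :
  sigma_finite setT nu -> measurable D ->
  measurable_fun setT (fun z : measurableTypeR R * measurableTypeR R => k z.1 z.2) ->
  nu.-integrable setT (EFin \o b) ->
  (forall r, \int[mu]_(t in D) `|k r t|%:E <= (b r)%:E) ->
  \int[mu]_(t in D) \int[nu]_r (k r t)%:E = \int[nu]_r \int[mu]_(t in D) (k r t)%:E.
Proof.
move=> sf.
pose H1 := isSFinite.Build _ _ _ _ (sfinite_measure_sigma_finite sf).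
pose H2 := isSigmaFinite.Build _ _ _ _ sf.
pose nu' := HB.pack_for (SigmaFiniteMeasure.type (measurableTypeR R) R) (Measure.sort nu) H1 H2.
exact: (@kernel_swap_sigma_finite nu').
Qed.

End Swap.

(** * Hilbert space and bounded operators *)

Local Open Scope complex_scope.
Local Open Scope ring_scope.

Lemma cReD (R : realType) (x y : R[i]) : complex.Re (x + y) = complex.Re x + complex.Re y.
Proof. by case: x y => [a b] [c d]. Qed.
Lemma cReN (R : realType) (x : R[i]) : complex.Re (- x) = - complex.Re x.
Proof. by case: x. Qed.
Lemma cReZ (R : realType) (c : R) (x : R[i]) : complex.Re (c%:C * x) = c * complex.Re x.
Proof. by case: x => [a b] /=; rewrite mul0r subr0. Qed.
Lemma cReiM (R : realType) (x : R[i]) : complex.Re ('i * x) = - complex.Im x.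
Proof. by case: x => [a b] /=; rewrite mul0r mul1r sub0r. Qed.
Lemma cRe_conj (R : realType) (x : R[i]) : complex.Re (Num.conj x) = complex.Re x.
Proof. by case: x. Qed.

Section Hilbert.
Context {R : realType} {H : hilbertType R}.
Implicit Types (x y z : H).

Local Notation "<[ x , y ]>" := (hdot H x y) (format "<[ x ,  y ]>").

(** The norm of [H] takes its values in R[i]; estimates are made on this real squared norm
    instead. *)
Definition nsq x : R := complex.Re <[x, x]>.

Lemma hdotC x y : <[x, y]> = Num.conj <[y, x]>.
Proof. by rewrite (@hermC _ false _ _ (hdot H)) /= expr0 mul1r. Qed.
Lemma hdotDl x y z : <[x + y, z]> = <[x, z]> + <[y, z]>.
Proof. exact: linearDl. Qed.
Lemma hdotDr x y z : <[z, x + y]> = <[z, x]> + <[z, y]>.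
Proof. by rewrite hdotC hdotDl rmorphD [in RHS]hdotC [<[z, y]>]hdotC. Qed.
Lemma hdotZl a x z : <[a *: x, z]> = a * <[x, z]>.
Proof. by rewrite linearZl_LR. Qed.
Lemma hdotZr a x z : <[z, a *: x]> = Num.conj a * <[z, x]>.
Proof. by rewrite hdotC hdotZl rmorphM [in RHS]hdotC. Qed.
Lemma hdotNl x z : <[- x, z]> = - <[x, z]>.
Proof. by rewrite -scaleN1r hdotZl mulN1r. Qed.
Lemma hdotNr x z : <[z, - x]> = - <[z, x]>.
Proof. by rewrite hdotC hdotNl rmorphN [in RHS]hdotC. Qed.
Lemma hdotBl x y z : <[x - y, z]> = <[x, z]> - <[y, z]>.
Proof. by rewrite hdotDl hdotNl. Qed.
Lemma hdotBr x y z : <[z, x - y]> = <[z, x]> - <[z, y]>.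
Proof. by rewrite hdotDr hdotNr. Qed.
Lemma hdot0l z : <[0, z]> = 0.
Proof. by rewrite -(subrr z) hdotBl subrr. Qed.
Lemma hdot0r z : <[z, 0]> = 0.
Proof. by rewrite -(subrr z) hdotBr subrr. Qed.

Lemma conj_real (c : R) : Num.conj (c%:C) = c%:C.
Proof. exact: conjc_real. Qed.

Lemma hdot_nsq x : <[x, x]> = (nsq x)%:C.
Proof.
rewrite /nsq; have := dnorm_ge0 (hdot H) x; case: <[x, x]> => a b.
by rewrite lecE /= => /andP[/eqP -> _].
Qed.
Lemma nsq_ge0 x : 0 <= nsq x.
Proof. by have := dnorm_ge0 (hdot H) x; rewrite lecE => /andP[]. Qed.
Lemma norm_nsq x : `|x| = (Num.sqrt (nsq x))%:C.
Proof.
apply/eqP; rewrite -(@eqrXn2 _ 2) ?normr_ge0 //; last first.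
  by rewrite lecR sqrtr_ge0.
by rewrite hdotE hdot_nsq -rmorphXn sqr_sqrtr ?nsq_ge0.
Qed.
Lemma nsq_eq0 x : nsq x = 0 -> x = 0.
Proof. by move=> x0; apply/eqP; rewrite -(dnorm_eq0 (hdot H)) hdot_nsq x0. Qed.
Lemma nsq0 : nsq 0 = 0. Proof. by rewrite /nsq hdot0l. Qed.
Lemma nsqN x : nsq (- x) = nsq x.
Proof. by rewrite /nsq hdotNl hdotNr opprK. Qed.
Lemma nsqD x y : nsq (x + y) = nsq x + nsq y + complex.Re <[x, y]> *+ 2.
Proof.
by rewrite /nsq hdotDl !hdotDr [<[y, x]>]hdotC !cReD cRe_conj mulr2n; ring.
Qed.
Lemma nsqB x y : nsq (x - y) = nsq x + nsq y - complex.Re <[x, y]> *+ 2.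
Proof. by rewrite nsqD nsqN hdotNr cReN mulNrn. Qed.
Lemma nsqZ (c : R[i]) x : nsq (c *: x) = complex.Re (c * Num.conj c) * nsq x.
Proof.
rewrite /nsq hdotZl hdotZr mulrA hdot_nsq.
by rewrite mulrC cReZ mulrC.
Qed.
Lemma nsqZr (c : R) x : nsq (c%:C *: x) = c ^+ 2 * nsq x.
Proof. by rewrite nsqZ conj_real /= mul0r subr0 expr2. Qed.

(** The quadratic polynomial t |-> nsq (x + t y) is nonnegative at its minimiser - b / nsq y. *)
Lemma hdot_CS x y : complex.Re <[x, y]> ^+ 2 <= nsq x * nsq y.
Proof.
set b := complex.Re _.
have q t : 0 <= nsq x + 2 * t * b + t ^+ 2 * nsq y.
  have := nsq_ge0 (x + t%:C *: y).
  rewrite nsqD nsqZr hdotZr conj_real cReZ -/b mulr2n; lra.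
have [y0|y0] := eqVneq (nsq y) 0.
  move/nsq_eq0: y0 => y0; rewrite /b y0 hdot0r /= expr0n mulr_ge0 ?nsq_ge0//.
have yp : 0 < nsq y by rewrite lt_def y0 nsq_ge0.
rewrite -subr_ge0.
have -> : nsq x * nsq y - b ^+ 2 =
    (nsq x + 2 * (- b / nsq y) * b + (- b / nsq y) ^+ 2 * nsq y) * nsq y.
  by field.
by rewrite mulr_ge0 ?nsq_ge0.
Qed.
Lemma hdot_CS_sqrt x y : `|complex.Re <[x, y]>| <= Num.sqrt (nsq x) * Num.sqrt (nsq y).
Proof.
rewrite -sqrtrM ?nsq_ge0// -sqrtr_sqr ler_sqrt ?hdot_CS//.
by rewrite mulr_ge0 ?nsq_ge0.
Qed.

Lemma nsqD_le x y : nsq (x + y) <= 2 * nsq x + 2 * nsq y.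
Proof.
have := nsq_ge0 (x - y); rewrite nsqB nsqD mulr2n; lra.
Qed.

Lemma hdot_eq x y : (forall z, <[x, z]> = <[y, z]>) -> x = y.
Proof.
move=> e; apply/eqP; rewrite -subr_eq0; apply/eqP/nsq_eq0.
by rewrite /nsq hdotBl e subrr.
Qed.

Lemma hdot_eq_re x y : (forall z, complex.Re <[x, z]> = complex.Re <[y, z]>) -> x = y.
Proof.
move=> e; apply/eqP; rewrite -subr_eq0; apply/eqP/nsq_eq0.
by rewrite /nsq hdotBl cReD cReN e subrr.
Qed.

Lemma cvg_nsqP (T : Type) (F : set_system T) (FF : Filter F) (u : T -> H) l :
  u @ F --> l <-> (fun t => nsq (l - u t)) @ F --> 0.
Proof.
split=> [/cvgrPdist_le h|/cvgrPdist_le h].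
  apply/cvgrPdist_le => e e0.
  have e1 : (0 : R[i]) < (Num.sqrt e)%:C by rewrite ltcR sqrtr_gt0.
  have := h _ e1; apply: filterS => t; rewrite norm_nsq lecR => h1.
  by rewrite sub0r normrN (ger0_norm (nsq_ge0 _)) -(ler_sqrt _ (ltW e0)).
(* In R[i], [0 < e] forces the imaginary part of [e] to vanish: radii are real. *)
apply/cvgrPdist_le => -[e f]; rewrite ltcE/= => /andP[/eqP -> e0].
have e1 : 0 < e ^+ 2 by rewrite exprn_gt0.
near=> t; have : `|0 - nsq (l - u t)| <= e ^+ 2 by near: t; exact: h.
rewrite sub0r normrN ger0_norm ?nsq_ge0// => h1.
rewrite norm_nsq -[_ +i* 0]/(e%:C) lecR -(ger0_norm (ltW e0)) -sqrtr_sqr.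
by rewrite ler_sqrt ?sqr_ge0.
Unshelve. all: end_near. Qed.

Lemma cauchy_nsq (u : nat -> H) :
  (forall e : R, 0 < e ->
    exists n, forall m, (n <= m)%N -> nsq (u m - u n) <= e) ->
  cvgn u.
Proof.
move=> h; apply: cauchy_cvg; apply: cauchy_exP => -[e f].
rewrite ltcE/= => /andP[/eqP -> e0].
have e1 : 0 < (e / 2) ^+ 2 by rewrite exprn_gt0 ?divr_gt0.
have [n hn] := h _ e1; exists (u n); rewrite -ball_normE /ball_ /=.
near=> m; rewrite /= distrC norm_nsq -[_ +i* 0]/(e%:C) ltcR.
apply: (@le_lt_trans _ _ (e / 2)); last by lra.
have e2 : 0 <= e / 2 by lra.
rewrite -[leRHS](ger0_norm e2) -sqrtr_sqr ler_sqrt ?sqr_ge0//.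
by apply: hn; near: m; exact: nbhs_infty_ge.
Unshelve. all: end_near. Qed.

Lemma cvg_nsq (T : Type) (F : set_system T) (FF : Filter F) (u : T -> H) l :
  u @ F --> l -> (fun t => nsq (u t)) @ F --> nsq l.
Proof.
move=> /cvg_nsqP ul.
have -> : (fun t => nsq (u t)) =
   (fun t => nsq l + nsq (l - u t) - complex.Re <[l, l - u t]> *+ 2).
  by apply/funext => t; rewrite -nsqB subKr.
have c0 : (fun t => complex.Re <[l, l - u t]>) @ F --> 0.
  apply/norm_cvg0P; apply: (@squeeze_cvgr _ _ _ _ (fun=> 0)
    (fun t => Num.sqrt (nsq l) * Num.sqrt (nsq (l - u t)))).
  - by apply: nearW => t; rewrite normr_ge0 hdot_CS_sqrt.
  - exact: cvg_cst.
  - rewrite -[X in _ --> X](mulr0 (Num.sqrt (nsq l))).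
    apply: cvgM; first exact: cvg_cst.
    rewrite -[X in _ --> X](@sqrtr0 R).
    by apply: continuous_cvg => //; exact: sqrt_continuous.
rewrite -[X in _ --> X]addr0 -[X in _ --> X]subr0.
apply: cvgB; first by apply: cvgD => //; exact: cvg_cst.
by rewrite -[X in _ --> X](mul0rn R 2); apply: cvgMn.
Qed.

(** Re <x, y> is half of nsq (x + y) - nsq x - nsq y, so joint continuity reduces to that of
    [nsq]. *)
Lemma cvg_hdot (T : Type) (F : set_system T) (FF : Filter F) (u v : T -> H) l m :
  u @ F --> l -> v @ F --> m ->
  (fun t => complex.Re <[u t, v t]>) @ F --> complex.Re <[l, m]>.
Proof.
move=> ul vm.
have -> : complex.Re <[l, m]> = (nsq (l + m) - nsq l - nsq m) / 2.
  by rewrite nsqD mulr2n; field.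
have -> : (fun t => complex.Re <[u t, v t]>) =
  (fun t => (nsq (u t + v t) - nsq (u t) - nsq (v t)) / 2).
  by apply/funext => t; rewrite nsqD mulr2n; field.
apply: cvgM; last exact: cvg_cst.
apply: cvgB; last exact: cvg_nsq.
apply: cvgB; last exact: cvg_nsq.
by apply: cvg_nsq; apply: cvgD.
Qed.

End Hilbert.

(** * Polarization, adjoints, and commutation with unitaries *)

Section Operators.
Context {R : realType} {H : hilbertType R}.
Implicit Types (x y z : H) (T S : H -> H) (V : set H).

Local Notation "<[ x , y ]>" := (hdot H x y) (format "<[ x ,  y ]>").

(** A common form for [D] on its domain and, with [V = setT], for everywhere defined operators. *)
Definition linear_on V T := forall a x y, V x -> V y ->
  V (a *: x + y) /\ T (a *: x + y) = a *: T x + T y.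

Lemma linear_onT T : linear T -> linear_on setT T.
Proof. by move=> lT a x y _ _; split=> //; exact: lT. Qed.

Lemma linear_on_zero V T x : linear_on V T -> V x -> V 0 /\ T 0 = 0.
Proof.
move=> lT Vx; have [] := lT (-1) x x Vx Vx.
by rewrite !scaleN1r !addNr.
Qed.

Lemma linear_onD V T x y : linear_on V T -> V x -> V y ->
  V (x + y) /\ T (x + y) = T x + T y.
Proof. by move=> lT Vx Vy; have := lT 1 x y Vx Vy; rewrite !scale1r. Qed.

Lemma linear_onZ V T a x : linear_on V T -> V x ->
  V (a *: x) /\ T (a *: x) = a *: T x.
Proof.
move=> lT Vx; have [V0 T0] := linear_on_zero lT Vx.
by have := lT a x 0 Vx V0; rewrite T0 !addr0.
Qed.

Lemma linear_onB V T x y : linear_on V T -> V x -> V y ->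
  V (x - y) /\ T (x - y) = T x - T y.
Proof.
move=> lT Vx Vy; have [V1 T1] := linear_onZ (-1) lT Vy.
have [V2 T2] := linear_onD lT Vx V1.
by move: V2 T2; rewrite T1 !scaleN1r.
Qed.

(** The diagonal value at x + y gives B x y = - B y x, and the one at x + i y gives B y x = B x
    y. *)
Lemma polarization V (B : H -> H -> R[i]) :
  (forall x y, V x -> V y -> V (x + y)) ->
  (forall a x, V x -> V (a *: x)) ->
  (forall x y z, V x -> V y -> V z -> B (x + y) z = B x z + B y z) ->
  (forall x y z, V x -> V y -> V z -> B z (x + y) = B z x + B z y) ->
  (forall x y, V x -> V y -> B ('i%C *: x) y = 'i%C * B x y) ->
  (forall x y, V x -> V y -> B x ('i%C *: y) = - 'i%C * B x y) ->
  (forall x, V x -> B x x = 0) -> forall x y, V x -> V y -> B x y = 0.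
Proof.
move=> VD VZ BDl BDr BZl BZr B0 x y Vx Vy.
have e1 : B x y + B y x = 0.
  have := B0 _ (VD _ _ Vx Vy).
  by rewrite BDl ?BDr ?B0 ?add0r ?addr0//; exact: VD.
have Viy := VZ 'i%C _ Vy.
have e2 : B y x = B x y.
  have := B0 _ (VD _ _ Vx Viy).
  rewrite BDl ?BDr// ?B0// ?addr0 ?add0r; last exact: VD.
  rewrite BZl// BZr// mulNr addrC => /eqP; rewrite subr_eq0 => /eqP/mulfI; apply.
  by apply/eqP => -[] /eqP; rewrite oner_eq0.
move: e1; rewrite e2 -mulr2n => /eqP; rewrite mulrn_eq0/= => /eqP//.
Qed.

Lemma conj_i : Num.conj ('i%C : R[i]) = - 'i%C.
Proof. by apply/eqP; rewrite eq_complex /= oppr0 !eqxx. Qed.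

Lemma form_eq V T S : linear_on V T -> linear_on V S ->
  (forall x, V x -> <[T x, x]> = <[S x, x]>) ->
  forall x y, V x -> V y -> <[T x, y]> = <[S x, y]>.
Proof.
move=> lT lS h x y Vx Vy; apply/eqP; rewrite -subr_eq0; apply/eqP.
apply: (@polarization V (fun x y => <[T x, y]> - <[S x, y]>)) => //.
- by move=> a b Va Vb; exact: (linear_onD lT Va Vb).1.
- by move=> a b Vb; exact: (linear_onZ a lT Vb).1.
- move=> a b c Va Vb Vc.
  by rewrite (linear_onD lT Va Vb).2 (linear_onD lS Va Vb).2 !hdotDl opprD addrACA.
- by move=> a b c Va Vb Vc; rewrite !hdotDr opprD addrACA.
- move=> a b Va Vb.
  by rewrite (linear_onZ _ lT Va).2 (linear_onZ _ lS Va).2 !hdotZl mulrBr.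
- by move=> a b Va Vb; rewrite !hdotZr conj_i mulrBr.
- by move=> a Va; rewrite h// subrr.
Qed.

(** <T x, y> - <x, T y> vanishes on the diagonal when the form of T is real, and polarization
    applies. *)
Lemma form_real_sym V T : linear_on V T ->
  (forall x, V x -> complex.Im <[T x, x]> = 0) ->
  forall x y, V x -> V y -> <[T x, y]> = <[x, T y]>.
Proof.
move=> lT h x y Vx Vy; apply/eqP; rewrite -subr_eq0; apply/eqP.
apply: (@polarization V (fun x y => <[T x, y]> - <[x, T y]>)) => //.
- by move=> a b Va Vb; exact: (linear_onD lT Va Vb).1.
- by move=> a b Vb; exact: (linear_onZ a lT Vb).1.
- move=> a b c Va Vb Vc.
  by rewrite (linear_onD lT Va Vb).2 !hdotDl opprD addrACA.
- move=> a b c Va Vb Vc.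
  by rewrite (linear_onD lT Va Vb).2 !hdotDr opprD addrACA.
- move=> a b Va Vb.
  by rewrite (linear_onZ _ lT Va).2 !hdotZl mulrBr.
- move=> a b Va Vb.
  by rewrite (linear_onZ _ lT Vb).2 !hdotZr conj_i mulrBr.
- move=> a Va; rewrite [<[a, _]>]hdotC; have := h a Va.
  by case: <[_, _]> => c d /= ->; apply/eqP; rewrite eq_complex /= oppr0 !subrr !eqxx.
Qed.

(** The means by which operators are identified: [is_fcalc] and [pvm] prescribe quadratic forms
    only. *)
Lemma linear_op_eq T S : linear T -> linear S ->
  (forall x, <[T x, x]> = <[S x, x]>) -> T = S.
Proof.
move=> /linear_onT lT /linear_onT lS h; apply/funext => x; apply: hdot_eq => y.
exact: (form_eq lT lS).
Qed.

Lemma linear_op0 T : linear T -> T 0 = 0.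
Proof. by move=> /linear_onT lT; exact: (@linear_on_zero _ _ 0 lT I).2. Qed.
Lemma linear_opD T x y : linear T -> T (x + y) = T x + T y.
Proof. by move=> /linear_onT lT; exact: (linear_onD lT I I).2. Qed.
Lemma linear_opB T x y : linear T -> T (x - y) = T x - T y.
Proof. by move=> /linear_onT lT; exact: (linear_onB lT I I).2. Qed.
Lemma linear_opZ T a x : linear T -> T (a *: x) = a *: T x.
Proof. by move=> /linear_onT lT; exact: (linear_onZ a lT I).2. Qed.

Lemma bounded_opP T : bounded_op T <->
  linear T /\ exists C, forall x, nsq (T x) <= C * nsq x.
Proof.
split=> [[lT cT]|[lT [C hC]]]; split => //.
  pose g : {linear H -> H} := HB.pack T (GRing.isLinear.Build _ _ _ _ T lT).
  have /linear_boundedP/pinfty_ex_gt0 [[m m'] + Bf] : bounded_near g (nbhs 0).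
    by apply: continuous_linear_bounded; exact: cT.
  rewrite ltcE/= => /andP[/eqP m'0 m0]; move: Bf; rewrite m'0 => Bf.
  exists (m ^+ 2) => x; have := Bf x.
  rewrite !norm_nsq -[m +i* 0]/(m%:C) -rmorphM lecR /=.
  rewrite -(@ler_pXn2r _ 2)// ?nnegrE ?mulr_ge0 ?sqrtr_ge0 ?(ltW m0)//.
  by rewrite exprMn !sqr_sqrtr ?nsq_ge0.
have {}hC x : nsq (T x) <= `|C| * nsq x.
  by apply: le_trans (hC x) _; apply: ler_wpM2r; rewrite ?nsq_ge0 ?ler_norm.
move=> x; apply/cvg_nsqP; have /cvg_nsqP := @cvg_id _ (nbhs x).
move=> h; apply: (@squeeze_cvgr _ _ _ _ (fun=> 0) (fun t => `|C| * nsq (x - t))).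
- by apply: nearW => t; rewrite nsq_ge0/= -(linear_opB _ _ lT).
- exact: cvg_cst.
- by rewrite -[X in _ --> X](mulr0 `|C|); apply: cvgM => //; exact: cvg_cst.
Qed.

(** The first-order condition at a minimum, tested at t = - b / (a + 1), where the + 1 allows a =
    0. *)
Lemma le0_quadratic (a b : R) : (forall t, 0 <= t ^+ 2 * a + 2 * t * b) -> b = 0.
Proof.
move=> h; have a0 : 0 <= a by have := h 1; have := h (-1); lra.
have := h (- b / (a + 1)).
have -> : (- b / (a + 1)) ^+ 2 * a + 2 * (- b / (a + 1)) * b =
   - (b ^+ 2 * (a + 2) / (a + 1) ^+ 2) by field; lra.
rewrite oppr_ge0 pmulr_lle0 ?invr_gt0 ?exprn_gt0//; last lra.
rewrite pmulr_lle0; last lra.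
by move=> b0; apply/eqP; rewrite -sqrf_eq0 eq_le b0 sqr_ge0.
Qed.

(* y is a minimizer of nsq (T x) - 2 phi x, obtained as the limit of a minimizing sequence. *)
Lemma variational T (phi : H -> R) (C : R) : bounded_op T ->
  (forall x, nsq x <= nsq (T x)) ->
  (forall x y, phi (x + y) = phi x + phi y) ->
  (forall t x, phi (t%:C *: x) = t * phi x) ->
  (forall x, phi x ^+ 2 <= C * nsq x) ->
  exists y, forall z, complex.Re <[T z, T y]> = phi z.
Proof.
move=> [lT cT] Tge phiD phiZ phiC.
pose q x := nsq (T x) - 2 * phi x.
(* The bound on [phi] gives 2 phi x <= nsq x + |C| by the inequality of arithmetic and geometric
   means, and nsq x <= nsq (T x) absorbs nsq x. *)
have qge x : - `|C| <= q x.
  rewrite /q; have := Tge x; have := nsq_ge0 x.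
  have : phi x ^+ 2 <= `|C| * nsq x.
    by apply: le_trans (phiC x) _; apply: ler_wpM2r; rewrite ?nsq_ge0 ?ler_norm.
  have : 0 <= `|C| := normr_ge0 _; move: `|C| => D D0 h N0 TN.
  suff : 2 * phi x <= nsq x + D by lra.
  rewrite leNgt; apply/negP => hlt.
  have : (nsq x + D) ^+ 2 < (2 * phi x) ^+ 2.
    by rewrite ltr_pXn2r// nnegrE; lra.
  have := sqr_ge0 (nsq x - D); rewrite !expr2 in h *; lra.
have hm : has_inf (range q).
  by split; [exists (q 0); exists 0|exists (- `|C|) => _ [x _ <-]].
set m := inf (range q).
have mle x : m <= q x by apply: ge_inf; [exact: hm.2|exists x].
have /choice[u hu] n : exists x, q x < m + n.+1%:R^-1.
  have [|_ [x _ <-] h] := @inf_adherent _ (range q) n.+1%:R^-1 _ hm.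
    by rewrite invr_gt0.
  by exists x.
have qmid x y t : q (x + t%:C *: y) =
   q x + t ^+ 2 * nsq (T y) + 2 * t * (complex.Re <[T y, T x]> - phi y).
  rewrite /q linear_opD// linear_opZ// phiD phiZ nsqD nsqZr.
  rewrite hdotZr conj_real cReZ [<[T x, _]>]hdotC cRe_conj mulr2n; ring.
(* The midpoint has [q] at least [m]; by the parallelogram identity for [q], almost minimal points
   are close to each other, so a minimizing sequence is Cauchy. *)
have par x y : nsq (x - y) <= 2 * (q x + q y) - 4 * m.
  have := mle (x + (2^-1)%:C *: (y - x)).
  rewrite qmid; have : q y = q (x + (1)%:C *: (y - x)) by rewrite scale1r subrKC.
  rewrite qmid; have := Tge (y - x); rewrite -[nsq (y - x)]nsqN opprB.
  lra.
have : cvgn u.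
  apply: cauchy_nsq => e e0.
  have e4 : 0 < e / 4 by lra.
  have [n _ hn] := near_infty_natSinv_lt (PosNum e4).
  exists n => k nk; apply: le_trans (par _ _) _.
  have h1 : k.+1%:R^-1 < e / 4 := hn _ nk.
  have h2 : n.+1%:R^-1 < e / 4 := hn _ (leqnn n).
  have := lt_trans (hu n) (ler_ltD (lexx m) h2).
  have := lt_trans (hu k) (ler_ltD (lexx m) h1).
  lra.
move=> /cvg_ex[y uy]; exists y => z.
apply/eqP; rewrite -subr_eq0; apply/eqP; apply: (@le0_quadratic (nsq (T z))) => t.
have Tu : (fun n => T (u n)) @ \oo --> T y by apply: continuous_cvg => //; exact: cT.
have c1 := @cvg_hdot _ _ _ _ _ _ _ _ _ (@cvg_cst _ (T z) _ \oo _) Tu.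
have c2 : (fun n => t ^+ 2 * nsq (T z) +
    2 * t * (complex.Re <[T z, T (u n)]> - phi z) + n.+1%:R^-1) @ \oo -->
   t ^+ 2 * nsq (T z) + 2 * t * (complex.Re <[T z, T y]> - phi z) + 0.
  apply: cvgD; last exact: cvg_harmonic.
  apply: cvgD; first exact: cvg_cst.
  apply: cvgM; first exact: cvg_cst.
  by apply: cvgB; [exact: c1|exact: cvg_cst].
rewrite -[leRHS]addr0. apply: (cvgr_to_ge c2); apply: nearW => n.
have := mle (u n + t%:C *: z); rewrite qmid.
by have := hu n; move: (n.+1%:R^-1) => d; lra.
Qed.

(** Replacing z by i z turns real parts into imaginary parts. *)
Lemma hdot_re_eq T a b : linear T ->
  (forall z, complex.Re <[z, a]> = complex.Re <[T z, b]>) ->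
  forall z, <[z, a]> = <[T z, b]>.
Proof.
move=> lT h z; have h1 := h z; have := h ('i%C *: z).
rewrite linear_opZ// !hdotZl !cReiM => /oppr_inj.
by move: h1; case: <[_, _]> => ? ?; case: <[_, _]> => ? ? /= -> ->.
Qed.

Lemma bounded_op_bound T : bounded_op T ->
  exists2 C, 0 <= C & forall x, nsq (T x) <= C * nsq x.
Proof.
move=> /bounded_opP[_ [C hC]]; exists `|C| => // x.
by apply: le_trans (hC x) _; apply: ler_wpM2r; rewrite ?nsq_ge0 ?ler_norm.
Qed.

(** Riesz representation of z |-> <T z, y>, obtained from [variational] with the identity as
    operator. *)
Lemma bounded_adjoint T : bounded_op T ->
  exists2 S, bounded_op S & adjoint_of T S.
Proof.
move=> bT; have [C C0 hC] := bounded_op_bound bT.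
have lT := bT.1.
have /choice[S hS] y : exists w, forall z, <[T z, y]> = <[z, w]>.
  have [|||||w hw] := @variational id (fun z => complex.Re <[T z, y]>) (C * nsq y).
  - by apply/bounded_opP; split => //; exists 1 => x; rewrite mul1r.
  - by [].
  - by move=> a b; rewrite linear_opD// hdotDl cReD.
  - by move=> t a; rewrite linear_opZ// hdotZl cReZ.
  - move=> x; apply: le_trans (hdot_CS _ _) _.
    by rewrite mulrAC; apply: ler_wpM2r; rewrite ?nsq_ge0.
  by exists w => z; rewrite (hdot_re_eq lT hw).
exists S => //; apply/bounded_opP; split.
  move=> a x y; apply: hdot_eq => z.
  by rewrite hdotC -hS [RHS]hdotC !hdotDr !hdotZr !hS.
exists C => x.
(* nsq (S x) = <T (S x), x>, so Cauchy-Schwarz gives S the same bound as T after division by nsq (S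
   x). *)
have h : nsq (S x) ^+ 2 <= C * nsq (S x) * nsq x.
  rewrite {1}/nsq -hS; apply: le_trans (hdot_CS _ _) _.
  by apply: ler_wpM2r; rewrite ?nsq_ge0.
have [->|S0] := eqVneq (nsq (S x)) 0; first by rewrite mulr_ge0 ?nsq_ge0.
have Sp : 0 < nsq (S x) by rewrite lt_def S0 nsq_ge0.
by rewrite -(ler_pM2l Sp) -expr2 mulrA [nsq (S x) * C]mulrC.
Qed.

(** The solutions are i and - i. Both occur: that A + c is onto rests on the injectivity of A -
    c. *)
Definition imaginary_unit (c : R[i]) := Num.conj c = - c /\ c * Num.conj c = 1.

Lemma imaginary_unit_i : imaginary_unit 'i%C.
Proof.
split; first exact: conj_i.
by apply/eqP; rewrite eq_complex /= !mulr0 !mul0r !mul1r sub0r addr0 opprK !eqxx.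
Qed.

Lemma imaginary_unitN c : imaginary_unit c -> imaginary_unit (- c).
Proof. by move=> [c1 c2]; split; rewrite rmorphN ?mulrNN /= ?c1 -?c1. Qed.

(** The cross term is the real part of a real number, the form of A, times an imaginary one. *)
Lemma nsq_shift A c x : adjoint_of A A -> imaginary_unit c ->
  nsq (A x + c *: x) = nsq (A x) + nsq x.
Proof.
move=> sA [c1 c2]; rewrite nsqD nsqZ c2 mul1r hdotZr.
have : complex.Im <[A x, x]> = 0.
  have := sA x x; rewrite [RHS]hdotC; case: <[_, _]> => a b /= [] h; lra.
have : complex.Re (Num.conj c) = 0.
  have := cRe_conj c; rewrite c1 cReN; lra.
move: (Num.conj c) => [a b]; case: <[_, _]> => a' b' /= -> ->.
by rewrite mul0r mulr0 subrr mul0rn addr0.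
Qed.

Lemma shift_bounded A c : bounded_op A -> bounded_op (fun x => A x + c *: x).
Proof.
move=> bA; have [C C0 hC] := bounded_op_bound bA; apply/bounded_opP; split.
  by move=> a x y; rewrite [A _]bA.1 !scalerDr !scalerA [c * a]mulrC addrACA.
exists (2 * C + 2 * complex.Re (c * Num.conj c)) => x.
apply: le_trans (nsqD_le _ _) _; rewrite nsqZ; have := hC x; lra.
Qed.

(** The variational problem solves T x = y weakly. The defect w = T x - y is orthogonal to the range
    of T, hence killed by A - c, and [nsq_shift] for - c makes it zero. *)
Lemma shift_surj A c : bounded_op A -> adjoint_of A A -> imaginary_unit c ->
  forall y, exists x, A x + c *: x = y.
Proof.
move=> bA sA ic y; pose T x := A x + c *: x.
have bT : bounded_op T := shift_bounded c bA.
have [C C0 hC] := bounded_op_bound bT.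
have lT := bT.1.
have [|||||x hx] := @variational T (fun z => complex.Re <[T z, y]>) (C * nsq y).
- exact: bT.
- by move=> x; rewrite /T nsq_shift// lerDr nsq_ge0.
- by move=> a b; rewrite linear_opD// hdotDl cReD.
- by move=> t a; rewrite linear_opZ// hdotZl cReZ.
- move=> x; apply: le_trans (hdot_CS _ _) _.
  by rewrite mulrAC; apply: ler_wpM2r; rewrite ?nsq_ge0.
exists x; apply/eqP; rewrite -subr_eq0; apply/eqP; set w := _ - _.
have w0 z : <[z, A w + - c *: w]> = 0.
  have e z' : <[z', A w + - c *: w]> = <[T z', w]>.
    by rewrite /T hdotDl hdotDr hdotZl hdotZr sA (imaginary_unitN ic).1 opprK.
  rewrite (@hdot_re_eq (fun=> 0) _ 0) ?hdot0l// => [a u v|{}z].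
    by rewrite scaler0 addr0.
  by rewrite e /w hdotBr cReD cReN hx subrr.
apply: nsq_eq0; apply/eqP; rewrite eq_le nsq_ge0 andbT.
rewrite (@le_trans _ _ (nsq (A w + - c *: w)))//; last by rewrite /nsq w0.
by rewrite (nsq_shift _ sA (imaginary_unitN ic)) lerDr nsq_ge0.
Qed.

(* The Cayley transform (A - i)(A + i)^-1 is a unitary of the commutant, and determines A:
   this avoids the spectral theorem. *)
Lemma commute_selfadjoint (N : set (H -> H)) P A : linear P ->
  (forall T, N T -> bounded_op T) ->
  (forall U, unitary_op U -> commutant N U -> P \o U = U \o P) ->
  adjoint_of A A -> commutant N A -> P \o A = A \o P.
Proof.
move=> lP bN hP sA [bA cA]; have ic := imaginary_unit_i.
pose c : R[i] := 'i%C.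
pose T x := A x + c *: x.
have lT : linear T := (shift_bounded c bA).1.
have /choice[K hK] := shift_surj bA sA ic.
have Tinj x y : T x = T y -> x = y.
  move=> e; apply/eqP; rewrite -subr_eq0; apply/eqP/nsq_eq0.
  have := nsq_shift (x - y) sA ic; rewrite -/(T _) linear_opB// e subrr nsq0.
  have := nsq_ge0 (A (x - y)); have := nsq_ge0 (x - y); lra.
have KT x : K (T x) = x by apply: Tinj; exact: hK.
have lK : linear K.
  by move=> a x y; apply: Tinj; rewrite lT /T !hK.
pose U y := A (K y) - c *: K y.
have UE y : U y = y - (c *+ 2) *: K y.
  by rewrite -[X in _ = X - _](hK y) /U -/c -scalerMnl mulr2n opprD addrA addrK.
have nU y : nsq (U y) = nsq y.
  rewrite -[in RHS](hK y) nsq_shift// /U -scaleNr nsq_shift//.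
  exact: imaginary_unitN.
have lU : linear U.
  by move=> a x y; rewrite !UE lK scalerDr scalerBr opprD addrACA !scalerA mulrC.
have uU : unitary_op U.
  split; first by apply/bounded_opP; split => //; exists 1 => x; rewrite nU mul1r.
    move=> x y; have e a b : complex.Re <[U a, U b]> = complex.Re <[a, b]>.
      by have := nU (a + b); rewrite (linear_opD _ _ lU) (nsqD (U a)) (nsqD a) !nU !mulr2n; lra.
    have := e ('i%C *: x) y; have := e x y; rewrite (linear_opZ _ _ lU) !hdotZl !cReiM.
    by case: <[_, _]> => ? ?; case: <[_, _]> => ? ? /= -> /oppr_inj ->.
  move=> y; have [x hx] := shift_surj bA sA (imaginary_unitN ic) y.
  by exists (T x); rewrite /U KT -hx scaleNr.
have cU : commutant N U.
  split; first by case: uU.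
  move=> S NS; apply/funext => y /=; rewrite !UE.
  have lS := (bN _ NS).1.
  rewrite (linear_opB _ _ lS) (linear_opZ _ _ lS); congr (_ - _ *: _).
  apply: Tinj; rewrite /T hK; have := congr1 (@^~ (K y)) (cA _ NS) => /= ->.
  by rewrite -(linear_opZ _ _ lS) -(linear_opD _ _ lS) hK.
have PK y : P (K y) = K (P y).
  have := congr1 (@^~ y) (hP _ uU cU) => /=; rewrite !UE (linear_opB _ _ lP) (linear_opZ _ _ lP).
  move=> /addrI/oppr_inj/scalerI; apply.
  by rewrite -mulr_natr mulf_neq0// ?pnatr_eq0// -/c; apply/eqP => -[] /eqP; rewrite oner_eq0.
apply/funext => x /=; have := PK (T x); rewrite KT => e.
have : T (P x) = P (T x) by rewrite e /T hK.
by rewrite /T (linear_opD _ _ lP) (linear_opZ _ _ lP) => /addIr.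
Qed.

(** By the bicommutant theorem built into the definition, P has to commute with every S of the
    commutant. The commutant contains the adjoint S' of S, as N is closed under adjoints, so S
    splits into the self-adjoint S + S' and i (S - S'). *)
Lemma commute_unitaries (N : set (H -> H)) P :
  von_neumann_algebra N -> bounded_op P ->
  (forall U, unitary_op U -> commutant N U -> P \o U = U \o P) -> N P.
Proof.
move=> vN bP hP; rewrite -(vna_bicommutant vN); split => // S [bS cS].
have lP := bP.1.
have [S' bS' aS] := bounded_adjoint bS.
have aS' : adjoint_of S' S.
  by move=> x y; rewrite hdotC -aS -hdotC.
have cS' T : N T -> S' \o T = T \o S'.
  move=> NT; have [T' NT' aT] := vna_adjoint vN NT.
  apply/funext => x /=; apply: hdot_eq => y.
  rewrite aS' !aT aS'; have /= -> // := congr1 (@^~ y) (cS _ NT').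
have comm_lin a b : commutant N (fun x => a *: S x + b *: S' x).
  have lS := bS.1; have lS' := bS'.1.
  have [C C0 hC] := bounded_op_bound bS; have [C' C'0 hC'] := bounded_op_bound bS'.
  split.
    apply/bounded_opP; split.
      move=> d x y; rewrite (lS d x y) (lS' d x y) !scalerDr !scalerA.
      by rewrite [a * d]mulrC [b * d]mulrC addrACA.
    exists (2 * (complex.Re (a * Num.conj a) * C) + 2 * (complex.Re (b * Num.conj b) * C')) => x.
    apply: le_trans (nsqD_le _ _) _; rewrite !nsqZ [leRHS]mulrDl -!mulrA.
    have nn (d : R[i]) : 0 <= complex.Re (d * Num.conj d).
      by case: d => u v /=; rewrite mulrN opprK -!expr2 addr_ge0 ?sqr_ge0.
    by apply: lerD; apply: ler_wpM2l => //; apply: ler_wpM2l.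
  move=> T NT; have lT := (vna_bounded vN NT).1; apply/funext => x /=.
  rewrite (linear_opD _ _ lT) !(linear_opZ _ _ lT).
  by have := congr1 (@^~ x) (cS _ NT) => /= ->; have := congr1 (@^~ x) (cS' _ NT) => /= ->.
have h1 : P \o (fun x => 1 *: S x + 1 *: S' x) = (fun x => 1 *: S x + 1 *: S' x) \o P.
  apply: (commute_selfadjoint lP (vna_bounded vN) hP _ (comm_lin 1 1)).
  by move=> x y; rewrite !scale1r hdotDl hdotDr aS aS' addrC.
pose c : R[i] := 'i%C.
have h2 : P \o (fun x => c *: S x + (- c) *: S' x) = (fun x => c *: S x + (- c) *: S' x) \o P.
  apply: (commute_selfadjoint lP (vna_bounded vN) hP _ (comm_lin _ _)).
  move=> x y; rewrite hdotDl hdotDr !hdotZl !hdotZr aS aS'.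
  have ic : imaginary_unit c := imaginary_unit_i.
  by rewrite ic.1 (imaginary_unitN ic).1 opprK addrC.
apply/funext => x /=; have /= := congr1 (@^~ x) h1; have /= := congr1 (@^~ x) h2.
rewrite !(linear_opD _ _ lP) !(linear_opZ _ _ lP) !scale1r !scaleNr -!scalerBr.
have c0 : c != 0 by apply/eqP => -[] /eqP; rewrite oner_eq0.
move=> /(scalerI c0) e2 e1.
have := congr2 +%R e1 e2; rewrite addrACA [RHS]addrACA !subrr !addr0.
have two (u v : H) : u + u = v + v -> u = v.
  rewrite -!mulr2n -(scaler_nat 2 u) -(scaler_nat 2 v) => /scalerI; apply.
  by rewrite pnatr_eq0.
exact: two.
Qed.

End Operators.

(** * Bounded functional calculus *)

Section BoundedMeasurable.
Context {R : realType}.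
Implicit Types (f g : R -> R).

Definition bm f := measurable_fun setT (f : measurableTypeR R -> R) /\
  exists K, forall r, `|f r| <= K.

Lemma bm_cst c : bm (fun=> c).
Proof. by split; [exact: measurable_cst|exists `|c|]. Qed.

Lemma bm_indic (B : set (measurableTypeR R)) : measurable B -> bm (\1_B).
Proof.
move=> mB; split; first exact: measurable_indic.
by exists 1 => r; rewrite indicE ger0_norm ?ler0n// lern1 leq_b1.
Qed.

Lemma bmD f g : bm f -> bm g -> bm (fun r => f r + g r).
Proof.
move=> [mf [K hK]] [mg [L hL]]; split; first exact: measurable_funD.
by exists (K + L) => r; rewrite (le_trans (ler_normD _ _))// lerD.
Qed.

Lemma bmM f g : bm f -> bm g -> bm (fun r => f r * g r).
Proof.
move=> [mf [K hK]] [mg [L hL]]; split; first exact: measurable_funM.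
by exists (K * L) => r; rewrite normrM ler_pM.
Qed.

Lemma bmN f : bm f -> bm (fun r => - f r).
Proof.
move=> [mf [K hK]]; split; first exact: measurableT_comp.
by exists K => r; rewrite normrN.
Qed.

Lemma bmB f g : bm f -> bm g -> bm (fun r => f r - g r).
Proof. by move=> bf /bmN; exact: bmD. Qed.

Lemma bmZ c f : bm f -> bm (fun r => c * f r).
Proof. by move=> bf; apply: bmM => //; exact: bm_cst. Qed.

Lemma bmX f n : bm f -> bm (fun r => f r ^+ n).
Proof.
move=> bf; elim: n => [|n ih]; first exact: bm_cst.
by under [X in bm X]eq_fun do rewrite exprS; exact: bmM.
Qed.

Variable mu : {measure set (measurableTypeR R) -> \bar R}.
Hypothesis mufin : (mu setT < +oo)%E.

Local Notation I f := (\int[mu]_r f r).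

Lemma bm_integrable f : bm f -> mu.-integrable setT (EFin \o f).
Proof.
move=> [mf [K hK]]; apply: measurable_bounded_integrable => //.
exists K; split; first exact: num_real.
by move=> M KM r _; rewrite /= (le_trans (hK r))// ltW.
Qed.

Lemma RintegralD_bm f g : bm f -> bm g -> I (fun r => f r + g r) = I f + I g.
Proof. by move=> bf bg; rewrite RintegralD//; exact: bm_integrable. Qed.
Lemma RintegralB_bm f g : bm f -> bm g -> I (fun r => f r - g r) = I f - I g.
Proof. by move=> bf bg; rewrite RintegralB//; exact: bm_integrable. Qed.
Lemma RintegralZ_bm c f : bm f -> I (fun r => c * f r) = c * I f.
Proof. by move=> bf; rewrite RintegralZl//; exact: bm_integrable. Qed.
Lemma Rintegral_indic_bm (B : set (measurableTypeR R)) : measurable B ->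
  I (\1_B : R -> R) = fine (mu B).
Proof. by move=> mB; rewrite /Rintegral integral_indic// setIT. Qed.
Lemma le_Rintegral_bm f g : bm f -> bm g -> (forall r, f r <= g r) -> I f <= I g.
Proof. by move=> bf bg fg; apply: le_Rintegral => //; exact: bm_integrable. Qed.
Lemma normr_Rintegral_bm f c : bm f -> (forall r, `|f r| <= c) ->
  `|I f| <= c * fine (mu setT).
Proof.
move=> bf fc; rewrite -[X in _ <= X](@Rintegral_cst _ _ _ mu setT measurableT c).
apply: le_trans; first by apply: le_normr_Rintegral => //; exact: bm_integrable.
apply: le_Rintegral => //; last exact: bm_integrable (bm_cst c).
by apply: integrable_norm; exact: bm_integrable.
Qed.

End BoundedMeasurable.

(** * Algebra of projection-valued measures *)

Section Pvm.
Context {R : realType} {H : hilbertType R}.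
Variable E : pvm H.
Implicit Types (x y z : H) (A B : set (measurableTypeR R)) (f g : R -> R).

Local Notation "<[ x , y ]>" := (hdot H x y) (format "<[ x ,  y ]>").
Local Notation P := (pvm_proj E).
Local Notation mu := (pvm_measure E).

Lemma pvm_linear B : measurable B -> linear (P B).
Proof. by move=> /(pvm_projP E)[[]]. Qed.

Lemma pvm_idem B x : measurable B -> P B (P B x) = P B x.
Proof. by move=> /(pvm_projP E)[_ + _] => /(congr1 (@^~ x)). Qed.

Lemma pvm_adj B x y : measurable B -> <[P B x, y]> = <[x, P B y]>.
Proof. by move=> /(pvm_projP E)[_ _]; apply. Qed.

Lemma pvm_measure_nsq B x : measurable B -> mu x B = (nsq (P B x))%:E.
Proof.
move=> mB; have [h f] := pvm_measureE E x mB.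
by rewrite -[LHS]fineK// /nsq pvm_adj// pvm_idem// hdotC h conj_real.
Qed.

Lemma pvm_measureT x : mu x setT = (nsq x)%:E.
Proof. by rewrite pvm_measure_nsq// pvm_projT. Qed.

Lemma pvm_measure_fin x : (mu x setT < +oo)%E.
Proof. by rewrite pvm_measureT ltry. Qed.

Lemma pvm_form B x : measurable B -> <[P B x, x]> = (nsq (P B x))%:C.
Proof.
by move=> mB; have [-> _] := pvm_measureE E x mB; rewrite pvm_measure_nsq.
Qed.

Lemma nsq_pvm_le B x : measurable B -> nsq (P B x) <= nsq x.
Proof.
by move=> mB; rewrite -lee_fin -pvm_measure_nsq// -pvm_measureT le_measure ?inE.
Qed.

Lemma pvmU A B x : measurable A -> measurable B -> A `&` B = set0 ->
  P (A `|` B) x = P A x + P B x.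
Proof.
move=> mA mB AB; have mAB := measurableU _ _ mA mB.
suff -> : P (A `|` B) = (fun x => P A x + P B x) by [].
apply: linear_op_eq; first exact: pvm_linear.
  by move=> a u v; rewrite !pvm_linear// scalerDr addrACA.
move=> u; rewrite hdotDl !pvm_form// -rmorphD; congr (_ %:C).
apply: EFin_inj; rewrite EFinD -!pvm_measure_nsq// measureU//.
Qed.

(** With y = P B x, additivity gives |P A y|^2 + |y|^2 = |P (A u B) y|^2 <= |y|^2. *)
Lemma pvm_disj A B x : measurable A -> measurable B -> A `&` B = set0 ->
  P A (P B x) = 0.
Proof.
move=> mA mB AB; apply: nsq_eq0; apply/eqP; rewrite eq_le nsq_ge0 andbT.
have := nsq_pvm_le (P B x) (measurableU _ _ mA mB).
rewrite -!lee_fin -pvm_measure_nsq//; last exact: measurableU.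
have -> : mu (P B x) (A `|` B) = (mu (P B x) A + mu (P B x) B)%E by rewrite measureU.
rewrite (pvm_measure_nsq _ mA) (pvm_measure_nsq _ mB) pvm_idem// -EFinD !lee_fin.
by rewrite gerDr; exact.
Qed.

Lemma pvmI A B x : measurable A -> measurable B -> P A (P B x) = P (A `&` B) x.
Proof.
move=> mA mB; have mAB := measurableI _ _ mA mB.
have mD : measurable (B `\` A) by exact: measurableD.
have mD' : measurable (A `\` B) by exact: measurableD.
have e1 y : P B y = P (A `&` B) y + P (B `\` A) y.
  rewrite -pvmU//; first by rewrite setIC setUIDK.
  by apply/seteqP; split => r /=; tauto.
have e2 y : P A y = P (A `&` B) y + P (A `\` B) y.
  rewrite -pvmU//; first by rewrite setUIDK.
  by apply/seteqP; split => r /=; tauto.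
rewrite e1 (linear_opD _ _ (pvm_linear mA)) [P A (P (B `\` A) x)]pvm_disj//; last first.
  by apply/seteqP; split => r /=; tauto.
rewrite addr0 e2 pvm_idem// [P (A `\` B) _]pvm_disj ?addr0//.
by apply/seteqP; split => r /=; tauto.
Qed.

End Pvm.

(** Turns an error e / (k n + 1) into a final error e; the + 1 keeps the quotient meaningful when k
    n = 0. *)
Lemma ler_div_add1 (R : realFieldType) (e k n : R) : 0 <= e -> 0 <= k -> 0 <= n ->
  e / (k * n + 1) * k * n <= e.
Proof.
move=> e0 k0 n0; have d0 : 0 < k * n + 1 by rewrite ltr_wpDl// mulr_ge0.
have -> : e / (k * n + 1) * k * n = e * (k * n) / (k * n + 1) by field; rewrite gt_eqF.
by rewrite ler_pdivrMr// ler_wpM2l// lerDl.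
Qed.

Section Approximation.
Context {R : realType}.
Implicit Types (f : R -> R).

Lemma bm_uniform_approx f (e : R) : bm f -> 0 < e ->
  exists (n : nat) (c : nat -> R) (B : nat -> set (measurableTypeR R)),
    (forall i, measurable (B i)) /\
    forall r, `|f r - \sum_(i < n) c i * \1_(B i) r| <= e.
Proof.
move=> [mf [K hK]] e0.
(* The range [-K, K] is cut into slices of height [e]. As f r + K <= 2 K, the slice of r has index
   at most [truncn (2 * K / e)]. *)
pose c (i : nat) : R := i%:R * e - K.
pose B i : set (measurableTypeR R) := f @^-1` `[c i, c i.+1[%classic.
exists (Num.truncn (2 * K / e)).+1, c, B; split.
  by move=> i; rewrite -[B i]setTI; apply: mf => //; exact: measurable_itv.
move=> r; have := hK r; rewrite ler_norml => /andP[f1 f2].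
have q0 : 0 <= (f r + K) / e by apply: divr_ge0; [lra|exact: ltW].
have := truncn_itv q0; set j := Num.truncn _ => /andP[j1 j2].
have jn : (j < (Num.truncn (2 * K / e)).+1)%N.
  rewrite ltnS /j; apply: le_truncn; rewrite ler_pM2r ?invr_gt0//; lra.
have inB i : (r \in B i) = (i == j).
  apply/idP/eqP => [|->].
    rewrite inE /B /= in_itv/= /c => /andP[b1 b2].
    have h : i%:R <= (f r + K) / e < i.+1%:R.
      by rewrite ler_pdivlMr// ltr_pdivrMr//; apply/andP; split; lra.
    by rewrite /j (truncn_def h).
  rewrite inE /B /= in_itv/= /c lerBlDr ltrBrDr.
  by rewrite -ler_pdivlMr// j1 -ltr_pdivrMr.
rewrite (bigD1 (Ordinal jn))//= big1 ?addr0; last first.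
  move=> i ij; rewrite indicE inB (_ : (i == j :> nat) = false) ?mulr0//.
  by apply/negbTE; apply: contraNneq ij => h; apply/eqP/val_inj.
rewrite indicE inB eqxx mulr1 /c.
move: j1 j2; rewrite ler_pdivlMr// ltr_pdivrMr// -natr1 mulrDl mul1r => j1 j2.
by rewrite ler_norml; apply/andP; split; lra.
Qed.

End Approximation.

(** * Construction of the integral of a bounded Borel function against E *)

Section Calculus.
Context {R : realType} {H : hilbertType R}.
Variable E : pvm H.
Implicit Types (x y z : H) (A B : set (measurableTypeR R)) (f g : R -> R) (T S : H -> H).

Local Notation "<[ x , y ]>" := (hdot H x y) (format "<[ x ,  y ]>").
Local Notation P := (pvm_proj E).
Local Notation mu := (pvm_measure E).
Local Notation I x f := (\int[mu x]_r f r).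

(** The functional calculus as a relation, so that its properties go by induction: limits are
    uniform for functions and strong for operators. That it is single-valued comes afterwards, from
    the isometry [calc_nsq]. *)
Inductive calc : (R -> R) -> (H -> H) -> Prop :=
| calc_indic B of measurable B : calc \1_B (P B)
| calc_lin (a : R) f g T S of calc f T & calc g S :
    calc (fun r => a * f r + g r) (fun x => a%:C *: T x + S x)
| calc_lim (f_ : nat -> R -> R) (T_ : nat -> H -> H) f T of
    (forall n, calc (f_ n) (T_ n)) & bm f &
    (forall e : R, 0 < e -> exists n0, forall n, (n0 <= n)%N ->
      forall r, `|f r - f_ n r| <= e) &
    (forall x, T_ ^~ x @ \oo --> T x) : calc f T.

Lemma calc_bm f T : calc f T -> bm f.
Proof.
by elim=> // [B mB|a f1 g1 T1 S1 _ bf _ bg]; [exact: bm_indic|exact: bmD (bmZ _ bf) bg].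
Qed.

Lemma calc_linear f T : calc f T -> linear T.
Proof.
elim=> [B mB|a f1 g1 T1 S1 _ lT _ lS|f_ T_ f1 T1 _ lT _ _ Tc].
- exact: pvm_linear.
- move=> b x y; rewrite lT lS !scalerDr !scalerA [a%:C * b]mulrC.
  by rewrite addrACA.
- move=> b x y; apply: (norm_cvg_unique (Tc (b *: x + y))).
  have -> : T_ ^~ (b *: x + y) = fun n => b *: T_ n x + T_ n y.
    by apply/funext => n; exact: lT.
  by apply: cvgD; [exact: cvgZl_tmp|exact: Tc].
Qed.

(** Continuity is available for real parts only; the imaginary part is caught by pairing with i
    v. *)
Lemma hdot_lim (u : nat -> H) l v (c : nat -> R) (c0 : R) :
  u @ \oo --> l -> c @ \oo --> c0 -> (forall n, <[u n, v]> = (c n)%:C) ->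
  <[l, v]> = c0%:C.
Proof.
move=> ul cc h.
have c1 w : (fun n => complex.Re <[u n, w]>) @ \oo --> complex.Re <[l, w]>.
  exact: (@cvg_hdot _ _ _ _ _ _ _ _ _ ul (@cvg_cst _ w _ \oo _)).
have e1 : complex.Re <[l, v]> = c0.
  apply: (@norm_cvg_unique _ R^o _ _ _ _ (c1 v)).
  by under [X in X @ \oo]eq_fun do rewrite h.
have e2 : complex.Re <[l, 'i%C *: v]> = 0.
  apply: (@norm_cvg_unique _ R^o _ _ _ _ (c1 _)).
  under [X in X @ \oo]eq_fun do rewrite hdotZr h conj_i mulrC cReZ /= oppr0 mulr0.
  exact: cvg_cst.
move: e1 e2; rewrite hdotZr conj_i mulNr cReN cReiM opprK.
by case: <[_, _]> => a b /= -> ->.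
Qed.

(** The induction treats one factor at a time: the other one is a vector [v] known by its density
    [g] on indicators. [calc_hdot] uses it twice, with v = S x and then with v = P B x. *)
Lemma calc_hdot_aux x v g f T : bm g ->
  (forall B, measurable B -> <[P B x, v]> = (I x (fun r => \1_B r * g r))%:C) ->
  calc f T -> <[T x, v]> = (I x (fun r => f r * g r))%:C.
Proof.
move=> bg hB; have mufin := pvm_measure_fin E x.
elim=> [B mB|a f1 g1 T1 S1 cf hT cg hS|f_ T_ f1 T1 cf hT bf uf Tc].
- exact: hB.
- rewrite hdotDl hdotZl hT hS -rmorphM -rmorphD; congr (_ %:C).
  have bf := bmM (calc_bm cf) bg; have bg1 := bmM (calc_bm cg) bg.
  rewrite -RintegralZ_bm// -RintegralD_bm//; last exact: bmZ.
  by apply: eq_Rintegral => r _; rewrite mulrDl mulrA.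
- apply: (hdot_lim (Tc x) _ hT).
  have [Kg hKg] := bg.2.
  have Kg0 : 0 <= Kg := le_trans (normr_ge0 _) (hKg 0).
  apply/cvgrPdist_le => e e0.
  have e1 : 0 < e / (Kg * nsq x + 1).
    by rewrite divr_gt0// ltr_wpDl// mulr_ge0// nsq_ge0.
  have [n0 hn0] := uf _ e1.
  near=> n.
  rewrite -RintegralB_bm//; [|exact: bmM|exact: bmM (calc_bm (cf n)) bg].
  have b1 : bm (fun r => f1 r * g r - f_ n r * g r).
    by apply: bmB; apply: bmM => //; exact: calc_bm.
  apply: le_trans (normr_Rintegral_bm mufin b1
    (c := e / (Kg * nsq x + 1) * Kg) _) _.
    move=> r; rewrite -mulrBl normrM ler_pM//; apply: hn0.
    by near: n; exact: nbhs_infty_ge.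
  rewrite pvm_measureT; apply: ler_div_add1 => //; first exact: ltW.
  exact: nsq_ge0.
Unshelve. all: end_near. Qed.

Lemma calc_hdot x f g T S : calc f T -> calc g S ->
  <[T x, S x]> = (I x (fun r => f r * g r))%:C.
Proof.
move=> cf cg; apply: (calc_hdot_aux (calc_bm cg) _ cf) => B mB.
rewrite hdotC (calc_hdot_aux (bm_indic mB) _ cg) ?conj_real.
  by congr (_ %:C); apply: eq_Rintegral => r _; rewrite mulrC.
move=> A mA; have mAB := measurableI _ _ mA mB.
rewrite -pvm_adj// pvmI// setIC pvm_form//; congr (_ %:C).
apply: EFin_inj; rewrite -pvm_measure_nsq// -[LHS]fineK; last first.
  by rewrite pvm_measure_nsq.
rewrite -Rintegral_indic_bm//; congr EFin.
by apply: eq_Rintegral => r _; rewrite indicI.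
Qed.

Lemma calc_nsq x f T : calc f T -> nsq (T x) = I x (fun r => f r ^+ 2).
Proof. by move=> cf; rewrite /nsq (calc_hdot _ cf cf). Qed.

Lemma calc_nsqB x f g T S : calc f T -> calc g S ->
  nsq (T x - S x) = I x (fun r => (f r - g r) ^+ 2).
Proof.
move=> cf cg; have := calc_nsq x (calc_lin (-1) cg cf).
rewrite rmorphN scaleN1r addrC => ->.
by apply: eq_Rintegral => r _; rewrite mulN1r addrC.
Qed.

Lemma calc_simple n (c : nat -> R) (B : nat -> set (measurableTypeR R)) :
  (forall i, measurable (B i)) ->
  exists T, calc (fun r => \sum_(i < n) c i * \1_(B i) r) T.
Proof.
move=> mB; elim: n => [|n [T cT]].
  exists (P set0); have := calc_indic measurable0.
  by congr (calc _ _); apply/funext => r; rewrite big_ord0 indic0.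
exists (fun x => (c n)%:C *: P (B n) x + T x).
have := calc_lin (c n) (calc_indic (mB n)) cT.
by congr (calc _ _); apply/funext => r; rewrite big_ord_recr/= addrC.
Qed.

Lemma calc_exists f : bm f -> exists T, calc f T.
Proof.
move=> bf.
have h n : exists g : (R -> R) * (H -> H), calc g.1 g.2 /\
    forall r, `|f r - g.1 r| <= n.+1%:R^-1.
  have [|m [c [B [mB hB]]]] := @bm_uniform_approx _ f n.+1%:R^-1 bf.
    by rewrite invr_gt0.
  have [T cT] := calc_simple m c mB.
  by exists (fun r => \sum_(i < m) c i * \1_(B i) r, T).
move/choice: h => [g hg].
have unif (e : R) : 0 < e -> exists n0, forall n, (n0 <= n)%N ->
      forall r, `|f r - (g n).1 r| <= e.
  move=> e0; have [n _ hn] := near_infty_natSinv_lt (PosNum e0).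
  by exists n => m nm r; apply: le_trans ((hg m).2 r) _; apply/ltW/hn.
have Tc x : cvgn (fun n => (g n).2 x).
  apply: cauchy_nsq => e e0.
  (* Two approximants within this distance of f differ by at most sqrt (e / (nsq x + 1)); the square
     is integrated against a measure of mass nsq x. *)
  have e1 : 0 < Num.sqrt (e / (nsq x + 1)) / 2.
    by rewrite divr_gt0// sqrtr_gt0 divr_gt0// ltr_wpDl// nsq_ge0.
  have [n0 hn0] := unif _ e1; exists n0 => m nm.
  rewrite (calc_nsqB _ (hg m).1 (hg n0).1).
  apply: le_trans (ler_norm _) _.
  have := normr_Rintegral_bm (pvm_measure_fin E x) (c := e / (nsq x + 1))
    (bmX 2 (bmB (calc_bm (hg m).1) (calc_bm (hg n0).1))).
  rewrite pvm_measureT /= => /(_ _)/le_trans; apply.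
    move=> r; rewrite normrX -[leRHS]sqr_sqrtr; last first.
      by rewrite divr_ge0 ?ltW// ltr_wpDl// nsq_ge0.
    rewrite ler_pXn2r// ?nnegrE ?sqrtr_ge0//.
    have := hn0 _ nm r; have := hn0 _ (leqnn _) r.
    rewrite !ler_norml => /andP[? ?] /andP[? ?]; apply/andP; split; lra.
  have := ler_div_add1 (ltW e0) ler01 (nsq_ge0 x); rewrite mul1r mulr1; exact.
exists (fun x => lim ((fun n => (g n).2 x) @ \oo)).
by apply: (calc_lim (fun n => (hg n).1)).
Qed.

Definition Phi f : H -> H := xget (fun=> 0) [set T | calc f T].

Lemma PhiP f : bm f -> calc f (Phi f).
Proof. by move=> /calc_exists[T cT]; exact: xgetI cT. Qed.

End Calculus.

Section PhiTheory.
Context {R : realType} {H : hilbertType R}.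
Variable E : pvm H.
Implicit Types (x y z : H) (A B : set (measurableTypeR R)) (f g : R -> R) (T S : H -> H).

Local Notation "<[ x , y ]>" := (hdot H x y) (format "<[ x ,  y ]>").
Local Notation P := (pvm_proj E).
Local Notation mu := (pvm_measure E).
Local Notation I x f := (\int[mu x]_r f r).
Local Notation Phi := (Phi E).

Lemma calc_Phi f T : calc E f T -> Phi f = T.
Proof.
move=> cf; have cP := PhiP E (calc_bm cf); apply/funext => x.
apply/eqP; rewrite -subr_eq0; apply/eqP/nsq_eq0.
rewrite (calc_nsqB _ cP cf) -[RHS](@mulr0 R 0).
under eq_Rintegral do rewrite subrr expr0n/=.
by rewrite Rintegral_cst// mul0r mulr0.
Qed.

Lemma Phi_linear f : bm f -> linear (Phi f).
Proof. by move=> /(PhiP E)/calc_linear. Qed.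

Lemma hdot_Phi f g x : bm f -> bm g ->
  <[Phi f x, Phi g x]> = (I x (fun r => f r * g r))%:C.
Proof. by move=> /(PhiP E) cf /(PhiP E) cg; exact: calc_hdot. Qed.

Lemma nsq_Phi f x : bm f -> nsq (Phi f x) = I x (fun r => f r ^+ 2).
Proof. by move=> /(PhiP E) cf; exact: calc_nsq. Qed.

Lemma nsq_Phi_le f x K : bm f -> (forall r, `|f r| <= K) ->
  nsq (Phi f x) <= K ^+ 2 * nsq x.
Proof.
move=> bf hK; rewrite nsq_Phi//; apply: le_trans (ler_norm _) _.
have := normr_Rintegral_bm (pvm_measure_fin E x) (c := K ^+ 2) (bmX 2 bf).
rewrite pvm_measureT /=; apply => r.
by rewrite normrX ler_pXn2r// nnegrE (le_trans _ (hK r)).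
Qed.

Lemma Phi_bounded_op f : bm f -> bounded_op (Phi f).
Proof.
move=> bf; apply/bounded_opP; split; first exact: Phi_linear.
by have [K hK] := bf.2; exists (K ^+ 2) => x; exact: nsq_Phi_le.
Qed.

Lemma Phi_indic B : measurable B -> Phi \1_B = P B.
Proof. by move=> mB; apply/calc_Phi/calc_indic. Qed.

Lemma Phi1 : Phi (fun=> 1) = id.
Proof.
rewrite (_ : (fun=> 1) = \1_(setT : set (measurableTypeR R))).
  by rewrite Phi_indic// pvm_projT.
by rewrite indicT.
Qed.

Lemma Phi_form f x : bm f -> <[Phi f x, x]> = (I x f)%:C.
Proof.
move=> bf; have := hdot_Phi x bf (bm_cst 1); rewrite Phi1 => ->.
by congr (_ %:C); apply: eq_Rintegral => r _; rewrite mulr1.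
Qed.

Lemma Phi_lin a f g x : bm f -> bm g ->
  Phi (fun r => a * f r + g r) x = a%:C *: Phi f x + Phi g x.
Proof.
by move=> /(PhiP E) cf /(PhiP E) cg; rewrite (calc_Phi (calc_lin a cf cg)).
Qed.

Lemma PhiD f g x : bm f -> bm g ->
  Phi (fun r => f r + g r) x = Phi f x + Phi g x.
Proof.
move=> bf bg; rewrite -[Phi f x]scale1r -(Phi_lin 1 x bf bg); congr (Phi _ x).
by apply/funext => r; rewrite mul1r.
Qed.

Lemma PhiZ a f x : bm f -> Phi (fun r => a * f r) x = a%:C *: Phi f x.
Proof.
move=> bf; have := Phi_lin a x bf (bm_cst 0).
have -> : Phi (fun=> 0) x = 0.
  apply: nsq_eq0; rewrite nsq_Phi; last exact: bm_cst.
  under eq_Rintegral do rewrite expr0n/=.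
  by rewrite Rintegral_cst// mul0r.
by rewrite addr0 => <-; congr (Phi _ x); apply/funext => r; rewrite addr0.
Qed.

Lemma PhiB f g x : bm f -> bm g ->
  Phi (fun r => f r - g r) x = Phi f x - Phi g x.
Proof.
move=> bf bg; rewrite (_ : - Phi g x = Phi (fun r => -1 * g r) x); last first.
  by rewrite PhiZ// rmorphN scaleN1r.
rewrite -PhiD//; last exact: bmZ.
by congr (Phi _ x); apply/funext => r; rewrite mulN1r.
Qed.

Lemma Phi_adj f : bm f -> adjoint_of (Phi f) (Phi f).
Proof.
move=> bf x y; have lP := linear_onT (Phi_linear bf).
by apply: (form_real_sym lP) => // z _; rewrite Phi_form.
Qed.

(** The form of [Phi f \o Phi g] at u is <Phi g u, Phi f u>, which [hdot_Phi] evaluates. *)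
Lemma PhiM f g x : bm f -> bm g ->
  Phi (fun r => f r * g r) x = Phi f (Phi g x).
Proof.
move=> bf bg.
suff -> : Phi (fun r => f r * g r) = Phi f \o Phi g by [].
apply: linear_op_eq; first by apply: Phi_linear; exact: bmM.
  by move=> a u v; rewrite /= !Phi_linear.
move=> u; rewrite /= Phi_form; last exact: bmM.
rewrite Phi_adj// hdot_Phi//; congr (_ %:C).
by apply: eq_Rintegral => r _; rewrite mulrC.
Qed.

Lemma PhiX f n x : bm f -> Phi (fun r => f r ^+ n) x = iter n (Phi f) x.
Proof.
move=> bf; elim: n => [|n ih]; first by under [X in Phi X]eq_fun do rewrite expr0; rewrite Phi1.
under [X in Phi X]eq_fun do rewrite exprS.
by rewrite PhiM//= ?ih//; exact: bmX.
Qed.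

Definition sym_itv (n : nat) : set (measurableTypeR R) := `[- n%:R, n%:R]%classic.

Lemma measurable_sym_itv n : measurable (sym_itv n).
Proof. exact: measurable_itv. Qed.

(** The squared distance is nsq x - nsq (P x), and the scalar measure is continuous from below. *)
Lemma pvm_sym_itv_cvg x : (fun n => P (sym_itv n) x) @ \oo --> x.
Proof.
apply/cvg_nsqP.
have c1 : (fun n => nsq (P (sym_itv n) x)) @ \oo --> nsq x.
  suff /fine_cvgP[] : (fun n => (nsq (P (sym_itv n) x))%:E) @ \oo --> (nsq x)%:E by [].
  rewrite -(pvm_measureT E) (_ : setT = \bigcup_n sym_itv n).
    under [X in X @ \oo]eq_fun do rewrite -(pvm_measure_nsq _ _ (measurable_sym_itv _)).
    apply: nondecreasing_cvg_mu; [by move=> n; exact: measurable_sym_itv| |].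
      by apply: bigcup_measurable => n _; exact: measurable_sym_itv.
    move=> m n mn; apply/subsetPset => r; rewrite /sym_itv /= !in_itv/= => /andP[h1 h2].
    have : (m%:R : R) <= n%:R by rewrite ler_nat.
    by move=> h; apply/andP; split; lra.
  apply/seteqP; split => // r _; exists (Num.truncn `|r|).+1 => //.
  rewrite /sym_itv /= in_itv/=; have := truncnS_gt `|r|.
  by have := ler_norm r; have := ler_norm (- r); rewrite normrN => ? ? ?; apply/andP; split; lra.
have e n : nsq (x - P (sym_itv n) x) = nsq x - nsq (P (sym_itv n) x).
  rewrite nsqB hdotC cRe_conj pvm_form; last exact: measurable_sym_itv.
  by rewrite /= mulr2n; lra.
rewrite (_ : (fun n => _) = (fun n => nsq x - nsq (P (sym_itv n) x))).
  have := cvgB (@cvg_cst _ (nsq x) _ \oo _) c1; rewrite subrr; exact.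
by apply/funext => n; rewrite e.
Qed.

End PhiTheory.

(** * Self-adjoint operators and their spectral measures *)

Lemma ge0_monotone_cvg d (T : measurableType d) (R : realType)
    (mu : {measure set T -> \bar R}) (f_ : nat -> T -> \bar R) (f : T -> \bar R) :
  (forall n, measurable_fun setT (f_ n)) -> (forall n x, 0 <= f_ n x)%E ->
  (forall x, nondecreasing_seq (f_ ^~ x)) ->
  (forall x, f_ ^~ x @ \oo --> f x) ->
  (\int[mu]_x f_ n x)%E @[n --> \oo] --> (\int[mu]_x f x)%E.
Proof.
move=> mf f0 nd fc.
have -> : f = fun x => limn (f_ ^~ x).
  by apply/funext => x; apply/esym/cvg_lim => //; exact: fc.
by apply: cvg_monotone_convergence => // x _; exact: nd.
Qed.

Section Truncation.
Context {R : realType}.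
Implicit Types (r : R).

Definition trunc (n : nat) (r : R) : R := r * \1_(sym_itv n : set R) r.

Lemma truncE n r : trunc n r = if `|r| <= n%:R then r else 0.
Proof.
rewrite /trunc indicE; have -> : (r \in sym_itv n) = (`|r| <= n%:R).
  by apply/idP/idP; rewrite inE /sym_itv /= in_itv/= ler_norml.
by case: ifP => _; rewrite ?mulr1 ?mulr0.
Qed.

Lemma bm_trunc n : bm (trunc n).
Proof.
split.
  apply: measurable_funM; first exact: measurable_id.
  by apply: measurable_indic; exact: measurable_sym_itv.
by exists n%:R => r; rewrite truncE; case: ifP => // _; rewrite normr0 ler0n.
Qed.

Lemma normr_trunc n r : `|trunc n r| <= `|r|.
Proof. by rewrite truncE; case: ifP => // _; rewrite normr0. Qed.

Lemma trunc_near r : \forall n \near \oo, trunc n r = r.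
Proof.
near=> n; rewrite truncE ifT//; apply/ltW/(lt_le_trans (truncnS_gt _)).
by rewrite ler_nat; near: n; exact: nbhs_infty_ge.
Unshelve. all: end_near. Qed.

Lemma trunc_cvg r : trunc ^~ r @ \oo --> r.
Proof.
apply: cvg_near_cst; exact: trunc_near.
Qed.

Lemma trunc_sqr_nd r : nondecreasing_seq (fun n => trunc n r ^+ 2).
Proof.
move=> m n mn; rewrite !truncE; case: ifPn => rm; last first.
  by rewrite expr0n/= sqr_ge0.
by rewrite ifT// (le_trans rm)// ler_nat.
Qed.

End Truncation.

Section SelfAdjoint.
Context {R : realType} {H : hilbertType R}.
Variables (D : operator H) (E : pvm H).
Hypothesis lD : linear_on (opdom D) (opfun D).
Hypothesis sD : spectral_resolution D E.
Implicit Types (x y z : H) (A B : set (measurableTypeR R)) (f g : R -> R).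

Local Notation "<[ x , y ]>" := (hdot H x y) (format "<[ x ,  y ]>").
Local Notation P := (pvm_proj E).
Local Notation mu := (pvm_measure E).
Local Notation I x f := (\int[mu x]_r f r).
Local Notation Phi := (Phi E).

(** nsq (Phi (trunc n) x) is the integral of trunc n ^ 2; monotone convergence bounds the integral
    of r^2, which is the condition for the domain. *)
Lemma opdom_trunc x C : (forall n, nsq (Phi (trunc n) x) <= C) -> opdom D x.
Proof.
move=> hC; apply/(sD.1 x); apply/integrableP; split.
  by apply/measurable_EFinP; apply: measurable_funX; exact: measurable_id.
have h : (\int[mu x]_r (trunc n r ^+ 2)%:E)%E @[n --> \oo] -->
    (\int[mu x]_r (r ^+ 2)%:E)%E.
  apply: ge0_monotone_cvg.
  - move=> n; apply/measurable_EFinP; apply: measurable_funX.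
    exact: (bm_trunc n).1.
  - by move=> n r; rewrite lee_fin sqr_ge0.
  - by move=> r m n mn; rewrite lee_fin trunc_sqr_nd.
  - move=> r; apply: cvg_near_cst; near=> n.
    by have -> : trunc n r = r by near: n; exact: trunc_near.
under eq_integral do rewrite gee0_abs ?lee_fin ?sqr_ge0//.
apply: (@le_lt_trans _ _ C%:E); last exact: ltry.
apply: (cvge_to_le h); apply: nearW => n.
have := hC n; rewrite nsq_Phi; last exact: bm_trunc.
rewrite -lee_fin /Rintegral fineK//.
apply: integrable_fin_num => //; apply: bm_integrable (bmX 2 (bm_trunc n)).
exact: pvm_measure_fin.
Unshelve. all: end_near. Qed.

Lemma opdom_Phi g x : bm g -> bm (fun r => r * g r) -> opdom D (Phi g x).
Proof.
move=> bg brg; have [K hK] := brg.2.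
apply: (@opdom_trunc _ (K ^+ 2 * nsq x)) => n.
have bt := bm_trunc (R := R) n.
rewrite -PhiM//; apply: nsq_Phi_le; first exact: bmM.
move=> r; apply: le_trans (hK r); rewrite [leLHS]normrM [leRHS]normrM.
exact: (ler_pM (normr_ge0 _) (normr_ge0 _) (normr_trunc _ _) (lexx _)).
Qed.

Lemma opfun_sym x y : opdom D x -> opdom D y ->
  <[opfun D x, y]> = <[x, opfun D y]>.
Proof.
by apply: (form_real_sym lD) => z Dz; rewrite sD.2.
Qed.

Lemma trunc_form_cvg x : opdom D x ->
  (fun n => complex.Re <[Phi (trunc n) x, x]>) @ \oo --> complex.Re <[opfun D x, x]>.
Proof.
move=> Dx; rewrite sD.2//=.
rewrite (_ : (fun n => _) = fun n => I x (trunc n)); last first.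
  by apply/funext => n; rewrite Phi_form//; exact: bm_trunc.
have fin := pvm_measure_fin E x.
have int2 : (mu x).-integrable setT (EFin \o (fun r : R => 1 + r ^+ 2)).
  exact: (integrableD measurableT (bm_integrable fin (bm_cst 1)) ((sD.1 x).1 Dx)).
have ler12 (r : R) : `|r| <= 1 + r ^+ 2.
  rewrite -(real_normK (num_real r)); have := normr_ge0 r; have := sqr_ge0 (`|r| - 1); rewrite !expr2; lra.
have cT (r : R) : (fun n => (trunc n r)%:E) @ \oo --> r%:E.
  by apply: cvg_EFin; [exact: nearW|exact: trunc_cvg].
have [||||| intid _ h] := @dominated_convergence _ _ _ (mu x) setT measurableT
  (fun n r => (trunc n r)%:E) (fun r => r%:E) (fun r => (1 + r ^+ 2)%:E).
- by move=> n; apply/measurable_EFinP; exact: (bm_trunc n).1.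
- by apply/measurable_EFinP; exact: measurable_id.
- by apply: aeW => r _; exact: cT.
- exact: int2.
- by apply: aeW => r n _; rewrite lee_fin (le_trans (normr_trunc n r)).
rewrite /Rintegral; apply: fine_cvg; rewrite fineK; first exact: h.
exact: integrable_fin_num.
Qed.

(** [spectral_resolution] controls only the quadratic form of D; both operators being symmetric,
    real polarization extends the convergence to pairs. *)
Lemma trunc_hdot_cvg x y : opdom D x -> opdom D y ->
  (fun n => complex.Re <[Phi (trunc n) x, y]>) @ \oo --> complex.Re <[opfun D x, y]>.
Proof.
move=> Dx Dy; have [Dxy eD] := linear_onD lD Dx Dy.
have pol (T : H -> H) : <[T x, y]> = <[x, T y]> -> T (x + y) = T x + T y ->
    complex.Re <[T x, y]> = (complex.Re <[T (x + y), x + y]> -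
      complex.Re <[T x, x]> - complex.Re <[T y, y]>) / 2.
  move=> sT ->; rewrite hdotDl !hdotDr [<[T y, x]>]hdotC -sT !cReD cRe_conj.
  by field.
rewrite (pol (opfun D))//; last exact: opfun_sym.
rewrite (_ : (fun n => _) = fun n =>
    (complex.Re <[Phi (trunc n) (x + y), x + y]> -
      complex.Re <[Phi (trunc n) x, x]> - complex.Re <[Phi (trunc n) y, y]>) / 2).
  apply: cvgM; last exact: cvg_cst.
  by apply: cvgB; [apply: cvgB|]; exact: trunc_form_cvg.
apply/funext => n; apply: pol; first by apply: Phi_adj; exact: bm_trunc.
by apply: linear_opD; apply: Phi_linear; exact: bm_trunc.
Qed.

Lemma opdom_sym_itv n x : opdom D (P (sym_itv n) x).
Proof.
have mn := measurable_sym_itv (R := R) n.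
by rewrite -Phi_indic//; apply: opdom_Phi; [exact: bm_indic|exact: bm_trunc].
Qed.

(** Against v in the domain, D (Phi g x) is the weak limit of Phi (trunc n) (Phi g x) = P_n (Phi (r
    g) x), where P_n is the spectral projection of [-n, n]. The vectors P_n v lie in the domain and
    tend to v, which extends the identity to all v. *)
Lemma opfun_Phi g x : bm g -> bm (fun r => r * g r) ->
  opfun D (Phi g x) = Phi (fun r => r * g r) x.
Proof.
move=> bg brg; have Dy := opdom_Phi x bg brg.
have h v : opdom D v ->
    complex.Re <[opfun D (Phi g x), v]> = complex.Re <[Phi (fun r => r * g r) x, v]>.
  move=> Dv; apply: (@norm_cvg_unique _ R^o _ _ _ _ (trunc_hdot_cvg Dy Dv)).
  rewrite (_ : (fun n => _) = fun n =>
      complex.Re <[P (sym_itv n) (Phi (fun r => r * g r) x), v]>).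
    by apply: cvg_hdot; [exact: pvm_sym_itv_cvg|exact: cvg_cst].
  apply/funext => n; have bt := bm_trunc (R := R) n.
  have mn := measurable_sym_itv (R := R) n.
  rewrite -PhiM// -(Phi_indic _ mn) -PhiM//; last exact: bm_indic.
  by congr (complex.Re <[Phi _ x, v]>); apply/funext => r; rewrite /trunc; ring.
apply: hdot_eq_re => v.
have c w : (fun n => complex.Re <[w, P (sym_itv n) v]>) @ \oo --> complex.Re <[w, v]>.
  by apply: cvg_hdot; [exact: cvg_cst|exact: pvm_sym_itv_cvg].
apply: (@norm_cvg_unique _ R^o _ _ _ _ (c _)).
rewrite (_ : (fun n => _) =
    fun n => complex.Re <[Phi (fun r => r * g r) x, P (sym_itv n) v]>).
  exact: c.
by apply/funext => n; rewrite h//; exact: opdom_sym_itv.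
Qed.

(** |r - a - i|^-2, a real substitute for the resolvent at a + i. *)
Definition resolvent_kernel (a r : R) : R := (1 + (r - a) ^+ 2)^-1.

Lemma bm_resolvent a : bm (resolvent_kernel a) /\
  bm (fun r => r * resolvent_kernel a r) /\
  bm (fun r => r * (r * resolvent_kernel a r)).
Proof.
have m1 : measurable_fun setT (resolvent_kernel a : measurableTypeR R -> R).
  apply: continuous_measurable_fun => r; apply: cvgV.
    by rewrite gt_eqF// ltr_pwDl// sqr_ge0.
  apply: cvgD; first exact: cvg_cst.
  by apply: cvgM; apply: cvgB => //; exact: cvg_cst.
have m2 : measurable_fun setT ((fun r => r * resolvent_kernel a r) : measurableTypeR R -> R).
  by apply: measurable_funM => //; exact: measurable_id.
have m3 : measurable_fun setT
    ((fun r => r * (r * resolvent_kernel a r)) : measurableTypeR R -> R).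
  by apply: measurable_funM => //; exact: measurable_id.
have p (r : R) : 0 < 1 + (r - a) ^+ 2 by rewrite ltr_pwDl// sqr_ge0.
have a2 : a ^+ 2 = `|a| ^+ 2 by rewrite real_normK// num_real.
have a0 := normr_ge0 a.
split; [|split]; split => //.
- exists 1 => r; rewrite normrV ?unitfE ?gt_eqF// gtr0_norm//.
  by rewrite invf_le1// lerDl sqr_ge0.
- exists (1 + `|a|) => r; rewrite normrM /resolvent_kernel (gtr0_norm (x := _^-1)) ?invr_gt0//.
  rewrite ler_pdivrMr//.
  have h : `|r| <= `|r - a| + `|a| by rewrite -{1}(subrK a r) ler_normD.
  apply: le_trans h _; rewrite -(real_normK (num_real (r - a))).
  have := sqr_ge0 (`|r - a| - 1); have := normr_ge0 (r - a).
  move: `|r - a| => b b0; rewrite !expr2; nra.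
(* From r^2 <= 2 (r - a)^2 + 2 a^2. *)
- exists (2 + 2 * a ^+ 2) => r; rewrite mulrA normrM /resolvent_kernel (gtr0_norm (x := _^-1)) ?invr_gt0//.
  rewrite ler_pdivrMr// ger0_norm; last first.
    by rewrite -expr2 sqr_ge0.
  have := sqr_ge0 (r - 2 * a); have := sqr_ge0 (a * (r - a)); rewrite !expr2; nra.
Qed.

(** y solves (1 + (D - a)^2) y = x, an equation in which E does not appear; together with
    [resolvent_inj] it determines y from D alone. *)
Lemma Phi_resolventP a x (y := Phi (resolvent_kernel a) x) :
  [/\ opdom D y, opdom D (opfun D y) &
    opfun D (opfun D y) - (2 * a)%:C *: opfun D y + (1 + a ^+ 2)%:C *: y = x].
Proof.
have [b0 [b1 b2]] := bm_resolvent a.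
have e1 := opfun_Phi x b0 b1.
have e2 := opfun_Phi x b1 b2.
split; first exact: opdom_Phi.
  by rewrite e1; exact: opdom_Phi.
rewrite e1 e2 -!PhiZ// -PhiB//; last exact: bmZ.
rewrite -PhiD//; [|exact: bmB b2 (bmZ _ b1)|exact: bmZ].
rewrite -[RHS](congr1 (@^~ x) (Phi1 E)); congr (Phi _ x); apply/funext => r.
by rewrite /resolvent_kernel; field; rewrite gt_eqF// ltr_pwDl// sqr_ge0.
Qed.

(** Pairing the equation with w gives |(D - a) w|^2 + |w|^2 = 0. *)
Lemma resolvent_inj a w : opdom D w -> opdom D (opfun D w) ->
  opfun D (opfun D w) - (2 * a)%:C *: opfun D w + (1 + a ^+ 2)%:C *: w = 0 ->
  w = 0.
Proof.
move=> Dw DDw e; apply: nsq_eq0; apply/eqP; rewrite eq_le nsq_ge0 andbT.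
have := congr1 (fun v => complex.Re <[v, w]>) e.
rewrite hdot0l !hdotDl hdotNl !hdotZl !cReD cReN !cReZ (opfun_sym DDw Dw) -!/(nsq _).
have := nsq_ge0 (opfun D w - a%:C *: w).
rewrite nsqB nsqZr hdotZr conj_real cReZ mulr2n /= mulrDl mul1r; lra.
Qed.

End SelfAdjoint.

Lemma addr_sub3 (V : zmodType) (a a' b b' c c' : V) :
  (a - a') - (b - b') + (c - c') = (a - b + c) - (a' - b' + c').
Proof. by rewrite !opprD !opprK (addrACA a) [LHS]addrACA. Qed.

(** * Uniqueness of the spectral measure *)

Section Uniqueness.
Context {R : realType} {H : hilbertType R}.
Implicit Types (x y z : H) (A B : set (measurableTypeR R)) (f g : R -> R) (E : pvm H).

Local Notation "<[ x , y ]>" := (hdot H x y) (format "<[ x ,  y ]>").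

Lemma pvmC E A x : measurable A -> pvm_proj E (~` A) x = x - pvm_proj E A x.
Proof.
move=> mA; have := pvmU E x (measurableC mA) mA.
by rewrite setICl setUC setUv pvm_projT => /(_ erefl) {2}->; rewrite addrK.
Qed.

Definition sublevel g (c : R) : set (measurableTypeR R) := [set r | g r <= c].

Lemma measurable_superlevel g (c : R) : bm g ->
  measurable ([set r | c <= g r] : set (measurableTypeR R)).
Proof.
move=> [mg _]; rewrite [X in measurable X](_ : _ = g @^-1` `[c, +oo[); last first.
  by apply/seteqP; split => r; rewrite /= in_itv/= andbT.
by rewrite -[X in measurable X]setTI; apply: mg => //; exact: measurable_itv.
Qed.

Lemma measurable_sublevel g (c : R) : bm g -> measurable (sublevel g c).
Proof.
move=> [mg _]; rewrite [X in measurable X](_ : _ = g @^-1` `]-oo, c]); last first.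
  by apply/seteqP; split => r; rewrite /sublevel /= in_itv/=.
by rewrite -[X in measurable X]setTI; apply: mg => //; exact: measurable_itv.
Qed.

(* The range of the spectral projection of T for g <= c is the set of the x
   such that |T^n x| <= c^n |x| for all n. *)
Lemma iter_Phi_sublevel E g c n x : bm g -> (forall r, 0 <= g r) -> 0 <= c ->
  pvm_proj E (sublevel g c) x = x -> nsq (iter n (Phi E g) x) <= (c ^+ n) ^+ 2 * nsq x.
Proof.
move=> bg g0 c0 xQ; have mQ := measurable_sublevel c bg.
rewrite -{1}xQ -PhiX// -(Phi_indic _ mQ) -PhiM; [|exact: bmX|exact: bm_indic].
apply: nsq_Phi_le; first by apply: bmM; [exact: bmX|exact: bm_indic].
move=> r; rewrite indicE normrM normrX ger0_norm//.
case: (boolP (r \in _)) => [|_]; last by rewrite normr0 mulr0 exprn_ge0.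
rewrite inE normr1 mulr1 => h; apply: lerXn2r; rewrite ?nnegrE; [exact: g0|exact: c0|exact: h].
Qed.

(** On the range of the projection for g >= m, T^n expands by m^n at least. Hence m^n |P x| <= |T^n
    x| <= c^n |x|, and (c / m)^n tends to 0. *)
Lemma superlevel_null E g c m x : bm g -> (forall r, 0 <= g r) -> 0 <= c -> c < m ->
  (forall n, nsq (iter n (Phi E g) x) <= (c ^+ n) ^+ 2 * nsq x) ->
  pvm_proj E [set r | m <= g r] x = 0.
Proof.
move=> bg g0 c0 cm hn; have m0 : 0 < m by exact: le_lt_trans cm.
have mA := measurable_superlevel m bg; set A := [set r | _] in mA *.
have h n : nsq (pvm_proj E A x) <= nsq x * ((c / m) ^+ 2) ^+ n.
  have : (m ^+ n) ^+ 2 * nsq (pvm_proj E A x) <= (c ^+ n) ^+ 2 * nsq x.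
    apply: le_trans (hn n); rewrite -PhiX// !nsq_Phi; last exact: bmX.
    rewrite -(Phi_indic _ mA) nsq_Phi; last exact: bm_indic.
    rewrite -RintegralZ_bm; [|exact: pvm_measure_fin|exact/bmX/bm_indic].
    apply: le_Rintegral_bm; [exact: pvm_measure_fin| | |].
    - exact/bmZ/bmX/bm_indic.
    - exact/bmX/bmX.
    move=> r; rewrite indicE; case: (boolP (r \in A)) => [|_]; last first.
      by rewrite expr0n mulr0 sqr_ge0.
    rewrite inE /A /= => mg; rewrite expr1n mulr1 ler_pXn2r ?nnegrE ?exprn_ge0// ?(ltW m0)//.
    by apply: lerXn2r; rewrite ?nnegrE; [exact: ltW|exact: g0|exact: mg].
  have mn0 : 0 < (m ^+ n) ^+ 2 by rewrite !exprn_gt0.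
  rewrite -ler_pdivlMl// => /le_trans; apply.
  have -> : ((c / m) ^+ 2) ^+ n = (c ^+ n) ^+ 2 / (m ^+ n) ^+ 2.
    by rewrite exprAC !expr_div_n.
  by rewrite [leLHS]mulrC [X in X * _ <= _]mulrC -mulrA.
apply: nsq_eq0; apply/eqP; rewrite eq_le nsq_ge0 andbT.
have q1 : `|(c / m) ^+ 2| < 1.
  rewrite normrX ger0_norm ?divr_ge0// ?(ltW m0)//.
  by rewrite exprn_ilt1 ?divr_ge0 ?(ltW m0)// ltr_pdivrMr// mul1r.
have c2 : (fun n => nsq x * ((c / m) ^+ 2) ^+ n) @ \oo --> 0.
  rewrite -[X in _ --> X](mulr0 (nsq x)).
  by apply: cvgM; [exact: cvg_cst|exact: cvg_expr].
by apply: (cvgr_to_ge c2); apply: nearW => n; exact: h.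
Qed.

Lemma pvm_superlevel0 E g c x : bm g ->
  (forall m, c < m -> pvm_proj E [set r | m <= g r] x = 0) ->
  pvm_proj E (sublevel g c) x = x.
Proof.
move=> bg h; pose A (k : nat) : set (measurableTypeR R) := [set r | c + k.+1%:R^-1 <= g r].
have mA k : measurable (A k) by exact: measurable_superlevel.
have mQ := measurable_sublevel c bg.
have mC : measurable (~` sublevel g c) by exact: measurableC.
have eC : ~` sublevel g c = \bigcup_k A k.
  apply/seteqP; split => [r|r [k _]]; rewrite /sublevel /A /=.
    move=> /negP; rewrite -ltNge => cg; have gc : 0 < g r - c by lra.
    have [n _ hn] := near_infty_natSinv_lt (PosNum gc).
    by exists n => //=; have /= := hn n (leqnn n); move: (n.+1%:R^-1) => d; lra.
  have : 0 < k.+1%:R^-1 :> R by rewrite invr_gt0.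
  by move: (k.+1%:R^-1) => d d0 hd /=; lra.
have z : pvm_measure E x (~` sublevel g c) = 0%E.
  rewrite eC; have : (pvm_measure E x \o A) @ \oo --> pvm_measure E x (\bigcup_k A k).
    apply: nondecreasing_cvg_mu => //; first by rewrite -eC.
    move=> i j ij; apply/subsetPset => r; rewrite /A /=; apply: le_trans.
    by rewrite lerD2l lef_pV2 ?posrE// ler_nat ltnS.
  rewrite (_ : _ \o A = fun=> 0%E) => [/cvg_lim <-//|]; first by rewrite lim_cst.
  apply/funext => k /=; rewrite pvm_measure_nsq// h ?nsq0//.
  by rewrite ltrDl invr_gt0.
apply/esym/eqP; rewrite -subr_eq0; apply/eqP.
rewrite -pvmC//.
by apply: nsq_eq0; apply: EFin_inj; rewrite -pvm_measure_nsq.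
Qed.

(** The growth condition involves only the operator, which is common to E and E'. *)
Lemma sublevel_sub E E' g c x : bm g -> (forall r, 0 <= g r) -> 0 <= c ->
  Phi E g = Phi E' g ->
  pvm_proj E' (sublevel g c) (pvm_proj E (sublevel g c) x) = pvm_proj E (sublevel g c) x.
Proof.
move=> bg g0 c0 eP; have mQ := measurable_sublevel c bg.
apply: pvm_superlevel0 => // m cm; apply: (superlevel_null bg g0 c0 cm) => n.
rewrite -eP; apply: iter_Phi_sublevel => //.
exact: pvm_idem.
Qed.

(** Each projection fixes the range of the other; taking adjoints makes them equal. *)
Lemma pvm_sublevel_eq E E' g c : bm g -> (forall r, 0 <= g r) -> 0 <= c ->
  Phi E g = Phi E' g ->
  pvm_proj E (sublevel g c) = pvm_proj E' (sublevel g c).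
Proof.
move=> bg g0 c0 eP; have mQ := measurable_sublevel c bg.
apply/funext => x; apply: hdot_eq => y.
rewrite -(sublevel_sub x bg g0 c0 eP) !pvm_adj//.
by rewrite (sublevel_sub y bg g0 c0 (esym eP)).
Qed.

(* The resolvent kernels 1 / (1 + (r - a)^2) have the same Phi for E and E', since it inverts
   1 + (D - a)^2; their sublevel sets are the complements of the open intervals centred at a. *)
Lemma spectral_measure_unique (D : operator H) E E' :
  linear_on (opdom D) (opfun D) -> spectral_resolution D E ->
  spectral_resolution D E' ->
  forall x B, measurable B -> pvm_measure E x B = pvm_measure E' x B.
Proof.
move=> lD sD sD' x.
have eR a : Phi E (resolvent_kernel a) = Phi E' (resolvent_kernel a).
  apply/funext => y; apply/eqP; rewrite -subr_eq0; apply/eqP.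
  have [d1 d2 e1] := Phi_resolventP lD sD a y.
  have [d1' d2' e1'] := Phi_resolventP lD sD' a y.
  have [d3 e3] := linear_onB lD d1 d1'; have [d4 e4] := linear_onB lD d2 d2'.
  apply: (resolvent_inj lD sD (a := a)) => //; first by rewrite e3.
  by rewrite e3 e4 !scalerBr addr_sub3 e1 e1' subrr.
have ooE u v : pvm_measure E x `]u, v[%classic = pvm_measure E' x `]u, v[%classic.
  have [vu|uv] := leP v u; first by rewrite set_itv_ge ?measure0// bnd_simp -leNgt.
  pose a := (u + v) / 2; pose d := (v - u) / 2; have d0 : 0 < d by rewrite /d; lra.
  have [b0 _] := bm_resolvent a.
  have k0 r : 0 <= resolvent_kernel a r.
    by rewrite /resolvent_kernel invr_ge0 addr_ge0// sqr_ge0.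
  have c0 : 0 <= (1 + d ^+ 2)^-1 by rewrite invr_ge0 addr_ge0// sqr_ge0.
  have mQ := measurable_sublevel (1 + d ^+ 2)^-1 b0.
  (* The level is the value of the kernel at distance d from a, so the kernel exceeds it exactly on
     the interval of centre a and radius d. *)
  have -> : `]u, v[%classic = ~` sublevel (resolvent_kernel a) (1 + d ^+ 2)^-1.
    have e r : d ^+ 2 - (r - a) ^+ 2 = (r - u) * (v - r) by rewrite /a /d; field.
    have e2 r : sublevel (resolvent_kernel a) (1 + d ^+ 2)^-1 r <->
        (r - u) * (v - r) <= 0.
      rewrite /sublevel /resolvent_kernel /= lef_pV2 ?posrE ?ltr_pwDl ?sqr_ge0//.
      by rewrite lerD2l -e subr_le0.
    apply/seteqP; split => r /=; rewrite in_itv/=.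
      move=> /andP[ur rv] /e2; apply/negP; rewrite -ltNge mulr_gt0//; lra.
    move=> nQ; have : 0 < (r - u) * (v - r).
      by rewrite ltNge; apply/negP => h; apply: nQ; apply/e2.
    by move=> h; apply/andP; split; rewrite ltNge; apply/negP => h2; nra.
  rewrite !pvm_measure_nsq; [|exact: measurableC..].
  by rewrite !pvmC// (pvm_sublevel_eq b0 k0 c0 (eR a)).
move=> B mB.
have gB : <<s @RGenOpens.G R >> B by rewrite -[X in X B](RGenOpens.measurableE R).
(* Open intervals are stable under intersection and generate the Borel sets; the ]-n, n[ exhaust the
   line with finite measure. *)
have U := @g_sigma_algebra_measure_unique _ R (measurableTypeR R) (@RGenOpens.G R) _
  (fun n => `]- n%:R, n%:R[%classic) _ _ (pvm_measure E x) (pvm_measure E' x) _ _ _ B gB.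
apply: U.
- by move=> _ [u [v ->]]; exact: measurable_itv.
- by move=> n; exists (- n%:R), n%:R.
- apply/seteqP; split => // r _; exists (Num.truncn `|r|).+1 => //=.
  by rewrite in_itv/= -ltr_norml truncnS_gt.
- move=> _ _ [u [v ->]] [u' [v' ->]].
  exists (Num.max u u'), (Num.min v v').
  apply/seteqP; split => r /=; rewrite !in_itv/= gt_max lt_min.
    by move=> [/andP[-> ->] /andP[-> ->]].
  by move=> /andP[/andP[-> ->] /andP[-> ->]].
- by move=> _ [u [v ->]]; exact: ooE.
- by move=> n; rewrite pvm_measure_nsq ?ltry//; exact: measurable_itv.
Qed.

End Uniqueness.

(** * Pushforwards, and the calculus of functions and multiples of D *)

Section Push.
Context {R : realType} {H : hilbertType R}.
Variables (E : pvm H) (h : R -> R).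
Hypothesis mh : measurable_fun setT (h : measurableTypeR R -> measurableTypeR R).

Local Notation "<[ x , y ]>" := (hdot H x y) (format "<[ x ,  y ]>").

Lemma measurable_push (B : set (measurableTypeR R)) : measurable B ->
  measurable (h @^-1` B : set (measurableTypeR R)).
Proof. by move=> mB; rewrite -[X in measurable X]setTI; exact: mh. Qed.

Definition push_measure (x : H) : {measure set (measurableTypeR R) -> \bar R} :=
  measure_function_pushforward__canonical__measure_function_Measure
    (pvm_measure E x) mh.

Lemma push_projP (B : set (measurableTypeR R)) : measurable B ->
  orthogonal_projection (pvm_proj E (h @^-1` B)).
Proof. by move=> mB; apply: pvm_projP; exact: measurable_push. Qed.

Lemma push_measureE x (B : set (measurableTypeR R)) : measurable B ->
  hdot H (pvm_proj E (h @^-1` B) x) x = (fine (push_measure x B))%:C /\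
  push_measure x B \is a fin_num.
Proof. by move=> mB; exact: (pvm_measureE E x (measurable_push mB)). Qed.

(** The spectral measure of h(D). The nested uses of [fcalc] in the statement are thereby brought
    back to the measure of D. *)
Definition push_pvm : pvm H :=
  @Pvm R H (fun B => pvm_proj E (h @^-1` B)) push_measure push_projP
    (pvm_projT E) push_measureE.

Lemma push_integrable x (f : R -> R) :
  measurable_fun setT (f : measurableTypeR R -> R) ->
  (pvm_measure push_pvm x).-integrable setT (EFin \o f) <->
  (pvm_measure E x).-integrable setT (EFin \o (f \o h)).
Proof.
move=> mf; split => /integrableP[m1 i1]; apply/integrableP; split.
- by apply/measurable_EFinP; exact: (measurableT_comp mf mh).
- move: i1; rewrite ge0_integral_pushforward//.
  by apply: measurableT_comp => //; exact/measurable_EFinP.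
- exact/measurable_EFinP.
- rewrite ge0_integral_pushforward//.
  by apply: measurableT_comp => //; exact/measurable_EFinP.
Qed.

Lemma push_Rintegral x (f : R -> R) :
  measurable_fun setT (f : measurableTypeR R -> R) ->
  (pvm_measure E x).-integrable setT (EFin \o (f \o h)) ->
  (\int[pvm_measure push_pvm x]_r f r) = \int[pvm_measure E x]_r f (h r).
Proof.
move=> mf fi; rewrite /Rintegral; congr fine.
rewrite (@integral_pushforward _ _ (measurableTypeR R) (measurableTypeR R) R h mh
  (pvm_measure E x) setT (EFin \o f))//.
exact/measurable_EFinP.
Qed.

End Push.

Section FunctionalCalculus.
Context {R : realType} {H : hilbertType R}.
Implicit Types (x y z : H) (f g h : R -> R) (E : pvm H) (D : operator H).

Local Notation "<[ x , y ]>" := (hdot H x y) (format "<[ x ,  y ]>").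

(** The operator chosen by [fcalc] may come from another resolution E', but its form is an integral
    against the same scalar measures. *)
Lemma is_fcalc_Phi D E f T : linear_on (opdom D) (opfun D) ->
  spectral_resolution D E -> measurable_fun setT (f : measurableTypeR R -> R) ->
  (forall x, (pvm_measure E x).-integrable setT (fun r => (f r ^+ 2)%:E)) ->
  linear T -> (forall x, <[T x, x]> = (\int[pvm_measure E x]_r f r)%:C) ->
  fcalc D f = T.
Proof.
move=> lD sD mf if2 lT hT.
have iT : is_fcalc D f T by exists E.
have [E' sE' [_ lS _ hS]] : is_fcalc D f (fcalc D f) by exact: (xgetI _ iT).
apply: linear_op_eq => // x; rewrite hS hT; congr (_ %:C).
rewrite /Rintegral; congr fine; apply: eq_measure_integral => A mA _.
exact: (spectral_measure_unique lD sE' sD).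
Qed.

Lemma fcalc_push D E h (mh : measurable_fun setT (h : measurableTypeR R -> measurableTypeR R)) f :
  linear_on (opdom D) (opfun D) -> spectral_resolution D (push_pvm E mh) ->
  measurable_fun setT (f : measurableTypeR R -> R) ->
  bm (f \o h) -> fcalc D f = Phi E (f \o h).
Proof.
move=> lD sD mf bfh; have fin := pvm_measure_fin E.
apply: (is_fcalc_Phi lD sD mf) => [x||x].
- apply/(@push_integrable _ _ E h mh x (fun r => f r ^+ 2)).
    by apply: measurable_funX.
  exact: (bm_integrable (f := fun r => f (h r) ^+ 2) (fin x) (bmX 2 bfh)).
- exact: Phi_linear.
- rewrite push_Rintegral//; first by rewrite Phi_form.
  exact: (bm_integrable (f := f \o h) (fin x) bfh).
Qed.

Lemma fcalc_Phi D E f : linear_on (opdom D) (opfun D) -> spectral_resolution D E ->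
  bm f -> fcalc D f = Phi E f.
Proof.
move=> lD sD bf; have fin := pvm_measure_fin E.
apply: (is_fcalc_Phi lD sD bf.1) => [x||x].
- exact: (bm_integrable (f := fun r => f r ^+ 2) (fin x) (bmX 2 bf)).
- exact: Phi_linear.
- exact: Phi_form.
Qed.

Lemma bm_measurable h : bm h ->
  measurable_fun setT (h : measurableTypeR R -> measurableTypeR R).
Proof. by case. Qed.

Lemma measurable_idR : measurable_fun setT ((fun r => r) : measurableTypeR R -> R).
Proof. by move=> _ B mB; rewrite setTI. Qed.

Lemma spectral_total_op E h (bh : bm h) :
  spectral_resolution (total_op (Phi E h)) (push_pvm E (bm_measurable bh)).
Proof.
have fin := pvm_measure_fin E; split=> x; last first.
  move=> _; rewrite push_Rintegral//; first exact: Phi_form.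
  exact: (bm_integrable (f := h) (fin x) bh).
split=> // _; apply/(@push_integrable _ _ E h (bm_measurable bh) x (fun r => r ^+ 2)).
  by apply: measurable_funX; exact: measurable_idR.
exact: (bm_integrable (f := fun r => h r ^+ 2) (fin x) (bmX 2 bh)).
Qed.

Lemma fcalc_total_op E h f : bm h -> measurable_fun setT (f : measurableTypeR R -> R) ->
  bm (f \o h) -> fcalc (total_op (Phi E h)) f = Phi E (f \o h).
Proof.
move=> bh mf bfh; apply: (fcalc_push _ (spectral_total_op E bh)) => //.
by apply: linear_onT; exact: Phi_linear.
Qed.

Lemma linear_on_scale D (s : R) : linear_on (opdom D) (opfun D) ->
  linear_on (opdom (scale_op s D)) (opfun (scale_op s D)).
Proof.
move=> lD a x y Dx Dy; have [? e] := lD a x y Dx Dy; split => //=.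
by rewrite e scalerDr !scalerA mulrC.
Qed.

Lemma measurable_scale (s : R) :
  measurable_fun setT ((fun r => s * r) : measurableTypeR R -> measurableTypeR R).
Proof. by apply: measurable_funM => //; exact: measurable_idR. Qed.

Lemma square_integrable_id E x :
  (pvm_measure E x).-integrable setT (fun r => (r ^+ 2)%:E) ->
  (pvm_measure E x).-integrable setT (fun r => r%:E).
Proof.
move=> i2; have fin := pvm_measure_fin E x.
have i3 := integrableD measurableT (bm_integrable fin (bm_cst 1)) i2.
apply: (le_integrable measurableT _ _ i3).
  by apply/measurable_EFinP; exact: measurable_id.
move=> r _; rewrite /= lee_fin [leRHS]ger0_norm ?addr_ge0 ?sqr_ge0//.
rewrite -(real_normK (num_real r)); have := normr_ge0 r.
by have := sqr_ge0 (`|r| - 1); rewrite !expr2; lra.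
Qed.

(** [s != 0] makes r^2 and (s r)^2 integrable together; [scale_op] keeps the domain of D. *)
Lemma spectral_scale_op D E (s : R) : s != 0 -> spectral_resolution D E ->
  spectral_resolution (scale_op s D) (push_pvm E (measurable_scale s)).
Proof.
move=> s0 [dD fD].
have mid : measurable_fun setT ((fun r => r) : measurableTypeR R -> R) by exact: measurable_idR.
split=> x.
  have eq1 : (pvm_measure E x).-integrable setT (fun r => (r ^+ 2)%:E) <->
      (pvm_measure E x).-integrable setT (EFin \o ((fun r => r ^+ 2) \o (fun r => s * r))).
    split=> [/(integrableZl measurableT (s ^+ 2))|/(integrableZl measurableT (s ^- 2))];
      apply: eq_integrable => // r _ /=; rewrite -EFinM exprMn //.
    by rewrite mulKf// expf_neq0.
  rewrite /= dD; apply: (iff_trans eq1); apply: iff_sym.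
  have msq : measurable_fun setT ((fun r : R => r ^+ 2) : measurableTypeR R -> R).
    by apply: measurable_funX; exact: measurable_idR.
  exact: (push_integrable E (measurable_scale s) x msq).
move=> Dx; rewrite hdotZl fD// push_Rintegral//.
  rewrite RintegralZl//; first by rewrite rmorphM.
  by apply: square_integrable_id; exact/dD.
have i1 := square_integrable_id ((dD x).1 Dx).
by apply: eq_integrable (integrableZl measurableT s i1) => // r _ /=; rewrite EFinM.
Qed.

End FunctionalCalculus.

(** * Functions of D belong to N *)

Section Membership.
Context {R : realType} {H : hilbertType R}.
Variables (N : set (H -> H)) (D : operator H) (E : pvm H).
Hypotheses (vN : von_neumann_algebra N) (lD : linear_on (opdom D) (opfun D))
  (aD : affiliated N D) (sD : spectral_resolution D E).
Implicit Types (x y z : H) (A B : set (measurableTypeR R)) (f g : R -> R).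

Local Notation "<[ x , y ]>" := (hdot H x y) (format "<[ x ,  y ]>").
Local Notation P := (pvm_proj E).

Section Conjugation.
Variables (U V : H -> H).
Hypotheses (UV : forall y, U (V y) = y) (Udot : forall x y, <[U x, U y]> = <[x, y]>)
  (bU : bounded_op U) (bV : bounded_op V).

Lemma conj_projP B : measurable B -> orthogonal_projection (fun x => V (P B (U x))).
Proof.
move=> mB; have dotV x y : <[V x, y]> = <[x, U y]> by rewrite -Udot UV.
split.
- apply/bounded_opP; split; first by move=> a x y; rewrite bU.1 (pvm_linear E mB) bV.1.
  have [C C0 hC] := bounded_op_bound bU; have [C' C'0 hC'] := bounded_op_bound bV.
  exists (C' * C) => x; apply: le_trans (hC' _) _; rewrite -mulrA ler_wpM2l//.
  by apply: le_trans (hC x); exact: nsq_pvm_le.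
- by apply/funext => x /=; rewrite UV pvm_idem.
- by move=> x y; rewrite dotV pvm_adj// hdotC -dotV -hdotC.
Qed.

Lemma conj_projT : (fun x => V (P setT (U x))) = id.
Proof.
apply/funext => x; rewrite pvm_projT; apply: hdot_eq => y.
by rewrite -Udot UV Udot.
Qed.

Lemma conj_measureE x B : measurable B ->
  <[V (P B (U x)), x]> = (fine (pvm_measure E (U x) B))%:C /\
  pvm_measure E (U x) B \is a fin_num.
Proof.
move=> mB; rewrite -(Udot (V _)) UV; exact: (pvm_measureE E (U x) mB).
Qed.

Definition conj_pvm : pvm H :=
  @Pvm R H (fun B x => V (P B (U x))) (fun x => pvm_measure E (U x))
    conj_projP conj_projT conj_measureE.

End Conjugation.

(* U^-1 E U is a spectral resolution of D too, so that it is E. *)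
Lemma pvm_unitary_comm U B : unitary_op U -> commutant N U -> measurable B ->
  P B \o U = U \o P B.
Proof.
move=> uU cU mB; have [bU Udot /choice[V UV]] := uU.
have nU x : nsq (U x) = nsq x by rewrite /nsq Udot.
have Uinj x y : U x = U y -> x = y.
  move=> e; apply/eqP; rewrite -subr_eq0; apply/eqP/nsq_eq0.
  by rewrite -nU (linear_opB _ _ bU.1) e subrr nsq0.
have VU x : V (U x) = x by apply: Uinj; rewrite UV.
have bV : bounded_op V.
  apply/bounded_opP; split; last by exists 1 => x; rewrite -nU UV mul1r.
  by move=> a x y; apply: Uinj; rewrite bU.1 !UV.
have uV : unitary_op V.
  by split => //; [move=> x y; rewrite -Udot !UV|move=> y; exists (U y)].
have cV : commutant N V.
  split => // T NT; apply/funext => y /=; apply: Uinj; rewrite UV.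
  by have /= -> := congr1 (@^~ (V y)) (cU.2 _ NT); rewrite UV.
have sD' : spectral_resolution D (conj_pvm UV Udot bU bV).
  split=> x.
    split=> [Dx|/sD.1 DUx].
      by apply/sD.1; have [] := aD uU cU Dx.
    (* The converse inclusion of domains uses affiliation for the inverse V of U, which is a unitary
       of the commutant too. *)
    by rewrite -(VU x); have [] := aD uV cV DUx.
  move=> Dx; have [DUx e] := aD uU cU Dx.
  by rewrite -Udot -e sD.2.
have e := spectral_measure_unique lD sD sD'.
apply/funext => y /=.
suff {2}-> : P B = fun x => V (P B (U x)) by rewrite UV.
apply: linear_op_eq; first exact: pvm_linear.
  by move=> a x z; rewrite bU.1 (pvm_linear E mB) bV.1.
move=> x; rewrite -(Udot (V _)) UV !pvm_form//; congr (_ %:C).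
by apply: EFin_inj; rewrite -!pvm_measure_nsq// e.
Qed.

Lemma pvm_in_vna B : measurable B -> N (P B).
Proof.
move=> mB; apply: (commute_unitaries vN); first by case: (pvm_projP E mB).
by move=> U uU cU; exact: pvm_unitary_comm.
Qed.

Lemma calc_comm S f T : bounded_op S ->
  (forall B, measurable B -> S \o P B = P B \o S) ->
  calc E f T -> S \o T = T \o S.
Proof.
move=> [lS cS] cSP; elim=> [B mB|a f1 g1 T1 S1 _ e1 _ e2|f_ T_ f1 T1 _ e _ _ Tc].
- exact: cSP.
- apply/funext => x /=; rewrite (linear_opD _ _ lS) (linear_opZ _ _ lS).
  by have /= -> := congr1 (@^~ x) e1; have /= -> := congr1 (@^~ x) e2.
- apply/funext => x /=; apply: (norm_cvg_unique _ (Tc (S x))).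
  rewrite (_ : (fun n => _) = fun n => S (T_ n x)).
    by apply: continuous_cvg; [exact: cS|exact: Tc].
  by apply/funext => n; have /= -> := congr1 (@^~ x) (e n).
Qed.

Lemma Phi_in_vna f : bm f -> N (Phi E f).
Proof.
move=> bf; rewrite -(vna_bicommutant vN); split; first exact: Phi_bounded_op.
move=> S [bS cS]; apply/esym; apply: (calc_comm bS _ (PhiP E bf)) => B mB.
by apply: cS; exact: pvm_in_vna.
Qed.

End Membership.

(** * The trace as an integral *)

Section SpectralTrace.
Context {R : realType} {H : hilbertType R}.
Variables (N : set (H -> H)) (tau : (H -> H) -> \bar R) (E : pvm H).
Hypotheses (tr : faithful_normal_semifinite_trace N tau)
  (PhiN : forall f, bm f -> N (Phi E f)).
Implicit Types (x : H) (B : set (measurableTypeR R)) (f g : R -> R).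

Local Notation "<[ x , y ]>" := (hdot H x y) (format "<[ x ,  y ]>").
Local Notation P := (pvm_proj E).
Local Notation I x f := (\int[pvm_measure E x]_r f r).
Local Notation Phi := (Phi E).

Lemma Phi_pos f : bm f -> (forall r, 0 <= f r) -> positive_part N (Phi f).
Proof.
move=> bf f0; split; first exact: PhiN.
by move=> x; rewrite Phi_form// ler0c; apply: Rintegral_ge0.
Qed.

Lemma pvm_pos B : measurable B -> positive_part N (P B).
Proof.
move=> mB; rewrite -Phi_indic//; apply: Phi_pos; first exact: bm_indic.
by move=> r; rewrite indicE ler0n.
Qed.

Lemma tau_PhiD f g : bm f -> bm g -> (forall r, 0 <= f r) -> (forall r, 0 <= g r) ->
  tau (Phi (fun r => f r + g r)) = (tau (Phi f) + tau (Phi g))%E.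
Proof.
move=> bf bg f0 g0; rewrite -(traceD tr); [|exact: Phi_pos..].
by congr tau; apply/funext => x; rewrite PhiD.
Qed.

Lemma tau_PhiZ c f : bm f -> (forall r, 0 <= f r) -> 0 <= c ->
  tau (Phi (fun r => c * f r)) = (c%:E * tau (Phi f))%E.
Proof.
move=> bf f0 c0; rewrite -(traceZ tr)//; last exact: Phi_pos.
by congr tau; apply/funext => x; rewrite PhiZ.
Qed.

Lemma tau_Phi0 : tau (Phi (fun=> 0)) = 0%E.
Proof.
have := @tau_PhiZ 0 (fun=> 0) (bm_cst 0) (fun=> lexx 0) (lexx 0).
by rewrite mul0e => <-; congr (tau (Phi _)); apply/funext => r; rewrite mul0r.
Qed.

Lemma op_le_Phi f g : bm f -> bm g -> (forall r, f r <= g r) ->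
  op_le (Phi f) (Phi g).
Proof.
move=> bf bg fg x; rewrite /= hdotBl !Phi_form// -rmorphB ler0c subr_ge0.
by apply: le_Rintegral_bm => //; exact: pvm_measure_fin.
Qed.

(** Normality of the trace along an increasing sequence. What has to be shown is that [Phi f] is the
    supremum of the [Phi (f_ n)] among the positive elements of N. *)
Lemma tau_Phi_sup (f_ : nat -> R -> R) f : (forall n, bm (f_ n)) -> bm f ->
  (forall n r, 0 <= f_ n r) -> (forall r, nondecreasing_seq (f_ ^~ r)) ->
  (forall r, f_ ^~ r @ \oo --> f r) ->
  tau (Phi f) = ereal_sup (range (fun n => tau (Phi (f_ n)))).
Proof.
move=> bf_ bf f_0 nd fc.
have fle n r : f_ n r <= f r.
  apply: (cvgr_to_ge (fc r)); near=> m; apply: nd.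
  by near: m; exact: nbhs_infty_ge.
have f0 r : 0 <= f r by apply: le_trans (fle 0%N r).
have -> : range (fun n => tau (Phi (f_ n))) = tau @` range (fun n => Phi (f_ n)).
  apply/seteqP; split=> [_ [n _ <-]|_ [_ [n _ <-] <-]]; first by exists (Phi (f_ n)).
  by exists n.
apply: (trace_normal tr).
- by exists (Phi (f_ 0%N)), 0%N.
- by move=> _ [n _ <-]; exact: Phi_pos.
- move=> _ _ [m _ <-] [n _ <-]; exists (Phi (f_ (maxn m n))); split.
  + by exists (maxn m n).
  + by apply: op_le_Phi => // r; apply: nd; exact: leq_maxl.
  + by apply: op_le_Phi => // r; apply: nd; exact: leq_maxr.
split; first exact: Phi_pos.
  by move=> _ [n _ <-]; exact: op_le_Phi.
(* The form of an upper bound dominates the integral of each f_ n, hence that of f by monotone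
   convergence. *)
move=> T' [_ T'pos] hT' x /=.
have := T'pos x; rewrite hdotBl Phi_form// lecE /= => /andP[/eqP im0 _].
have h n : I x (f_ n) <= complex.Re <[T' x, x]>.
  have := hT' _ (imageT _ n) x; rewrite /= hdotBl Phi_form// lecE /= => /andP[_].
  by rewrite cReD cReN /= subr_ge0.
have fin := pvm_measure_fin E x.
have c : (\int[pvm_measure E x]_r (f_ n r)%:E)%E @[n --> \oo] -->
    (\int[pvm_measure E x]_r (f r)%:E)%E.
  apply: ge0_monotone_cvg.
  - by move=> n; apply/measurable_EFinP; exact: (bf_ n).1.
  - by move=> n r; rewrite lee_fin.
  - by move=> r m n mn; rewrite lee_fin nd.
  - by move=> r; apply: cvg_EFin; [exact: nearW|exact: fc].
have le : I x f <= complex.Re <[T' x, x]>.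
  rewrite -lee_fin /Rintegral fineK; last first.
    by apply: integrable_fin_num => //; exact: (bm_integrable (f := f) fin bf).
  apply: (cvge_to_le c); apply: nearW => n.
  have := h n; rewrite -lee_fin /Rintegral fineK//.
  by apply: integrable_fin_num => //; exact: (bm_integrable (f := f_ n) fin (bf_ n)).
rewrite lecE; move: im0 le; case: <[T' x, x]> => a b /= -> le.
by rewrite oppr0 addr0 eqxx subr_ge0.
Unshelve. all: end_near. Qed.

(* pvm_proj E B is arbitrary when B is not measurable. *)
Definition spectral_mass B : \bar R := if `[< measurable B >] then tau (P B) else 0%E.

Lemma spectral_massE B : measurable B -> spectral_mass B = tau (P B).
Proof. by move=> mB; rewrite /spectral_mass; case: asboolP. Qed.

Lemma spectral_mass0 : spectral_mass set0 = 0%E.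
Proof.
rewrite spectral_massE// -Phi_indic// -[RHS]tau_Phi0.
by congr (tau (Phi _)); apply/funext => r; rewrite indic0.
Qed.

Lemma spectral_mass_ge0 B : (0 <= spectral_mass B)%E.
Proof.
rewrite /spectral_mass; case: asboolP => // mB.
by apply: (trace_ge0 tr); exact: pvm_pos.
Qed.

(** Finite additivity comes from [traceD], the passage to the limit from normality through
    [tau_Phi_sup]. *)
Lemma spectral_mass_sigma_additive : semi_sigma_additive spectral_mass.
Proof.
move=> F mF tF mUF.
have mU n : measurable (\big[setU/set0]_(i < n) F i).
  by apply: bigsetU_measurable => i _.
have e n : (\sum_(0 <= i < n) spectral_mass (F i))%E = spectral_mass (\big[setU/set0]_(i < n) F i).
  elim: n => [|n ih]; first by rewrite big_geq// big_ord0 spectral_mass0.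
  have mFn : measurable (F n) by exact: mF.
  rewrite big_nat_recr//= ih big_ord_recr/= [in RHS](spectral_massE (measurableU _ _ (mU n) mFn)).
  rewrite (spectral_massE (mU n)) (spectral_massE mFn) -(traceD tr); [|exact: pvm_pos..].
  congr tau; apply/funext => x; rewrite pvmU//.
  apply/seteqP; split => // r [].
  rewrite -bigcup_mkord => -[i /= ilt Fir] Fnr.
  have ein : i = n by apply: (tF i n) => //; exists r.
  by rewrite ein ltnn in ilt.
rewrite (_ : (fun n => _) = fun n => spectral_mass (\big[setU/set0]_(i < n) F i)); last first.
  by apply/funext.
have -> : spectral_mass (\bigcup_n F n) = ereal_sup (range (fun n => spectral_mass (\big[setU/set0]_(i < n) F i))).
  rewrite spectral_massE// -Phi_indic// (tau_Phi_sup (f_ := fun n => \1_(\big[setU/set0]_(i < n) F i))).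
  - by congr (ereal_sup (_ @` setT)); apply/funext => n; rewrite spectral_massE// Phi_indic.
  - by move=> n; exact: bm_indic.
  - exact: bm_indic.
  - by move=> n r; rewrite indicE ler0n.
  - move=> r m n mn; rewrite !indicE ler_nat.
    case: (boolP (r \in \big[setU/set0]_(i < m) F i)) => //.
    rewrite inE -bigcup_mkord => -[i /= im Fir].
    by rewrite mem_set// -bigcup_mkord; exists i => //=; exact: leq_trans im mn.
  - move=> r; apply: cvg_near_cst.
    have [[i _ Fir]|nF] := pselect ((\bigcup_n F n) r).
      near=> n; rewrite !indicE !mem_set//; first by exists i.
      rewrite -bigcup_mkord; exists i => //=.
      by near: n; exact: nbhs_infty_gt.
    apply: nearW => n; rewrite !indicE !memNset// -bigcup_mkord => -[i _ Fir].
    by apply: nF; exists i.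
apply: ereal_nondecreasing_cvgn => m n mn; rewrite -!e.
by apply: lee_sum_nneg_natr => // i _ _; exact: spectral_mass_ge0.
Unshelve. all: end_near. Qed.

Definition spectral_trace : {measure set (measurableTypeR R) -> \bar R} :=
  HB.pack spectral_mass (isMeasure.Build _ _ _ spectral_mass spectral_mass0 spectral_mass_ge0 spectral_mass_sigma_additive).

Local Notation nuM := spectral_trace.

Lemma bm_simple (s : seq R) (A : R -> set (measurableTypeR R)) :
  (forall y, measurable (A y)) -> bm (fun r => \sum_(y <- s) y * \1_(A y) r).
Proof.
move=> mA; elim: s => [|y s ih].
  by rewrite (_ : (fun r => _) = fun=> 0); [exact: bm_cst|apply/funext => r; rewrite big_nil].
rewrite (_ : (fun r => _) = fun r => y * \1_(A y) r + \sum_(y <- s) y * \1_(A y) r).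
  by apply: bmD => //; apply: bmZ; exact: bm_indic.
by apply/funext => r; rewrite big_cons.
Qed.

Lemma tau_simple (s : seq R) (A : R -> set (measurableTypeR R)) :
  (forall y, y \in s -> 0 <= y) -> (forall y, measurable (A y)) ->
  tau (Phi (fun r => \sum_(y <- s) y * \1_(A y) r)) =
  (\int[nuM]_r (\sum_(y <- s) y * \1_(A y) r)%:E)%E.
Proof.
move=> + mA; elim: s => [_|y s ih s0].
  rewrite (_ : (fun r => _) = fun=> 0); last by apply/funext => r; rewrite big_nil.
  by rewrite tau_Phi0; under eq_integral do rewrite big_nil; rewrite integral0.
have y0 : 0 <= y by apply: s0; rewrite inE eqxx.
have s0' z : z \in s -> 0 <= z by move=> zs; apply: s0; rewrite inE zs orbT.
have b1 : bm (\1_(A y)) := bm_indic (mA y).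
have b2 := bm_simple s mA.
have i0 r : 0 <= (\1_(A y) : R -> R) r by rewrite indicE ler0n.
have t0 r : 0 <= \sum_(y <- s) y * \1_(A y) r.
  by rewrite big_seq; apply: sumr_ge0 => z zs; apply: mulr_ge0; [exact: s0'|rewrite indicE ler0n].
rewrite (_ : (fun r => _) = fun r => y * \1_(A y) r + \sum_(y <- s) y * \1_(A y) r); last first.
  by apply/funext => r; rewrite big_cons.
rewrite tau_PhiD//; [|exact: bmZ|by move=> r; rewrite mulr_ge0].
rewrite tau_PhiZ// ih// Phi_indic//.
under [RHS]eq_integral do rewrite big_cons EFinD EFinM.
rewrite ge0_integralD//.
- rewrite ge0_integralZl//.
  + by rewrite integral_indic// setIT -spectral_massE.
  + by apply/measurable_EFinP; exact: b1.1.
- by move=> r _; rewrite -EFinM lee_fin mulr_ge0.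
- by apply/measurable_EFinP; exact: (bmZ y b1).1.
- by move=> r _; rewrite lee_fin.
- by apply/measurable_EFinP; exact: b2.1.
Qed.

Import HBNNSimple.

(** Along increasing simple approximations, the left side converges by normality and the right side
    by monotone convergence. *)
Lemma tau_Phi f : bm f -> (forall r, 0 <= f r) ->
  tau (Phi f) = (\int[nuM]_r (f r)%:E)%E.
Proof.
move=> bf f0.
have mf : measurable_fun setT (EFin \o f : measurableTypeR R -> \bar R).
  by apply/measurable_EFinP; exact: bf.1.
pose g := nnsfun_approx measurableT mf.
have gE n : (fun r : R => g n r) = fun r =>
    \sum_(y <- enum_fset (fset_set (range (g n)))) y * \1_(g n @^-1` [set y]) r.
  by apply/funext => r; rewrite fimfunE fsbig_finite.
have mA n y : measurable (g n @^-1` [set y] : set (measurableTypeR R)) by [].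
have bg n : bm (fun r => g n r) by rewrite gE; exact: bm_simple.
have gc r : (fun n => g n r) @ \oo --> f r.
  have h := @cvg_nnsfun_approx _ _ _ _ measurableT _ mf (fun r _ => f0 r) r Logic.I.
  by move/fine_cvgP : h => [].
have nd r : nondecreasing_seq (fun n => g n r).
  by move=> m n mn; apply/lefP: r; exact: nd_nnsfun_approx.
rewrite (tau_Phi_sup bg)//.
have tE n : tau (Phi (fun r => g n r)) = (\int[nuM]_r (g n r)%:E)%E.
  rewrite gE tau_simple//.
    apply: eq_integral => r _; congr EFin.
    exact: (esym (congr1 (@^~ r) (gE n))).
  by move=> y; rewrite in_fset_set// inE => -[r _ <-].
rewrite (_ : (fun n => _) = fun n => (\int[nuM]_r (g n r)%:E)%E); last exact/funext.
have c : (\int[nuM]_r (g n r)%:E)%E @[n --> \oo] --> (\int[nuM]_r (f r)%:E)%E.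
  apply: ge0_monotone_cvg.
  - by move=> n; apply/measurable_EFinP; exact: (bg n).1.
  - by move=> n r; rewrite lee_fin.
  - by move=> r m n mn; rewrite lee_fin nd.
  - by move=> r; apply: cvg_EFin; [exact: nearW|exact: gc].
apply: (cvg_unique _ _ c) => //.
apply: ereal_nondecreasing_cvgn => m n mn; apply: ge0_le_integral => //.
- by move=> r _; rewrite lee_fin.
- by apply/measurable_EFinP; exact: (bg m).1.
- by apply/measurable_EFinP; exact: (bg n).1.
- by move=> r _; rewrite lee_fin nd.
Qed.

(** A1 + B2 = A2 + B1 is an identity between positive elements, to which additivity applies. *)
Lemma trace_unique (A1 B1 A2 B2 : H -> H) :
  positive_part N A1 -> positive_part N B1 -> positive_part N A2 -> positive_part N B2 ->
  (tau A1 < +oo)%E -> (tau B1 < +oo)%E -> (tau A2 < +oo)%E -> (tau B2 < +oo)%E ->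
  A1 - B1 = A2 - B2 ->
  fine (tau A1) - fine (tau B1) = fine (tau A2) - fine (tau B2).
Proof.
move=> pA1 pB1 pA2 pB2 fA1 fB1 fA2 fB2 e.
have fin T : positive_part N T -> (tau T < +oo)%E -> tau T \is a fin_num.
  by move=> pT fT; rewrite ge0_fin_numE// (trace_ge0 tr).
have : tau (A1 + B2) = tau (A2 + B1).
  congr tau; have -> : A1 = A2 - B2 + B1 by rewrite -e subrK.
  by rewrite addrAC subrK.
rewrite !(traceD tr)// => /(congr1 fine); rewrite !fineD ?fin//; lra.
Qed.

(** The positive and negative parts of f give one admissible decomposition, and [trace_unique]
    compares it with the chosen one. *)
Lemma trace_Phi f : bm f -> nuM.-integrable setT (EFin \o f) ->
  trace N tau (Phi f) = \int[nuM]_r f r.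
Proof.
move=> bf intf.
have bp : bm (f^\+).
  split; first exact: measurable_funrpos bf.1.
  have [K hK] := bf.2; exists K => r; apply: le_trans (hK r).
  by rewrite ger0_norm ?funrpos_ge0// /funrpos ge_max ler_norm normr_ge0.
have bn : bm (f^\-).
  split; first exact: measurable_funrneg bf.1.
  have [K hK] := bf.2; exists K => r; apply: le_trans (hK r).
  by rewrite ger0_norm ?funrneg_ge0// /funrneg -[leRHS]normrN ge_max ler_norm normr_ge0.
have p0 r : 0 <= f^\+ r := funrpos_ge0 f r.
have n0 r : 0 <= f^\- r := funrneg_ge0 f r.
have ip := integrable_funrpos measurableT intf.
have inn := integrable_funrneg measurableT intf.
have lt g : (forall r, 0 <= g r) -> nuM.-integrable setT (EFin \o g) ->
    (\int[nuM]_r (g r)%:E < +oo)%E.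
  by move=> g0 /(integrable_fin_num measurableT); rewrite ge0_fin_numE// integral_ge0// => r _; rewrite lee_fin.
have fE : f = fun r => f^\+ r - f^\- r.
  by rewrite -[LHS]funrposBneg.
pose r0 := fine (tau (Phi f^\+)) - fine (tau (Phi f^\-)).
have S0 : [set r | exists A B : H -> H, [/\ positive_part N A /\ (tau A < +oo)%E,
        positive_part N B /\ (tau B < +oo)%E,
        Phi f = A - B & r = fine (tau A) - fine (tau B)]] r0.
  exists (Phi f^\+), (Phi f^\-); split => //.
  - by split; [exact: Phi_pos|rewrite tau_Phi// lt].
  - by split; [exact: Phi_pos|rewrite tau_Phi// lt].
  - by apply/funext => x; rewrite {1}fE PhiB.
rewrite /trace; have [A [B [[pA fA] [pB fB] e ->]]] := xgetI 0 S0.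
have [A' [B' [[pA' fA'] [pB' fB'] e' er0]]] := S0.
rewrite (trace_unique pA pB pA' pB')//; last by rewrite -e.
rewrite -er0 /r0 !tau_Phi//.
rewrite [in RHS](_ : f = fun r => f^\+ r - f^\- r)//.
by rewrite RintegralB.
Qed.

End SpectralTrace.

(** * The operators of the statement as functions of D *)

Section StatementOperators.
Context {R : realType} {H : hilbertType R}.
Implicit Types (x : H) (f g h p : R -> R) (E : pvm H) (D : operator H) (r s t : R).

Local Notation "<[ x , y ]>" := (hdot H x y) (format "<[ x ,  y ]>").

Lemma bm_continuous f K : continuous f -> (forall r, `|f r| <= K) -> bm f.
Proof. by move=> cf hK; split; [exact: continuous_measurable_fun|exists K]. Qed.

Lemma measurable_sign_fun : measurable_fun setT (sign_fun : measurableTypeR R -> R).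
Proof.
rewrite (_ : sign_fun = fun r : R => 2 * \1_(`[0, +oo[ : set (measurableTypeR R)) r - 1).
  have m0 : measurable (`[0, +oo[%classic : set (measurableTypeR R)).
    exact: measurable_itv.
  exact: (bmB (bmZ 2 (bm_indic m0)) (bm_cst 1)).1.
apply/funext => r; rewrite /sign_fun indicE; case: ifPn => r0.
  by rewrite mem_set/= ?in_itv/= ?r0//; ring.
by rewrite memNset/= ?in_itv/= ?andbT; [ring|exact/negP].
Qed.

Lemma normr_sign_fun r : `|sign_fun r| = 1.
Proof. by rewrite /sign_fun; case: ifP; rewrite ?normrN normr1. Qed.

Lemma bm_sign_comp h : bm h -> bm (sign_fun \o h).
Proof.
move=> bh; split; first exact: (measurableT_comp measurable_sign_fun (bm_measurable bh)).
by exists 1 => r /=; rewrite normr_sign_fun.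
Qed.

Lemma measurable_cutoff : measurable_fun setT (cutoff_fun : measurableTypeR R -> R).
Proof. by apply: continuous_measurable_fun; exact: cutoff_fun_continuous. Qed.

Lemma bm_cutoff_comp h : bm h -> bm (cutoff_fun \o h).
Proof.
move=> bh; split; first exact: (measurableT_comp measurable_cutoff (bm_measurable bh)).
exists cutoff_const => r /=; rewrite ger0_norm ?cutoff_fun_ge0//.
exact: cutoff_fun_le_const.
Qed.

Lemma measurable_norm : measurable_fun setT (Num.norm : measurableTypeR R -> R).
Proof. by apply: continuous_measurable_fun; exact: norm_continuous. Qed.

Lemma bm_norm_comp h : bm h -> bm (Num.norm \o h).
Proof.
move=> bh; split; first exact: (measurableT_comp measurable_norm (bm_measurable bh)).
by have [K hK] := bh.2; exists K => r /=; rewrite normr_id.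
Qed.

Lemma sign_op_Phi E h : bm h -> sign_op (Phi E h) = Phi E (sign_fun \o h).
Proof.
by move=> bh; apply: fcalc_total_op => //; [exact: measurable_sign_fun|exact: bm_sign_comp].
Qed.

Lemma sign_path_Phi E h t : bm h ->
  sign_path (Phi E h) t = Phi E (fun r => h r + t * (sign_fun (h r) - h r)).
Proof.
move=> bh; have bs := bm_sign_comp bh; have bd := bmB bs bh.
apply/funext => x; rewrite /sign_path sign_op_Phi//.
by rewrite PhiD ?PhiZ ?PhiB//; exact: bmZ.
Qed.

Lemma cutoff_op_Phi E p : bm p ->
  cutoff_op (Phi E p) = Phi E (fun r => cutoff_fun `|1 - p r ^+ 2|).
Proof.
move=> bp; have bw := bmB (bm_cst 1) (bmX 2 bp).
rewrite /cutoff_op (_ : idfun - _ = Phi E (fun r => 1 - p r ^+ 2)); last first.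
  apply/funext => x; rewrite PhiB//; [|exact: bm_cst|exact: bmX].
  by rewrite Phi1; under [X in _ = _ - Phi _ X _]eq_fun do rewrite expr2; rewrite PhiM.
rewrite (fcalc_total_op E bw measurable_norm (bm_norm_comp bw)).
rewrite (fcalc_total_op E (bm_norm_comp bw) measurable_cutoff)//.
exact: bm_cutoff_comp (bm_norm_comp bw).
Qed.

Lemma sqrt_oneDsqr_gt0 r : 0 < Num.sqrt (1 + r ^+ 2).
Proof. by rewrite sqrtr_gt0 oneDsqr_gt0. Qed.

Lemma normr_bounded_part r : `|bounded_part r| <= 1.
Proof.
rewrite normrM (gtr0_norm (x := _^-1)) ?invr_gt0 ?sqrt_oneDsqr_gt0//.
rewrite ler_pdivrMr ?sqrt_oneDsqr_gt0// mul1r; apply: sqrt_ge => //.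
by rewrite real_normK ?num_real// lerDr.
Qed.

Lemma continuous_scale s : continuous (fun r => s * r : R).
Proof. by move=> r; apply: cvgM; [exact: cvg_cst|exact: cvg_id]. Qed.

Lemma continuous_inv_sqrt s : continuous (fun r => (Num.sqrt (1 + (s * r) ^+ 2))^-1 : R).
Proof.
move=> r; apply: cvgV; first by rewrite gt_eqF// sqrt_oneDsqr_gt0.
have c : {for r, continuous (fun r => 1 + (s * r) ^+ 2)}.
  by apply: cvgD; [exact: cvg_cst|apply: cvgM; exact: continuous_scale].
exact: (@continuous_comp _ _ _ (fun r => 1 + (s * r) ^+ 2) Num.sqrt r c (@sqrt_continuous R _)).
Qed.

Lemma bm_bounded_part s : bm (fun r => bounded_part (s * r)).
Proof.
apply: (@bm_continuous _ 1) => [r|r]; last exact: normr_bounded_part.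
by apply: cvgM; [exact: continuous_scale|exact: continuous_inv_sqrt].
Qed.

Lemma bm_inv_sqrt s : bm (fun r => (Num.sqrt (1 + (s * r) ^+ 2))^-1).
Proof.
apply: (@bm_continuous _ 1) => [|r]; first exact: continuous_inv_sqrt.
rewrite gtr0_norm ?invr_gt0 ?sqrt_oneDsqr_gt0// invf_le1 ?sqrt_oneDsqr_gt0//.
by apply: sqrt_ge => //; rewrite expr1n lerDl sqr_ge0.
Qed.

Lemma bounded_transform_Phi D E s : 0 < s -> linear_on (opdom D) (opfun D) ->
  spectral_resolution D E ->
  bounded_transform (scale_op s D) = Phi E (fun r => bounded_part (s * r)).
Proof.
move=> s0 lD sD; have ss := spectral_scale_op (lt0r_neq0 s0) sD.
have b1 := bm_inv_sqrt s.
(* This function is s^-1 times [bounded_part (s * r)]. D is applied through E itself, not through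
   its pushforward, so that both sides of the formula refer to one measure. *)
have b2 : bm (fun r => r * (Num.sqrt (1 + (s * r) ^+ 2))^-1).
  have := bmZ s^-1 (bm_bounded_part s); congr bm; apply/funext => r.
  by rewrite /bounded_part -mulrA mulKf// gt_eqF.
rewrite /bounded_transform (fcalc_push (linear_on_scale (s := s) lD) ss); [| |exact: b1].
  apply/funext => x; rewrite /= (opfun_Phi lD sD x b1 b2) -PhiZ//.
  by congr (Phi E _ x); apply/funext => r; rewrite mulrA.
have := (bm_inv_sqrt 1).1; congr measurable_fun; apply/funext => r.
by rewrite mul1r.
Qed.

(** |r| <= 1 + r^2 <= (1 + 1/t) (1 + t r^2) <= (1 + 1/t) exp(t r^2). *)
Lemma bm_xexp t : 0 < t -> bm (fun r => r * expR (- t * r ^+ 2)).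
Proof.
move=> t0; apply: (@bm_continuous _ (1 + t^-1)) => [r|r].
  apply: cvgM; first exact: cvg_id.
  have c : {for r, continuous (fun r => - t * r ^+ 2)}.
    by apply: cvgM; [exact: cvg_cst|apply: cvgM; exact: cvg_id].
  exact: (@continuous_comp _ _ _ (fun r => - t * r ^+ 2) expR r c (@continuous_expR R _)).
rewrite normrM (ger0_norm (expR_ge0 _)) mulNr expRN ler_pdivrMr ?expR_gt0//.
have h := expR_ge1Dx (t * r ^+ 2); have r0 := normr_ge0 r.
have ti : 0 < t^-1 by rewrite invr_gt0.
rewrite -(real_normK (num_real r)) in h *.
have h2 : `|r| <= 1 + `|r| ^+ 2 by move: r0; have := sqr_ge0 (`|r| - 1); rewrite !expr2; lra.
apply: le_trans h2 _; apply: (@le_trans _ _ ((1 + t^-1) * (1 + t * `|r| ^+ 2))); last first.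
  by rewrite ler_pM2l// addr_gt0.
rewrite mulrDl mul1r [leRHS]addrC mulrDr mulr1 mulKf ?gt_eqF//.
have := sqr_ge0 `|r|; have : 0 <= t * `|r| ^+ 2 by rewrite mulr_ge0 ?(ltW t0) ?sqr_ge0.
by move=> a b; lra.
Qed.

Lemma bm_exp t : 0 < t -> bm (fun r => expR (- t * r ^+ 2)).
Proof.
move=> t0; apply: (@bm_continuous _ 1) => [r|r].
  have c : {for r, continuous (fun r => - t * r ^+ 2)}.
    by apply: cvgM; [exact: cvg_cst|apply: cvgM; exact: cvg_id].
  exact: (@continuous_comp _ _ _ (fun r => - t * r ^+ 2) expR r c (@continuous_expR R _)).
rewrite ger0_norm ?expR_ge0// -expR0 ler_expR mulNr oppr_le0 mulr_ge0 ?sqr_ge0//.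
exact: ltW.
Qed.

Lemma opfun_exp_Phi D E t : 0 < t -> linear_on (opdom D) (opfun D) ->
  spectral_resolution D E ->
  opfun D \o fcalc D (fun r => expR (- t * r ^+ 2)) =
  Phi E (fun r => r * expR (- t * r ^+ 2)).
Proof.
move=> t0 lD sD; rewrite (fcalc_Phi lD sD (bm_exp t0)).
by apply/funext => x; rewrite /= (opfun_Phi lD sD)//; [exact: bm_exp|exact: bm_xexp].
Qed.

Lemma opdom_set1 D E x : linear_on (opdom D) (opfun D) -> spectral_resolution D E ->
  op_kernel D (pvm_proj E [set 0] x).
Proof.
move=> lD sD; have m0 : measurable ([set 0] : set (measurableTypeR R)) by exact: measurable_set1.
have b0 := bm_indic m0.
have e : (fun r => r * \1_([set 0] : set (measurableTypeR R)) r) = fun=> 0.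
  apply/funext => r; rewrite indicE; case: (boolP (r \in _)) => [|_]; last by rewrite mulr0.
  by rewrite inE => ->; rewrite mul0r.
have b1 : bm (fun r => r * \1_([set 0] : set (measurableTypeR R)) r).
  by rewrite e; exact: bm_cst.
rewrite -Phi_indic//; split; first exact: (opdom_Phi sD).
rewrite (opfun_Phi lD sD)// e; apply: nsq_eq0; rewrite nsq_Phi; last exact: bm_cst.
by under eq_Rintegral do rewrite expr0n/=; rewrite Rintegral_cst// mul0r.
Qed.

(** If D y = 0, then y is fixed by (1 + D^2)^-1, hence killed by 1 minus it. As 1 - 1 / (1 + r^2) is
    at most 0 only at r = 0, the growth criterion with c = 0 places y in the range of the projection
    of 0. *)
Lemma pvm_kernel D E y : linear_on (opdom D) (opfun D) -> spectral_resolution D E ->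
  op_kernel D y -> pvm_proj E [set 0] y = y.
Proof.
move=> lD sD [Dy Ty]; have [b0 _] := bm_resolvent (0 : R).
have [D0 T0] := linear_on_zero lD Dy.
have bg := bmB (bm_cst 1) b0.
have k1 r : resolvent_kernel 0 r <= 1.
  by rewrite /resolvent_kernel invf_le1 ?lerDl ?sqr_ge0// ltr_pwDl// sqr_ge0.
have ky : Phi E (resolvent_kernel 0) y = y.
  have [d1 d2 e1] := Phi_resolventP lD sD 0 y.
  apply/eqP; rewrite -subr_eq0; apply/eqP.
  have [d3 e3] := linear_onB lD d1 Dy.
  have [d4 e4] := linear_onB lD d2 D0; rewrite T0 in e4.
  apply: (resolvent_inj lD sD (a := 0)) => //; rewrite e3 Ty //.
  rewrite e4 !scalerBr addr_sub3 e1 scaler0 subr0 add0r expr0n addr0 scale1r.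
  by rewrite subrr.
have gy : Phi E (fun r => 1 - resolvent_kernel 0 r) y = 0.
  by rewrite PhiB//; [rewrite Phi1 ky subrr|exact: bm_cst].
rewrite (_ : [set 0] = sublevel (fun r => 1 - resolvent_kernel 0 r) 0); last first.
  apply/seteqP; rewrite /sublevel /resolvent_kernel; split => r /=.
    by move=> ->; rewrite subrr expr0n addr0 invr1 subrr.
  rewrite subr0 subr_le0 => h; apply/eqP; rewrite -sqrf_eq0 eq_le sqr_ge0 andbT.
  have p : 0 < 1 + r ^+ 2 by rewrite ltr_pwDl// sqr_ge0.
  by move: h; rewrite -[leRHS]mul1r ler_pdivlMr// mul1r gerDl.
apply: (pvm_superlevel0 bg) => m m0.
apply: (superlevel_null bg _ (lexx 0) m0) => [r|[|n]]; first by rewrite subr_ge0.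
  by rewrite expr0 expr1n mul1r.
rewrite iterSr gy expr0n expr0n mul0r.
have -> : iter n (Phi E (fun r => 1 - resolvent_kernel 0 r)) 0 = 0.
  elim: n => // n ih; rewrite iterS ih.
  exact: linear_op0 (Phi_linear E bg).
by rewrite nsq0.
Qed.

(** Two candidates differ at x by a vector that lies in the kernel and is orthogonal to it. *)
Lemma projection_on_kernel D E : linear_on (opdom D) (opfun D) ->
  spectral_resolution D E -> projection_on (op_kernel D) = pvm_proj E [set 0].
Proof.
move=> lD sD; have m0 : measurable ([set 0] : set (measurableTypeR R)) by exact: measurable_set1.
have S0 : [set P : H -> H | forall x, op_kernel D (P x) /\
    forall y, op_kernel D y -> <[x - P x, y]> = 0] (pvm_proj E [set 0]).
  move=> x; split; first exact: opdom_set1.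
  move=> y ky; rewrite -[y in <[_, y]>](pvm_kernel lD sD ky) -pvm_adj//.
  by rewrite (linear_opB _ _ (pvm_linear E m0)) pvm_idem// subrr hdot0l.
have := xgetI 0 S0; rewrite -/(projection_on _); set Q := projection_on _ => hQ.
apply/funext => x; have [[dQ kQ] oQ] := hQ x; have [[dP kP] oP] := S0 x.
have [dd ed] := linear_onB lD dQ dP.
apply/eqP; rewrite -subr_eq0; apply/eqP/nsq_eq0.
have kd : op_kernel D (Q x - pvm_proj E [set 0] x).
  by split => //; rewrite ed kQ kP subrr.
have e : Q x - pvm_proj E [set 0] x = (x - pvm_proj E [set 0] x) - (x - Q x).
    by rewrite opprB [RHS]addrC addrA subrK.
by rewrite /nsq {1}e hdotBl oP// oQ// subrr.
Qed.

End StatementOperators.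

(** * Exchange of the integrals *)

Section Kernels.
Context {R : realType}.
Notation mu := (@lebesgue_measure R).
Implicit Types (q r s t : R).

Definition eta_kernel r t := r * expR (- t * r ^+ 2) * t `^ (- 2^-1).

Definition cutoff_kernel q t :=
  (sign_fun q - q) * cutoff_fun `|1 - (q + t * (sign_fun q - q)) ^+ 2|.

Definition signed_tail s r := sign_fun r * gauss_tail (s * `|r|).

Lemma integral_oppr (D : set R) (f : R -> R) (c : R) : measurable D ->
  (forall t, D t -> 0 <= f t) ->
  (\int[mu]_(t in D) (f t)%:E = c%:E)%E ->
  (\int[mu]_(t in D) (- f t)%:E = (- c)%:E)%E.
Proof.
move=> mD f0 fc; rewrite EFinN -fc -integral_ge0N; last by move=> t Dt; rewrite lee_fin f0.
by apply: eq_integral => t _; rewrite EFinN.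
Qed.

(* At r = 0 the left-hand side vanishes while 2 * signed_tail is sqrt pi, because
   sign_fun 0 = 1: this is where the kernel of D enters the formula. *)
Lemma eta_kernel_integral r (e : R) : 0 < e ->
  (\int[mu]_(t in `[e, +oo[) (eta_kernel r t)%:E =
   (2 * signed_tail (Num.sqrt e) r - Num.sqrt pi * \1_[set (0 : R)] r)%:E)%E.
Proof.
move=> e0; rewrite /eta_kernel /signed_tail /sign_fun indicE.
case: (ltrgt0P r) => [r0|r0|->].
- rewrite memNset; last by move=> /= h; rewrite h ltxx in r0.
  by rewrite gauss_tail_integral// mul1r mulr0 subr0.
- rewrite memNset; last by move=> /= h; rewrite h ltxx in r0.
  have nr0 : 0 < - r by rewrite oppr_gt0.
  rewrite mulr0 subr0 mulN1r mulrN -(integral_oppr _ _ (gauss_tail_integral nr0 e0))//.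
    by apply: eq_integral => t _; rewrite sqrrN; congr EFin; ring.
  by move=> t _; rewrite mulr_ge0 ?powR_ge0// mulr_ge0 ?expR_ge0// ltW.
- rewrite mem_set//= mulr0 gauss_tail0 mul1r mulr1 mulrC divfK// subrr.
  by under eq_integral do rewrite !mul0r; rewrite integral0.
Qed.

Lemma bounded_partN r : bounded_part (- r) = - bounded_part r.
Proof. by rewrite /bounded_part sqrrN mulNr. Qed.

Lemma sign_funN r : r != 0 -> sign_fun (- r) = - sign_fun r.
Proof.
rewrite /sign_fun oppr_ge0 leNgt; case: (ltrgt0P r) => //= r0 _; by rewrite opprK.
Qed.

(** Oddness reduces everything to r >= 0. The value 0 is excluded because [sign_fun 0 = 1]. *)
Lemma cutoff_kernelN q t : q != 0 -> cutoff_kernel (- q) t = - cutoff_kernel q t.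
Proof.
move=> q0; rewrite /cutoff_kernel sign_funN//.
rewrite (_ : - q + t * (- sign_fun q - - q) = - (q + t * (sign_fun q - q))); last by ring.
by rewrite sqrrN; ring.
Qed.

(** The path stays in [p, 1], so 1 - u^2 lies between 0 and 1 - p^2 = 1 / (1 + r^2), and the
    absolute value disappears. *)
Lemma cutoff_kernel_ge0E r t : 0 <= r -> 0 <= t <= 1 ->
  let p := bounded_part r in
  [/\ 0 <= p <= 1, 0 <= 1 - (p + t * (1 - p)) ^+ 2 <= (1 + r ^+ 2)^-1 &
   cutoff_kernel p t = (1 - p) * cutoff_fun (1 - (p + t * (1 - p)) ^+ 2)].
Proof.
move=> r0 /andP[t0 t1] p.
have p0 : 0 <= p by rewrite divr_ge0// sqrtr_ge0.
have p1 : p <= 1 by rewrite -(ger0_norm p0) normr_bounded_part.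
have w : 0 <= 1 - (p + t * (1 - p)) ^+ 2 <= (1 + r ^+ 2)^-1.
  rewrite -bounded_part_sqr -/p.
  have h1 : p <= p + t * (1 - p) by rewrite lerDl mulr_ge0// subr_ge0.
  have h2 : p + t * (1 - p) <= 1 by nra.
  by rewrite !expr2; apply/andP; split; nra.
split; [by rewrite p0|by []|].
rewrite /cutoff_kernel /sign_fun p0 ger0_norm//.
by have /andP[] := w.
Qed.

(** The Gaussian bound, uniform in t, that dominates the integrand in Fubini. *)
Lemma cutoff_kernel_ge0 r t : 0 <= r -> 0 <= t <= 1 ->
  0 <= cutoff_kernel (bounded_part r) t <= cutoff_const * expR (- (1 + r ^+ 2) / 2).
Proof.
move=> r0 t01; have [/andP[p0 p1] /andP[w0 w1] ->] := cutoff_kernel_ge0E r0 t01.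
have c0 := cutoff_fun_ge0 (1 - (bounded_part r + t * (1 - bounded_part r)) ^+ 2).
apply/andP; split; first by rewrite mulr_ge0// subr_ge0.
apply: (@le_trans _ _ (cutoff_fun (1 - (bounded_part r + t * (1 - bounded_part r)) ^+ 2))).
  by rewrite ler_piMl// lerBlDr lerDl.
have K0 : 0 <= cutoff_const * expR (- (1 + r ^+ 2) / 2) :> R.
  by rewrite mulr_ge0 ?expR_ge0.
move: w0 w1; move: (1 - _) => w; rewrite le_eqVlt => /predU1P[<- _|w0 w1].
  by rewrite /cutoff_fun ltxx.
apply: le_trans (cutoff_fun_le w0) _; rewrite ler_wpM2l ?expR_ge0// ler_expR.
rewrite !mulNr lerN2 ler_wpM2r ?invr_ge0//.
by rewrite -[leLHS]invrK lef_pV2 ?posrE// invr_gt0 oneDsqr_gt0.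
Qed.

Lemma normr_cutoff_kernel r t : 0 <= t <= 1 ->
  `|cutoff_kernel (bounded_part r) t| <= cutoff_const * expR (- (1 + r ^+ 2) / 2).
Proof.
move=> t01; have [r0|r0] := leP 0 r.
  by have /andP[k0 k1] := cutoff_kernel_ge0 r0 t01; rewrite ger0_norm.
have nr0 : 0 <= - r by rewrite oppr_ge0 ltW.
have := cutoff_kernel_ge0 nr0 t01; rewrite sqrrN bounded_partN cutoff_kernelN; last first.
  by rewrite mulf_neq0 ?(lt_eqF r0)// invr_eq0 gt_eqF// sqrtr_gt0 oneDsqr_gt0.
by move=> /andP[k0 k1]; rewrite -normrN ger0_norm.
Qed.

Lemma cutoff_kernel_integral_ge0 r : 0 <= r ->
  (\int[mu]_(t in `[0%R, 1%R]) (cutoff_kernel (bounded_part r) t)%:E =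
   (expR (-1) * gauss_tail r)%:E)%E.
Proof.
move=> r0; rewrite -cutoff_integral//; apply: eq_integral => t.
rewrite inE/= in_itv/= => t01.
by have [_ _ ->] := cutoff_kernel_ge0E r0 t01.
Qed.

Lemma cutoff_kernel_integral s r : 0 < s ->
  (\int[mu]_(t in `[0%R, 1%R]) (cutoff_kernel (bounded_part (s * r)) t)%:E =
   (expR (-1) * signed_tail s r)%:E)%E.
Proof.
move=> s0; rewrite /signed_tail /sign_fun; case: ifPn => [r0|]; [|rewrite -ltNge => r0].
  by rewrite mul1r ger0_norm// cutoff_kernel_integral_ge0// mulr_ge0// ltW.
have a0 : 0 <= s * - r by rewrite mulr_ge0 ?oppr_ge0 ?(ltW r0) ?(ltW s0).
rewrite ltr0_norm// mulN1r mulrN.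
rewrite -(integral_oppr _ _ (cutoff_kernel_integral_ge0 a0))//; last first.
  by move=> t; rewrite /= in_itv/= => /(cutoff_kernel_ge0 a0)/andP[].
apply: eq_integral => t _; rewrite mulrN bounded_partN cutoff_kernelN ?opprK//.
rewrite /bounded_part !mulf_neq0 ?(lt_eqF r0) ?(gt_eqF s0)// invr_eq0 gt_eqF//.
by rewrite sqrtr_gt0 oneDsqr_gt0.
Qed.

Lemma measurable_eta_kernel : measurable_fun setT
  (fun z : measurableTypeR R * measurableTypeR R => eta_kernel z.1 z.2 : R).
Proof.
rewrite /eta_kernel; apply: measurable_funM.
  apply: measurable_funM; first exact: measurable_fst.
  apply: measurableT_comp; first exact: measurable_expR.
  apply: measurable_funM.
    by apply: measurableT_comp; [exact: oppr_measurable|exact: measurable_snd].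
  by apply: measurable_funX; exact: measurable_fst.
by apply: (measurableT_comp (measurable_powR _)); exact: measurable_snd.
Qed.

Lemma measurable_cutoff_kernel s : measurable_fun setT
  (fun z : measurableTypeR R * measurableTypeR R =>
     cutoff_kernel (bounded_part (s * z.1)) z.2 : R).
Proof.
have m1 : measurable_fun setT (fun z : measurableTypeR R * measurableTypeR R =>
    bounded_part (s * z.1) : R).
  by apply: (measurableT_comp (bm_measurable (bm_bounded_part s))); exact: measurable_fst.
have m2 : measurable_fun setT (fun z : measurableTypeR R * measurableTypeR R =>
    sign_fun (bounded_part (s * z.1)) - bounded_part (s * z.1) : R).
  by apply: measurable_funB => //; apply: (measurableT_comp measurable_sign_fun).
rewrite /cutoff_kernel; apply: measurable_funM => //.
apply: (measurableT_comp measurable_cutoff).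
apply: (measurableT_comp measurable_norm).
apply: measurable_funB; first exact: measurable_cst.
apply: measurable_funX; apply: measurable_funD => //.
by apply: measurable_funM => //; exact: measurable_snd.
Qed.

(** The tail is e times an integral over [0, 1] of the cutoff kernel, so it inherits the pointwise
    bound of that kernel. *)
Lemma gauss_tail_bound r : 0 <= r ->
  0 <= gauss_tail r <= expR 1 * (cutoff_const * expR (- (1 + r ^+ 2) / 2)).
Proof.
move=> r0; have I := cutoff_kernel_integral_ge0 r0.
have e1 : gauss_tail r = expR 1 * (expR (-1) * gauss_tail r).
  by rewrite mulrA -expRD subrr expR0 mul1r.
suff /andP[h0 h1] : 0 <= expR (-1) * gauss_tail r <= cutoff_const * expR (- (1 + r ^+ 2) / 2).
  by rewrite e1; apply/andP; split; [rewrite mulr_ge0 ?expR_ge0|rewrite ler_wpM2l ?expR_ge0].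
have k0 (t : R) : `[0, 1]%classic t -> (0 <= (cutoff_kernel (bounded_part r) t)%:E)%E.
  by rewrite /= in_itv/= lee_fin => /(cutoff_kernel_ge0 r0)/andP[].
rewrite -!lee_fin -I; apply/andP; split; first exact: integral_ge0.
set b := (X in (_ <= X%:E)%E).
have <- : (\int[mu]_(t in `[0%R, 1%R]) (cst b%:E t) = b%:E)%E.
  by rewrite integral_cst//= lebesgue_measure_itv/= lte_fin ltr01 -EFinB subr0 mule1.
apply: ge0_le_integral => //.
- apply/measurable_EFinP; apply: measurable_funTS.
  have := measurable_cutoff_kernel 1 => /(measurableT_comp)/(_ (pair1_measurable r)).
  by rewrite /comp/= mul1r.
- by move=> t; rewrite /= in_itv/= lee_fin => /(cutoff_kernel_ge0 r0)/andP[].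
Qed.

End Kernels.

(** * Integrals against a measure for which all Gaussians are integrable *)

Section Integration.
Context {R : realType}.
Notation mu := (@lebesgue_measure R).
Implicit Types (r s t : R).
Variable nu : {measure set (measurableTypeR R) -> \bar R}.
Hypothesis nu_exp : forall t, 0 < t -> (\int[nu]_r (expR (- t * r ^+ 2))%:E < +oo)%E.

Lemma measurable_expsq t :
  measurable_fun setT (fun r : measurableTypeR R => expR (- t * r ^+ 2) : R).
Proof.
apply: (measurableT_comp (@measurable_expR _)).
by apply: measurable_funM => //; apply: measurable_funX; exact: measurable_idR.
Qed.

Lemma exp_integrable t : 0 < t -> nu.-integrable setT (EFin \o (fun r => expR (- t * r ^+ 2))).
Proof.
move=> t0; apply/integrableP; split.
  by apply/measurable_EFinP; exact: measurable_expsq.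
apply: le_lt_trans (nu_exp t0); rewrite le_eqVlt; apply/orP; left; apply/eqP.
by apply: eq_integral => r _ /=; rewrite ger0_norm ?expR_ge0.
Qed.

(** Markov's inequality on [-n, n], where exp(- r^2) is at least exp(- n^2). *)
Lemma exp_sigma_finite : sigma_finite setT nu.
Proof.
exists sym_itv.
  apply/seteqP; split => // r _; exists (Num.truncn `|r|).+1 => //.
  rewrite /sym_itv /= in_itv/=; have := truncnS_gt `|r|.
  by have := ler_norm r; have := ler_norm (- r); rewrite normrN => ? ? ?; apply/andP; split; lra.

  move=> n; split; first exact: measurable_sym_itv.
  have mr := @measurable_expsq 1.
  have b0 r : (0 <= (expR (- 1 * r ^+ 2))%:E)%E by rewrite lee_fin expR_ge0.
  have : (\int[nu]_(r in sym_itv n) (cst (expR (- 1 * n%:R ^+ 2))%:E r) < +oo)%E.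
    apply: le_lt_trans (nu_exp ltr01).
    apply: (@le_trans _ _ (\int[nu]_(r in sym_itv n) (expR (- 1 * r ^+ 2))%:E)%E).
    + apply: ge0_le_integral => //.
      * exact: measurable_sym_itv.
      * by move=> r _; rewrite lee_fin expR_ge0.
      * by apply/measurable_EFinP; exact: measurable_funTS.
      * move=> r; rewrite /sym_itv/= in_itv/= => /andP[r1 r2]; rewrite /cst lee_fin ler_expR.
        rewrite !mulN1r lerN2 -(@real_normK _ r) ?num_real// lerXn2r ?nnegrE//.
        by rewrite ler_norml r1.
    + apply: ge0_subset_integral => //; first exact: measurable_sym_itv.
      by apply/measurable_EFinP.
  rewrite integral_cst; last exact: measurable_sym_itv.
  case: (nu (sym_itv n)) (measure_ge0 nu (sym_itv n)) => //= [x _ _|_]; first exact: ltry.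
  by rewrite gt0_muley// lte_fin expR_gt0.
Qed.
Lemma integrable_exp_bound (f : R -> R) (K t : R) : 0 < t ->
  measurable_fun setT (f : measurableTypeR R -> R) ->
  (forall r, `|f r| <= K * expR (- t * r ^+ 2)) ->
  nu.-integrable setT (EFin \o f).
Proof.
move=> t0 mf fK.
have K0 : 0 <= K.
  by have := le_trans (normr_ge0 _) (fK 0); rewrite expr0n/= mulr0 expR0 mulr1.
apply: (le_integrable measurableT _ _ (integrableZl measurableT K (exp_integrable t0))).
- exact/measurable_EFinP.
- by move=> r _ /=; rewrite lee_fin (le_trans (fK r))// ler_norm.
Qed.

Lemma xexp_integrable t : 0 < t ->
  nu.-integrable setT (EFin \o (fun r => r * expR (- t * r ^+ 2))).
Proof.
move=> t0; have t20 : 0 < t / 2 by rewrite divr_gt0.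
have [K hK] := (bm_xexp t20).2.
apply: (@integrable_exp_bound _ K _ t20); first exact: (bm_measurable (bm_xexp t0)).
(* Half of the exponent bounds the factor r, the other half stays integrable. *)
move=> r; rewrite (_ : - t * r ^+ 2 = - (t / 2) * r ^+ 2 + - (t / 2) * r ^+ 2); last by field.
by rewrite expRD mulrA normrM [X in _ * X]ger0_norm ?expR_ge0// ler_wpM2r ?expR_ge0.
Qed.

Lemma expR_shift s r : expR (- (1 + (s * r) ^+ 2) / 2) =
  expR (- 2^-1) * expR (- (s ^+ 2 / 2) * r ^+ 2).
Proof. by rewrite -expRD; congr expR; field. Qed.

Lemma half_sqr_gt0 s : 0 < s -> 0 < s ^+ 2 / 2.
Proof. by move=> s0; rewrite divr_gt0// exprn_gt0. Qed.

Lemma normr_signed_tail s r : 0 < s -> `|signed_tail s r| <=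
  expR 1 * (cutoff_const * expR (- (1 + (s * r) ^+ 2) / 2)).
Proof.
move=> s0; rewrite normrM normr_sign_fun mul1r.
have /gauss_tail_bound/andP[h0 h1] : 0 <= s * `|r| by rewrite mulr_ge0// ltW.
rewrite ger0_norm//; apply: le_trans h1 _.
by rewrite !exprMn real_normK ?num_real.
Qed.

Lemma measurable_signed_tail s :
  measurable_fun setT (signed_tail s : measurableTypeR R -> R).
Proof.
apply: measurable_funM; first exact: measurable_sign_fun.
have c : continuous (gauss_tail : R -> R).
  move=> x; apply: cvgB; first exact: cvg_cst.
  exact: is_derive_continuous (is_derive_gauss_primitive x).
apply: (measurableT_comp (continuous_measurable_fun c)).
by apply: measurable_funM => //; exact: measurable_norm.
Qed.

Lemma signed_tail_integrable s : 0 < s ->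
  nu.-integrable setT (EFin \o signed_tail s).
Proof.
move=> s0.
apply: (@integrable_exp_bound _ (expR 1 * (cutoff_const * expR (- 2^-1))) _ (half_sqr_gt0 s0)).
  exact: measurable_signed_tail.
by move=> r; apply: le_trans (normr_signed_tail r s0) _; rewrite expR_shift !mulrA.
Qed.

Lemma cutoff_kernel_integrable s t : 0 < s -> 0 <= t <= 1 ->
  nu.-integrable setT (EFin \o (fun r => cutoff_kernel (bounded_part (s * r)) t)).
Proof.
move=> s0 t01.
apply: (@integrable_exp_bound _ (cutoff_const * expR (- 2^-1)) _ (half_sqr_gt0 s0)).
  exact: (measurableT_comp (measurable_cutoff_kernel s) (pair2_measurable t)).
by move=> r; apply: le_trans (normr_cutoff_kernel _ t01) _; rewrite expR_shift mulrA.
Qed.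

Lemma Rintegral_EFin (f : R -> R) : nu.-integrable setT (EFin \o f) ->
  (\int[nu]_r f r)%:E = (\int[nu]_r (f r)%:E)%E.
Proof. by move=> fi; rewrite /Rintegral fineK//; exact: integrable_fin_num. Qed.

Lemma cutoff_trace_integral s : 0 < s ->
  (\int[mu]_(t in `[0%R, 1%R])
     (\int[nu]_r cutoff_kernel (bounded_part (s * r)) t)%R%:E =
   (expR (-1) * \int[nu]_r signed_tail s r)%:E)%E.
Proof.
move=> s0.
transitivity (\int[mu]_(t in `[0%R, 1%R])
    \int[nu]_r (cutoff_kernel (bounded_part (s * r)) t)%:E)%E.
  apply: eq_integral => t; rewrite inE/= in_itv/= => t01.
  by rewrite Rintegral_EFin//; exact: cutoff_kernel_integrable.
pose K := cutoff_const * expR (- 2^-1) : R.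
rewrite (@kernel_swap _ nu _ (fun r t => cutoff_kernel (bounded_part (s * r)) t)
  (fun r => K * expR (- (s ^+ 2 / 2) * r ^+ 2))).
- rewrite EFinM Rintegral_EFin; last exact: signed_tail_integrable.
  rewrite -integralZl//; last exact: signed_tail_integrable.
  by apply: eq_integral => r _; rewrite cutoff_kernel_integral// EFinM.
- exact: exp_sigma_finite.
- exact: measurable_itv.
- exact: measurable_cutoff_kernel.
- exact: (integrableZl measurableT K (exp_integrable (half_sqr_gt0 s0))).
move=> r; set b := (X in (_ <= X%:E)%E).
have <- : (\int[mu]_(t in `[0%R, 1%R]) (cst b%:E t) = b%:E)%E.
  by rewrite integral_cst//= lebesgue_measure_itv/= lte_fin ltr01 -EFinB subr0 mule1.
apply: ge0_le_integral => //.
- apply/measurable_EFinP; apply: measurable_funTS; apply: (measurableT_comp measurable_norm).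
  exact: (measurableT_comp (measurable_cutoff_kernel s) (pair1_measurable r)).
- move=> t; rewrite /= in_itv/= lee_fin => t01; apply: le_trans (normr_cutoff_kernel _ t01) _.
  by rewrite expR_shift /b mulrA.
Qed.

(** The indicator is at most exp(- r^2). Hence the projection on the kernel has finite trace, and
    the subtraction in the theorem never meets +oo - +oo. *)
Lemma indic0_integrable : nu.-integrable setT (EFin \o (\1_[set (0 : R)] : R -> R)).
Proof.
apply: (@integrable_exp_bound _ 1 _ ltr01); first exact: (bm_indic (measurable_set1 (0 : R))).1.
move=> r; rewrite indicE mul1r; have [->|r0] := eqVneq r 0.
  by rewrite mem_set// normr1 expr0n mulr0 expR0.
by rewrite memNset ?normr0 ?expR_ge0//; exact/eqP.
Qed.

Lemma nu_set0 : nu [set (0 : R)] = (\int[nu]_r (\1_[set (0 : R)] r)%:E)%E.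
Proof. by rewrite integral_indic ?setIT//; exact: measurable_set1. Qed.

Lemma nu_set0_fin : nu [set (0 : R)] \is a fin_num.
Proof. by rewrite nu_set0; exact: integrable_fin_num indic0_integrable. Qed.

Lemma normr_eta_kernel r t : `|eta_kernel r t| = eta_kernel `|r| t.
Proof.
rewrite /eta_kernel !normrM (ger0_norm (powR_ge0 _ _)) (ger0_norm (expR_ge0 _)).
by rewrite real_normK ?num_real.
Qed.

Lemma eta_integral (e : R) : 0 < e ->
  (\int[mu]_(t in `[e, +oo[)
     ((\int[nu]_r (r * expR (- t * r ^+ 2))) * t `^ (- 2^-1))%R%:E =
   2%:E * (\int[nu]_r signed_tail (Num.sqrt e) r)%R%:E
   - (Num.sqrt pi)%:E * nu [set 0%R])%E.
Proof.
move=> e0; have s0 : 0 < Num.sqrt e by rewrite sqrtr_gt0.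
transitivity (\int[mu]_(t in `[e, +oo[) \int[nu]_r (eta_kernel r t)%:E)%E.
  apply: eq_integral => t; rewrite inE/= in_itv/= andbT => et.
  have t0 : 0 < t := lt_le_trans e0 et.
  rewrite EFinM Rintegral_EFin; last exact: xexp_integrable.
  by rewrite -integralZr//; exact: xexp_integrable.
pose K := expR 1 * (cutoff_const * expR (- 2^-1)) : R.
rewrite (@kernel_swap _ nu _ eta_kernel
  (fun r => (2 * K) * expR (- (Num.sqrt e ^+ 2 / 2) * r ^+ 2))).
- rewrite Rintegral_EFin; last exact: signed_tail_integrable.
  rewrite -integralZl//; last exact: signed_tail_integrable.
  rewrite nu_set0 -integralZl//; last exact: indic0_integrable.
  rewrite -integralB//; last 2 first.
  - exact: integrableZl (signed_tail_integrable s0).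
  - exact: integrableZl indic0_integrable.
  by apply: eq_integral => r _; rewrite eta_kernel_integral.
- exact: exp_sigma_finite.
- exact: measurable_itv.
- exact: measurable_eta_kernel.
- exact: (integrableZl measurableT (2 * K) (exp_integrable (half_sqr_gt0 s0))).
(* The absolute value replaces r by |r|, so the exact formula for the integral also bounds it, by
   twice the tail. *)
move=> r; under eq_integral do rewrite normr_eta_kernel.
rewrite eta_kernel_integral// lee_fin lerBlDr.
apply: (@le_trans _ _ (2 * (K * expR (- (Num.sqrt e ^+ 2 / 2) * r ^+ 2)))).
  rewrite ler_pM2l//; apply: le_trans (ler_norm _) _.
  apply: le_trans (normr_signed_tail _ s0) _.
  by rewrite expR_shift /K real_normK ?num_real// !mulrA.
by rewrite mulrA lerDl mulr_ge0// ?sqrtr_ge0// indicE ler0n.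
Qed.

End Integration.

Theorem theorem8p9 (R : realType) (H : hilbertType R)
    (N : set (H -> H)) (tau : (H -> H) -> \bar R)
    (vnN : von_neumann_algebra N) (sepN : separable_predual N)
    (trtau : faithful_normal_semifinite_trace N tau)
    (D : operator H) (thD : theta_summable N tau D)
    (eps : R) (eps_gt0 : 0 < eps) :
  (2^-1%:E * truncated_eta N tau eps D =
   gamma0 N tau (scale_op (Num.sqrt eps) D)
   - 2^-1%:E * tau (projection_on (op_kernel D)))%E.
Proof.
have [[lD denseD adjD] affD expD] := thD.
(* Theta-summability supplies a spectral resolution for each t; the one at t = 1 is fixed once and
   for all. *)
have [_ [E spE _] _] := expD 1 ltr01.
have s_gt0 : 0 < Num.sqrt eps by rewrite sqrtr_gt0.
set s := Num.sqrt eps in s_gt0 *.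
pose PhiN := @Phi_in_vna R H N D E vnN lD affD spE.
pose nu := spectral_trace trtau PhiN.
(* The finite trace is that of an operator built from a resolution E' that may vary with t; [fcalc]
   is the common name through which it equals [Phi E]. *)
have nu_exp (t : R) : 0 < t -> (\int[nu]_r (expR (- t * r ^+ 2))%:E < +oo)%E.
  move=> t0; have [T [E' spE' [mf lT iT TE]] Tfin] := expD t t0.
  rewrite -(tau_Phi trtau PhiN (bm_exp t0)); last by move=> r; exact: expR_ge0.
  rewrite -(fcalc_Phi lD spE (bm_exp t0)).
  by rewrite (is_fcalc_Phi lD spE' mf iT lT TE).
have kerE : tau (projection_on (op_kernel D)) = nu [set (0 : R)].
  rewrite (projection_on_kernel lD spE); apply/esym/spectral_massE; exact: (measurable_set1 (0 : R)).
have etaE : truncated_eta N tau eps D =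
    ((Num.sqrt pi)^-1%:E * (2%:E * (\int[nu]_r signed_tail s r)%R%:E
      - (Num.sqrt pi)%:E * nu [set 0%R]))%E.
  rewrite /truncated_eta -eta_integral//; congr (_ * _)%E.
  apply: eq_integral => t; rewrite inE/= in_itv/= andbT => et.
  have t0 : 0 < t := lt_le_trans eps_gt0 et.
  rewrite (opfun_exp_Phi t0 lD spE) (trace_Phi (tr:=trtau) (PhiN:=PhiN) (bm_xexp t0))//.
  exact: xexp_integrable.
have gammaE : gamma0 N tau (scale_op s D) =
    ((expR 1 / Num.sqrt pi)%:E * (expR (-1) * \int[nu]_r signed_tail s r)%:E)%E.
  rewrite /gamma0 (bounded_transform_Phi s_gt0 lD spE) -cutoff_trace_integral//.
  have bp := @bm_bounded_part R s.
  congr (_ * _)%E; apply: eq_integral => t; rewrite inE/= in_itv/= => t01; congr EFin.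
  have bd := bmB (bm_sign_comp bp) bp.
  have bu := bmD bp (bmZ t bd).
  have bw := bmB (bm_cst 1) (bmX 2 bu).
  rewrite (sign_path_Phi _ _ bp) (sign_op_Phi _ bp) (cutoff_op_Phi _ bu).
  rewrite -(trace_Phi (tr:=trtau) (PhiN:=PhiN) (bmM bd (bm_cutoff_comp (bm_norm_comp bw)))).
    congr trace; apply/funext => x /=.
    by rewrite (PhiM E x bd (bm_cutoff_comp (bm_norm_comp bw))) (PhiB _ _ (bm_sign_comp bp) bp).
  exact: (cutoff_kernel_integrable nu_exp s_gt0 t01).
have q0 : Num.sqrt pi != 0 :> R by rewrite gt_eqF// sqrtr_gt0 pi_gt0.
have e0 : expR 1 != 0 :> R by rewrite gt_eqF// expR_gt0.
(* Finiteness of the mass at 0 brings the identity down to real numbers, where the factor e of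
   [gamma0] cancels exp(-1). *)
rewrite kerE etaE gammaE; move: (nu_set0_fin nu_exp); case: (nu [set _]) => [z||] // _.
rewrite -!EFinM. rewrite -!EFinB. congr EFin.
by rewrite expRN; field; rewrite q0 e0.
Qed.
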